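(* There exists a continuous deformation (a continuous $1$-parameter family of surfaces) consisting exactly of the zero mean curvature surfaces with planar curvature lines in isotropic $3$-space $\mathbb{I}^3$, up to isometries and homotheties of $\mathbb{I}^3$. That is, there is a family of surfaces depending continuously on one real parameter such that every member of the family is a zero mean curvature surface with planar curvature lines, and every zero mean curvature immersion with planar curvature lines is, up to isometries and homotheties of $\mathbb{I}^3$, a piece of a member of the family.
   Context: Isotropic space: $\mathbb{R}^{3,1}$ is Minkowski $4$-space with bilinear form $\langle\cdot,\cdot\rangle$ of signature $(-+++)$, $\mathcal{L}=\{Y:\langle Y,Y\rangle=0\}$, $\mathfrak{p}=(1,0,0,1)^t\in\mathcal{L}$, and $\mathbb{I}^3=\{Y\in\mathbb{R}^{3,1}:\langle Y,\mathfrak{p}\rangle=0\}=\{(\mathbf l,\mathbf x,\mathbf y,\mathbf l)^t\}$, with degenerate induced metric $d\mathbf x^2+d\mathbf y^2$; it is identified with coordinate space $\{(\mathbf l,\mathbf x,\mathbf y)\}$. Isometries of $\mathbb{I}^3$ are compositions of translations of $\mathbb{I}^3$ and the restrictions to $\mathbb{I}^3$ of $A\in\mathrm{SO}(3,1)$ with $A\mathfrak p=\mathfrak p$; homotheties are the maps $Y\mapsto\lambda Y$, $\lambda\in\mathbb{R}\setminus\{0\}$. Surfaces: $\Sigma$ is a simply-connected domain and $X:\Sigma\to\mathbb{I}^3$ is a spacelike immersion (the induced metric is Riemannian), with conformal coordinates $z=u+iv$ and $ds^2=e^{2\omega}(du^2+dv^2)$. The lightlike Gauss map $n:\Sigma\to\mathcal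 L$ is the unique map with $\langle dX,n\rangle=0$, $\langle n,\mathfrak p\rangle=1$. Put $L=\langle X_{uu},n\rangle$, $M=\langle X_{uv},n\rangle$, $N=\langle X_{vv},n\rangle$. The mean curvature is $H=\tfrac12e^{-2\omega}(L+N)$, the second fundamental form is $L\,du^2+2M\,du\,dv+N\,dv^2$, and zero mean curvature means $H\equiv0$. Curvature lines are the lines of principal directions of the second fundamental form with respect to the induced metric; the surface has planar curvature lines if every curvature line lies in an affine plane of $\mathbb{I}^3$ (planes are counted as such surfaces). Continuity: a family $(X_t)_{t\in I}$, $I\subset\mathbb{R}$ an interval, of surfaces parametrized over a common domain of $\mathbb{C}$ is a continuous deformation if, for each $t_0\in I$, $X_t\to X_{t_0}$ as $t\to t_0$ uniformly, component-wise, on compact subdomains. Members of the family may fail to be immersed at isolated points of the domain; the conditions on them are imposed where they are immersed. ''A piece of'' means: after reparametrization, a restriction of. *)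

(* Defs.v *)
From HB Require Import structures.
From mathcomp Require Import all_boot all_order all_algebra.
From mathcomp Require Import all_classical all_reals all_analysis.

Set Implicit Arguments.
Unset Strict Implicit.
Unset Printing Implicit Defensive.

Import Order.TTheory GRing.Theory Num.Theory.
Import numFieldNormedType.Exports.

Local Open Scope classical_set_scope.
Local Open Scope ring_scope.

(* C^oo: all iterated directional derivatives of [f], in arbitrary constant
   directions, are (Frechet) differentiable at every point of [U].  Only used
   with [U] open, where it depends on the values of [f] on [U] only. *)
Definition smooth_on (R : realType) (V W : normedModType R) (U : set V)
    (f : V -> W) : Prop :=
  forall (vs : seq V) (x : V), U x ->
    differentiable (foldr (fun v (g : V -> W) => 'D_v g) f vs : V -> W) x.

Definition immersed_at (R : realType) (V W : normedModType R) (f : V -> W)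
    (x : V) : Prop :=
  differentiable f x /\ forall v : V, v != 0 -> 'D_v f x != 0.

Section PlaneDomains.
Variable R : realType.

(* The complex coordinate z = u + iv is the pair (u, v). *)
Definition domain (U : set (R * R)) : Prop :=
  [/\ open U, connected U & U !=set0].

(* Every loop in [U] is freely homotopic, within [U], to a constant loop. *)
Definition simply_connected (U : set (R * R)) : Prop :=
  connected U /\
  forall c : R -> R * R,
    {within `[0, 1], continuous c} -> c @` `[0, 1] `<=` U -> c 0 = c 1 ->
    exists h : R * R -> R * R,
      [/\ {within `[0, 1] `*` `[0, 1], continuous h},
          h @` (`[0, 1] `*` `[0, 1]) `<=` U,
          (forall s, s \in `[0, 1] -> h (s, 0) = c s),
          (forall s, s \in `[0, 1] -> h (s, 1) = h (0, 1)) &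
          (forall t, t \in `[0, 1] -> h (0, t) = h (1, t))].

End PlaneDomains.

Section IsotropicSpace.
Variable R : realType.

Definition minkowski_mx : 'M[R]_4 :=
  diag_mx (\row_i (if i == 0 then -1 else 1)).

Definition mink (Y Z : 'cV[R]_4) : R := (Y^T *m minkowski_mx *m Z) 0 0.

Definition lightcone : set 'cV[R]_4 := [set Y | mink Y Y = 0].

Definition pvec : 'cV[R]_4 :=
  \col_i (if (i == 0) || (i == ord_max) then 1 else 0).

Definition I3 : set 'cV[R]_4 := [set Y | mink Y pvec = 0].

Definition SO31 (A : 'M[R]_4) : Prop :=
  A^T *m minkowski_mx *m A = minkowski_mx /\ \det A = 1.

(* The generators preserve [I3]; only their restrictions to [I3] matter. *)
Inductive isometry_I3 : ('cV[R]_4 -> 'cV[R]_4) -> Prop :=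
| isometry_translation b : I3 b -> isometry_I3 (fun Y => Y + b)
| isometry_linear A : SO31 A -> A *m pvec = pvec ->
    isometry_I3 (fun Y => A *m Y)
| isometry_comp f g : isometry_I3 f -> isometry_I3 g ->
    isometry_I3 (fun Y => f (g Y)).

Definition affine_plane_I3 (P : set 'cV[R]_4) : Prop :=
  exists a b c : 'cV[R]_4,
    [/\ I3 a, I3 b, I3 c, free [:: b; c] &
        P = [set Y | exists s t : R, Y = a + s *: b + t *: c]].

End IsotropicSpace.

Arguments pvec {R}.
Arguments I3 {R}.
Arguments lightcone {R}.

Section Surfaces.
Variable R : realType.
Implicit Types (X : R * R -> 'cV[R]_4) (z v w : R * R) (U : set (R * R)).

Definition X_u X : R * R -> 'cV[R]_4 := 'D_((1, 0) : R * R) X.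
Definition X_v X : R * R -> 'cV[R]_4 := 'D_((0, 1) : R * R) X.

Definition first_form X z v w : R := mink ('D_v X z) ('D_w X z).

(* ds^2 = e^{2 omega} (du^2 + dv^2) on [U]; in particular the induced metric
   is Riemannian there and [X] is an immersion. *)
Definition conformal_on U X : Prop :=
  exists omega : R * R -> R, forall z, U z -> forall v w,
    first_form X z v w = expR (2 * omega z) * (v.1 * w.1 + v.2 * w.2).

Definition is_gauss_vector X z (n : 'cV[R]_4) : Prop :=
  [/\ lightcone n, forall v, mink ('D_v X z) n = 0 & mink n pvec = 1].

(* At a point where [X], with values in [I3], is a spacelike immersion there
   is exactly one such vector; [0] is a default value elsewhere. *)
Definition gauss_map X z : 'cV[R]_4 := xget 0 [set n | is_gauss_vector X z n].

Definition L_coef X z : R := mink (X_u (X_u X) z) (gauss_map X z).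
Definition M_coef X z : R := mink (X_v (X_u X) z) (gauss_map X z).
Definition N_coef X z : R := mink (X_v (X_v X) z) (gauss_map X z).

(* For conformal [X], e^{2 omega} is the value of the metric on (d/du, d/du). *)
Definition mean_curvature X z : R :=
  2^-1 * (first_form X z (1, 0) (1, 0))^-1 * (L_coef X z + N_coef X z).

Definition second_form X z v w : R :=
  L_coef X z * (v.1 * w.1) + M_coef X z * (v.1 * w.2 + v.2 * w.1)
  + N_coef X z * (v.2 * w.2).

Definition principal_direction X z v : Prop :=
  v != 0 /\ exists k : R, forall w,
    second_form X z v w = k * first_form X z v w.

(* At an umbilic every direction is principal, so for a planar surface every
   regular curve is a curvature line. *)
Definition curvature_line U X (a b : R) (c : R -> R * R) : Prop :=
  smooth_on `]a, b[ c /\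
  forall s, s \in `]a, b[ -> U (c s) /\ principal_direction X (c s) (derive1 c s).

Definition planar_curvature_lines U X : Prop :=
  forall (a b : R) (c : R -> R * R), a < b -> curvature_line U X a b c ->
    exists2 P, affine_plane_I3 P & forall s, s \in `]a, b[ -> P (X (c s)).

Definition zmc_planar_on U X : Prop :=
  [/\ smooth_on U X, (forall z, U z -> I3 (X z)), conformal_on U X,
      (forall z, U z -> mean_curvature X z = 0) & planar_curvature_lines U X].

(* [D] being open, the third condition says that the points of [D] where [X] is
   not immersed do not accumulate in [D]. *)
Definition zmc_planar_member (D : set (R * R)) X : Prop :=
  [/\ smooth_on D X, (forall z, D z -> I3 (X z)),
      (forall z, D z -> \forall w \near z^', immersed_at X w) &
      zmc_planar_on [set z | D z /\ immersed_at X z] X].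

Definition continuous_deformation (I : interval R) (D : set (R * R))
    (X_ : R -> R * R -> 'cV[R]_4) : Prop :=
  forall t0, t0 \in I -> forall K : set (R * R), compact K -> K `<=` D ->
    {uniform K, X_ t @[t --> within [set` I] (nbhs t0)] --> X_ t0}.

(* Up to an isometry and a homothety of [I3], [X] on [S] is a reparametrization
   of a restriction of [Y] on [D].  An immersion [X] may cover parts of its
   image several times (z |-> (0, e^z) in the coordinates (l, x + iy), say), so
   the change of parameters [psi] is a local diffeomorphism; it is injective,
   hence a diffeomorphism onto an open subset of [D], whenever [X] is. *)
Definition congruent_to_piece_of (S : set (R * R)) X (D : set (R * R))
    (Y : R * R -> 'cV[R]_4) : Prop :=
  exists (Phi : 'cV[R]_4 -> 'cV[R]_4) (lambda : R) (psi : R * R -> R * R),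
    [/\ isometry_I3 Phi, lambda != 0,
        smooth_on S psi /\ (forall z, S z -> immersed_at psi z),
        psi @` S `<=` D &
        forall z, S z -> X z = Phi (lambda *: Y (psi z))].

End Surfaces.

(* Main.v *)
Require Import Defs.
From HB Require Import structures.
From mathcomp Require Import all_boot all_order all_algebra.
From mathcomp Require Import all_classical all_reals all_analysis.
From mathcomp Require Import complex ring lra.
Set Implicit Arguments.
Unset Strict Implicit.
Unset Printing Implicit Defensive.
Import Order.TTheory GRing.Theory Num.Theory.
Import numFieldNormedType.Exports.
Local Open Scope classical_set_scope.
Local Open Scope ring_scope.
Local Open Scope complex_scope.

(* A conformal zero mean curvature immersion has, up to a reflection of the
   (x, y)-plane, the form X = (Re (int P dz), W) in the coordinates (l, x + iy),
   with P and f = W' holomorphic and f without zeros; its second fundamental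
   form is Re (Q dz^2) with Q = P' - P f' / f.  Let ' stand for the derivative
   with respect to zeta = int sqrt Q dz, and put rho = f / sqrt Q.  The curvature
   lines are the coordinate lines of zeta, and differentiating the equation of
   a plane three times along one of them shows that, when they are planar,
   K = (2 rho rho'' - rho'^2) / rho^2 is real, hence a real constant.  This ODE
   controls Q' by Q (a Gronwall estimate), so either Q = 0, which gives a plane,
   or Q has no zeros and zeta is globally defined, S being simply connected.
   Then rho is a combination of exp (+- sqrt K zeta) and 1 if K <> 0, and the
   square of an affine function or a constant if K = 0.  Normalizing by
   isometries, homotheties and changes of zeta leaves the two one-parameter
   families of models F_b and G_b (b >= 0), which are joined through planes. *)

(** With m = al P / f + be, the equation [al * l + Re (be * W) = d] of a plane differentiates along
    a curvature line to Re (m rho) = 0. Since m' = al / rho, the next two derivatives are al + Re (m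
    rho') = 0 and al Re (rho' / rho) + Re (m rho'') = 0; eliminating al and m leaves Im K = 0. Once
    K is constant, the nonlinear ODE differentiates to the linear equation rho''' = K rho', and what
    it says beyond this is that the resulting quadratic polynomial in exp (sqrt K zeta) has a double
    root. Hence the square in w' = e^(-z) (e^z + b)^2: F_b is branched where e^z = - b, at isolated
    points. The argument of the remaining coefficient goes into a rotation, so that b >= 0. The
    Gronwall estimate rests on the first integral rho'' - K rho, which stays bounded up to a zero of
    Q, where zeta and rho degenerate. Since planes are members of the family, F_0 and G_0 can each
    be flattened by scaling the height, and no limit of K tending to 0 is taken. *)

Notation Re := complex.Re.
Notation Im := complex.Im.

(** * Complex numbers as pairs of reals *)

Lemma cplx_eq (R : realType) (a b : R[i]) : Re a = Re b -> Im a = Im b -> a = b.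
Proof. by case: a b => [x y] [z t] /= -> ->. Qed.

Lemma ReD (R : realType) (a b : R[i]) : Re (a + b) = Re a + Re b.
Proof. by case: a b => [x y] [z t]. Qed.
Lemma ImD (R : realType) (a b : R[i]) : Im (a + b) = Im a + Im b.
Proof. by case: a b => [x y] [z t]. Qed.
Lemma ReN (R : realType) (a : R[i]) : Re (- a) = - Re a.
Proof. by case: a. Qed.
Lemma ImN (R : realType) (a : R[i]) : Im (- a) = - Im a.
Proof. by case: a. Qed.
Lemma ReM (R : realType) (a b : R[i]) : Re (a * b) = Re a * Re b - Im a * Im b.
Proof. by case: a b => [x y] [z t]. Qed.
Lemma ImM (R : realType) (a b : R[i]) : Im (a * b) = Re a * Im b + Im a * Re b.
Proof. by case: a b => [x y] [z t]. Qed.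

Definition ReImE := (ReD, ImD, ReN, ImN, ReM, ImM).

Definition normsq (R : realType) (a : R[i]) : R := Re a ^+ 2 + Im a ^+ 2.

Lemma normsq_ge0 (R : realType) (a : R[i]) : 0 <= normsq a.
Proof. by rewrite addr_ge0 ?sqr_ge0. Qed.

Lemma normsq_eq0 (R : realType) (a : R[i]) : (normsq a == 0) = (a == 0).
Proof. by rewrite paddr_eq0 ?sqr_ge0// !sqrf_eq0 eq_complex. Qed.

Lemma normsq_gt0 (R : realType) (a : R[i]) : (0 < normsq a) = (a != 0).
Proof. by rewrite lt0r normsq_eq0 normsq_ge0 andbT. Qed.

Lemma normsq_root (R : realType) (a : R[i]) : a != 0 -> exists2 n : R, 0 < n & n ^+ 2 = normsq a.
Proof.
by move=> a0; exists (Num.sqrt (normsq a)); rewrite ?sqrtr_gt0 ?normsq_gt0// sqr_sqrtr ?normsq_ge0.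
Qed.

Lemma normsqM (R : realType) (a b : R[i]) : normsq (a * b) = normsq a * normsq b.
Proof. rewrite /normsq !ReImE; ring. Qed.

Lemma ReV (R : realType) (a : R[i]) : Re a^-1 = Re a / normsq a.
Proof. by case: a. Qed.
Lemma ImV (R : realType) (a : R[i]) : Im a^-1 = - (Im a / normsq a).
Proof. by case: a. Qed.

(** * Differentiability of complex-valued functions *)

Section CDiff.
Variables (R : realType) (V : normedModType R).
Implicit Types (z : V) (F G dF dG : V -> R[i]).

(* [R[i]] is used without any topology, differentiability being that of the real
   and imaginary parts. *)
Definition cdiff z F dF : Prop :=
  is_diff z (@complex.Re R \o F) (@complex.Re R \o dF) /\
  is_diff z (@complex.Im R \o F) (@complex.Im R \o dF).

Lemma cdiff_eq z F dF dG : cdiff z F dF -> dF =1 dG -> cdiff z F dG.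
Proof. by move=> h /funext <-. Qed.

Lemma cdiff_cst z (a : R[i]) : cdiff z (cst a) (cst 0).
Proof. by split; [exact: (is_diff_cst (Re a) z)|exact: (is_diff_cst (Im a) z)]. Qed.

Lemma cdiffD z F G dF dG : cdiff z F dF -> cdiff z G dG ->
  cdiff z (fun x => F x + G x) (fun h => dF h + dG h).
Proof.
move=> [F1 F2] [G1 G2]; split.
- have -> : @complex.Re R \o (fun x => F x + G x) =
    (@complex.Re R \o F) + (@complex.Re R \o G) by apply/funext => x/=; rewrite ReD.
  by apply: is_diff_eq; apply/funext => x/=; rewrite ReD.
- have -> : @complex.Im R \o (fun x => F x + G x) =
    (@complex.Im R \o F) + (@complex.Im R \o G) by apply/funext => x/=; rewrite ImD.
  by apply: is_diff_eq; apply/funext => x/=; rewrite ImD.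
Qed.

Lemma cdiffM z F G dF dG : cdiff z F dF -> cdiff z G dG ->
  cdiff z (fun x => F x * G x) (fun h => dF h * G z + F z * dG h).
Proof.
move=> [F1 F2] [G1 G2]; split.
- have -> : @complex.Re R \o (fun x => F x * G x) =
    (@complex.Re R \o F) * (@complex.Re R \o G)
    - (@complex.Im R \o F) * (@complex.Im R \o G) by apply/funext => x/=; rewrite ReM.
  apply: (is_diff_eq (is_diffB (is_diffM F1 G1) (is_diffM F2 G2))); apply/funext => x/=; rewrite !fctE !ReImE /= /GRing.scale/=; ring.
- have -> : @complex.Im R \o (fun x => F x * G x) =
    (@complex.Re R \o F) * (@complex.Im R \o G)
    + (@complex.Im R \o F) * (@complex.Re R \o G) by apply/funext => x/=; rewrite ImM.
  apply: (is_diff_eq (is_diffD (is_diffM F1 G2) (is_diffM F2 G1))); apply/funext => x/=; rewrite !fctE !ReImE /= /GRing.scale/=; ring.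
Qed.

Lemma cdiffN z F dF : cdiff z F dF -> cdiff z (fun x => - F x) (fun h => - dF h).
Proof.
move=> [F1 F2]; split.
- have -> : @complex.Re R \o (fun x => - F x) =
    - (@complex.Re R \o F) by apply/funext => x/=; rewrite ReN.
  by apply: is_diff_eq; apply/funext => x/=; rewrite ReN.
- have -> : @complex.Im R \o (fun x => - F x) =
    - (@complex.Im R \o F) by apply/funext => x/=; rewrite ImN.
  by apply: is_diff_eq; apply/funext => x/=; rewrite ImN.
Qed.

Lemma cdiffB z F G dF dG : cdiff z F dF -> cdiff z G dG ->
  cdiff z (fun x => F x - G x) (fun h => dF h - dG h).
Proof. by move=> hF hG; exact: (cdiffD hF (cdiffN hG)). Qed.

Lemma is_diff_real_comp (g : R -> R) (g' : R) z (f df : V -> R) :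
  is_diff z f df -> is_derive (f z) 1 g g' ->
  is_diff z (g \o f) (fun h => df h * g').
Proof.
move=> hf [g1 g2].
have dg : differentiable g (f z) by exact/derivable1_diffP.
have hg : is_diff (f z) g ( *:%R^~ g').
  by apply: DiffDef => //; rewrite deriv1E// derive1E g2.
by apply: (is_diff_eq (is_diff_comp hf hg)); apply/funext.
Qed.

Lemma is_diffV_real z (f df : V -> R) : is_diff z f df -> f z != 0 ->
  is_diff z (fun x => (f x)^-1) (fun h => - (f z) ^- 2 * df h).
Proof.
move=> hf f0.
have hg : is_derive (f z) 1 (@GRing.inv R) (- (f z) ^- 2).
  have := @is_derive_id R R (f z) 1.
  move=> hid; split; first by apply: (@derivableV R R id).
  by rewrite (@deriveV R R id)// derive_id /GRing.scale/= mulr1.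
by apply: (is_diff_eq (is_diff_real_comp hf hg)); apply/funext => h; rewrite mulrC.
Qed.

Lemma is_diff_normsq z F dF : cdiff z F dF ->
  is_diff z (fun x => normsq (F x)) (fun h => 2 * Re (F z) * Re (dF h) + 2 * Im (F z) * Im (dF h)).
Proof.
move=> [F1 F2].
have -> : (fun x => normsq (F x)) = (@complex.Re R \o F) * (@complex.Re R \o F)
  + (@complex.Im R \o F) * (@complex.Im R \o F) by apply/funext.
apply: (is_diff_eq (is_diffD (is_diffM F1 F1) (is_diffM F2 F2))).
by apply/funext => x/=; rewrite !fctE /= /GRing.scale/=; ring.
Qed.

Lemma cdiffV z F dF : cdiff z F dF -> F z != 0 ->
  cdiff z (fun x => (F x)^-1) (fun h => - (dF h / F z ^+ 2)).
Proof.
move=> [F1 F2] F0.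
have n0 : normsq (F z) != 0 by rewrite normsq_eq0.
have hV := is_diffV_real (is_diff_normsq (conj F1 F2)) n0.
(* Replacing 1 / F by its conjugate over [normsq] turns the real and imaginary parts into real
   rational functions. *)
have E h : - (dF h / F z ^+ 2) =
  - (dF h * (((Re (F z)) +i* (- Im (F z)))) ^+2 * ((normsq (F z))^-1%:C) ^+ 2).
  congr (- _).
  have -> : (Re (F z) +i* - Im (F z)) = (normsq (F z))%:C / F z.
    apply: (mulIf F0); rewrite -mulrA mulVf// mulr1.
    by apply: cplx_eq; rewrite !ReImE /= /normsq; ring.
  have n1 : (normsq (F z))%:C != 0 by rewrite eq_complex /= eqxx andbT.
  have -> : ((normsq (F z))^-1)%:C = ((normsq (F z))%:C)^-1.
    by rewrite -fmorphV.
  by field; apply/andP.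
apply: cdiff_eq; last by move=> h; rewrite E.
split.
- have -> : @complex.Re R \o (fun x => (F x)^-1) =
    (@complex.Re R \o F) * (fun x => (normsq (F x))^-1).
    by apply/funext => x/=; rewrite ReV.
  apply: (is_diff_eq (is_diffM F1 hV)); apply/funext => x/=.
  rewrite !fctE !expr2 !ReImE /= /GRing.scale/= /normsq; field.
  by move: n0; rewrite /normsq.
- have -> : @complex.Im R \o (fun x => (F x)^-1) =
    - ((@complex.Im R \o F) * (fun x => (normsq (F x))^-1)).
    by apply/funext => x/=; rewrite ImV.
  apply: (is_diff_eq (is_diffN (is_diffM F2 hV))); apply/funext => x/=.
  rewrite !fctE !expr2 !ReImE /= /GRing.scale/= /normsq; field.
  by move: n0; rewrite /normsq.
Qed.

Definition cexp (a : R[i]) : R[i] := (expR (Re a) * cos (Im a)) +i* (expR (Re a) * sin (Im a)).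

Lemma cdiff_exp z F dF : cdiff z F dF ->
  cdiff z (fun x => cexp (F x)) (fun h => dF h * cexp (F z)).
Proof.
move=> [F1 F2].
have he := is_diff_real_comp F1 (is_derive_expR (Re (F z))).
have hc := is_diff_real_comp F2 (is_derive_cos (Im (F z))).
have hs := is_diff_real_comp F2 (is_derive_sin (Im (F z))).
split.
- have -> : @complex.Re R \o (fun x => cexp (F x)) =
    (expR \o (@complex.Re R \o F)) * (cos \o (@complex.Im R \o F)) by [].
  apply: (is_diff_eq (is_diffM he hc)); apply/funext => x/=.
  rewrite !fctE !ReImE /= /GRing.scale/=; ring.
- have -> : @complex.Im R \o (fun x => cexp (F x)) =
    (expR \o (@complex.Re R \o F)) * (sin \o (@complex.Im R \o F)) by [].
  apply: (is_diff_eq (is_diffM he hs)); apply/funext => x/=.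
  rewrite !fctE !ReImE /= /GRing.scale/=; ring.
Qed.

Lemma cexpD (a b : R[i]) : cexp (a + b) = cexp a * cexp b.
Proof.
by apply: cplx_eq; rewrite !ReImE /= !ReImE expRD ?cosD ?sinD; ring.
Qed.

Lemma cexp0 : cexp 0 = 1.
Proof. by apply: cplx_eq; rewrite /= ?sin0 ?cos0 expR0 ?mulr1 ?mulr0. Qed.

Lemma cexpN (a : R[i]) : cexp (- a) = (cexp a)^-1.
Proof.
have h : cexp a * cexp (- a) = 1 by rewrite -cexpD subrr cexp0.
have a0 : cexp a != 0 by apply: contra_eq_neq h => ->; rewrite mul0r eq_sym oner_eq0.
by apply: (mulfI a0); rewrite h mulfV.
Qed.

Lemma cexp_neq0 (a : R[i]) : cexp a != 0.
Proof.
have h : cexp a * cexp (- a) = 1 by rewrite -cexpD subrr cexp0.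
by apply: contra_eq_neq h => ->; rewrite mul0r eq_sym oner_eq0.
Qed.

Lemma is_diff_near (W : normedModType R) z (f g df : V -> W) :
  is_diff z f df -> (\forall x \near z, f x = g x) -> is_diff z g df.
Proof.
move=> [df1 df2] fg.
have fz : f z = g z by exact: nbhs_singleton fg.
have cd : continuous ('d f z) by exact: (diff_continuous df1).
have E : g \o shift z = cst (g z) + 'd f z +o_ 0 id.
  have := diff_locallyx df1.
  move=> h.
  apply/eqaddoP => _/posnumP[e].
  have : f \o shift z = cst (f z) + 'd f z +o_ 0 id by exact: diff_locally.
  move/eqaddoP => /(_ e%:num (gt0 e)) H.
  have S : shift z x @[x --> (0:V)] --> z.
    by rewrite -{2}(add0r z); apply: cvgD; [exact: cvg_id|exact: cvg_cst].
  have S' := S _ fg.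
  have S2 : \forall x \near (0:V), f (x + z) = g (x + z) by exact: S'.
  apply: filterS2 S2 H => x /= e1.
  by rewrite !fctE /= -e1 -fz.
have du := diff_unique cd E.
have dg : differentiable g z.
  by apply/diff_locallyP; rewrite du; split.
by apply: DiffDef; [exact: dg|rewrite du].
Qed.

Lemma cdiff_near z F G dF : cdiff z F dF -> (\forall x \near z, F x = G x) -> cdiff z G dF.
Proof.
by move=> [F1 F2] FG; split; [apply: (is_diff_near F1)|apply: (is_diff_near F2)];
  apply: filterS FG => x /= ->.
Qed.

End CDiff.
Lemma cdiff_comp (R : realType) (V W : normedModType R) z (F dF : W -> R[i]) (g dg : V -> W) :
  is_diff z g dg -> cdiff (g z) F dF -> cdiff z (F \o g) (dF \o dg).
Proof. by move=> hg [F1 F2]; split; exact: is_diff_comp. Qed.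

(** * Holomorphic functions *)

Section Hol.
Variable R : realType.
Implicit Types (z : R * R) (F G : R * R -> R[i]) (U : set (R * R)).

Definition cz z : R[i] := z.1 +i* z.2.
Definition pt (a : R[i]) : R * R := (Re a, Im a).

Lemma czK : cancel cz pt. Proof. by case. Qed.
Lemma ptK : cancel pt cz. Proof. by case. Qed.
Lemma czD z w : cz (z + w) = cz z + cz w. Proof. by apply: cplx_eq. Qed.
Lemma czN z : cz (- z) = - cz z. Proof. by apply: cplx_eq. Qed.
Lemma czZ (k : R) z : cz (k *: z) = k%:C * cz z.
Proof. by apply: cplx_eq; rewrite /= !(mul0r, subr0, addr0). Qed.

Lemma fst_diff z : is_diff z (@fst R R) (@fst R R).
Proof.
have c : continuous (@fst R R) by move=> x; exact: cvg_fst.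
by apply: DiffDef; [exact: linear_differentiable|exact: diff_lin].
Qed.
Lemma snd_diff z : is_diff z (@snd R R) (@snd R R).
Proof.
have c : continuous (@snd R R) by move=> x; exact: cvg_snd.
by apply: DiffDef; [exact: linear_differentiable|exact: diff_lin].
Qed.

Lemma cdiff_cz z : cdiff z cz cz.
Proof. by split; [exact: fst_diff|exact: snd_diff]. Qed.

(* [G] is the complex derivative of [F] on [U]. *)
Definition hol U F G := forall z, U z -> cdiff z F (fun h => G z * cz h).

(** Total, so that it can be iterated; it agrees with the complex derivative wherever there is one
    ([hol_cD]). *)
Definition cD F z : R[i] :=
  ('D_((1, 0) : R * R) (@complex.Re R \o F) z) +i*
  ('D_((1, 0) : R * R) (@complex.Im R \o F) z).

Lemma is_diff_derive (V W : normedModType R) (f df : V -> W) x v :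
  is_diff x f df -> 'D_v f x = df v.
Proof. by move=> [d1 <-]; rewrite deriveE. Qed.

Lemma cdiff_derive_Re (V : normedModType R) (f df : V -> R[i]) x v :
  cdiff x f df -> 'D_v (@complex.Re R \o f) x = Re (df v).
Proof. by move=> [h1 h2]; rewrite (is_diff_derive _ h1). Qed.

Lemma cdiff_derive_Im (V : normedModType R) (f df : V -> R[i]) x v :
  cdiff x f df -> 'D_v (@complex.Im R \o f) x = Im (df v).
Proof. by move=> [h1 h2]; rewrite (is_diff_derive _ h2). Qed.

Lemma cz10 : cz (1, 0) = 1. Proof. by []. Qed.
Lemma cz01 : cz (0, 1) = 'i. Proof. by []. Qed.

Lemma cdiff_cD z F a : cdiff z F (fun h => a * cz h) -> cD F z = a.
Proof.
move=> h; apply: cplx_eq; rewrite /= ?(cdiff_derive_Re _ h) ?(cdiff_derive_Im _ h);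
by rewrite cz10 mulr1.
Qed.

Lemma hol_cD U F G z : hol U F G -> U z -> cD F z = G z.
Proof. by move=> h /h /cdiff_cD. Qed.

Lemma hol_eqr U F G G' : {in U, G =1 G'} -> hol U F G -> hol U F G'.
Proof.
move=> e h z Uz; apply: cdiff_eq (h z Uz) _ => v.
by rewrite e// inE.
Qed.

Lemma hol_eq U F F' G G' : open U -> {in U, F =1 F'} -> {in U, G =1 G'} ->
  hol U F G -> hol U F' G'.
Proof.
move=> oU e1 e2 h; apply: (hol_eqr e2) => z Uz.
apply: cdiff_near (h z Uz) _.
have := open_nbhs_nbhs (conj oU Uz).
by apply: filterS => x /mem_set /e1.
Qed.

(* Infinite complex differentiability is part of the notion, so that no Cauchy
   theory is needed. *)
Definition Hol U F := forall n, hol U (iter n cD F) (iter n.+1 cD F).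

Lemma hol_sub U U' F G : U' `<=` U -> hol U F G -> hol U' F G.
Proof. by move=> s h z /s /h. Qed.

Lemma Hol_sub U U' F : U' `<=` U -> Hol U F -> Hol U' F.
Proof. by move=> s h n; exact: hol_sub (h n). Qed.

Lemma Hol_hol U F : Hol U F -> hol U F (cD F).
Proof. by move=> h; exact: (h 0%N). Qed.

Lemma Hol_cD U F : Hol U F -> Hol U (cD F).
Proof. by move=> h n; rewrite -!iterSr; exact: h. Qed.

(** By induction every iterate of [cD] agrees on [U] with a member of the class [P]; since [U] is
    open, this agreement can be differentiated. *)
Lemma Hol_coind U (P : (R * R -> R[i]) -> Prop) F : open U ->
  (forall F, P F -> exists2 G, P G & hol U F G) -> P F -> Hol U F.
Proof.
move=> oU H PF.
have K n : exists2 G, P G & {in U, iter n cD F =1 G}.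
  elim: n => [|n [G PG e]]; first by exists F.
  have [G' PG' h] := H _ PG.
  exists G' => // z /[!inE] Uz /=; rewrite -(hol_cD h Uz).
  apply: cdiff_cD; apply: cdiff_near (_ : \forall x \near z, G x = iter n cD F x).
    by have := h z Uz; rewrite (hol_cD h Uz).
  have := open_nbhs_nbhs (conj oU Uz).
  by apply: filterS => x /mem_set /e.
move=> n; have [G PG e] := K n; have [G' PG' h] := H _ PG.
apply: (@hol_eq _ G _ G') => // z; rewrite !inE => Uz.
  by rewrite e// inE.
rewrite /= -(hol_cD h Uz); apply/esym/cdiff_cD.
apply: cdiff_near (_ : \forall x \near z, G x = iter n cD F x).
  by have := h z Uz; rewrite (hol_cD h Uz).
have := open_nbhs_nbhs (conj oU Uz).
by apply: filterS => x /mem_set /e.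
Qed.

(* The closure rules of [Hol] are proved all at once, because the derivative of a
   product or of a quotient is again built with several of these operations. *)
Inductive holgen U : (R * R -> R[i]) -> Prop :=
| holgen_atom F : Hol U F -> holgen U F
| holgen_cst a : holgen U (cst a)
| holgen_add F G : holgen U F -> holgen U G -> holgen U (fun z => F z + G z)
| holgen_opp F : holgen U F -> holgen U (fun z => - F z)
| holgen_mul F G : holgen U F -> holgen U G -> holgen U (fun z => F z * G z)
| holgen_inv F : holgen U F -> (forall z, U z -> F z != 0) ->
    holgen U (fun z => (F z)^-1)
| holgen_exp F : holgen U F -> holgen U (fun z => cexp (F z))
| holgen_ext F G : holgen U F -> {in U, F =1 G} -> holgen U G.

Section holrules.
Variable U : set (R * R).

Lemma hol_cst a : hol U (cst a) (cst 0).
Proof. by move=> z _; apply: cdiff_eq (cdiff_cst z a) _ => h; rewrite /= mul0r. Qed.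

Lemma holD F G F' G' : hol U F F' -> hol U G G' ->
  hol U (fun z => F z + G z) (fun z => F' z + G' z).
Proof.
by move=> hF hG z Uz; apply: cdiff_eq (cdiffD (hF _ Uz) (hG _ Uz)) _ => h; rewrite mulrDl.
Qed.

Lemma holN F F' : hol U F F' -> hol U (fun z => - F z) (fun z => - F' z).
Proof. by move=> hF z Uz; apply: cdiff_eq (cdiffN (hF _ Uz)) _ => h; rewrite mulNr. Qed.

Lemma holB F G F' G' : hol U F F' -> hol U G G' ->
  hol U (fun z => F z - G z) (fun z => F' z - G' z).
Proof. by move=> hF hG; exact: (holD hF (holN hG)). Qed.

Lemma holM F G F' G' : hol U F F' -> hol U G G' ->
  hol U (fun z => F z * G z) (fun z => F' z * G z + F z * G' z).
Proof.
move=> hF hG z Uz; apply: cdiff_eq (cdiffM (hF _ Uz) (hG _ Uz)) _ => h; ring.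
Qed.

Lemma hol_inv F F' : hol U F F' -> (forall z, U z -> F z != 0) ->
  hol U (fun z => (F z)^-1) (fun z => - (F' z / F z ^+ 2)).
Proof.
move=> hF F0 z Uz; apply: cdiff_eq (cdiffV (hF _ Uz) (F0 _ Uz)) _ => h.
by rewrite mulNr mulrAC.
Qed.

Lemma hol_exp F F' : hol U F F' ->
  hol U (fun z => cexp (F z)) (fun z => F' z * cexp (F z)).
Proof. by move=> hF z Uz; apply: cdiff_eq (cdiff_exp (hF _ Uz)) _ => h; rewrite mulrAC. Qed.

Lemma hol_cz : hol U cz (cst 1).
Proof. by move=> z Uz; apply: cdiff_eq (cdiff_cz z) _ => h; rewrite /= mul1r. Qed.

Hypothesis oU : open U.

Lemma holgen_Hol F : holgen U F -> Hol U F.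
Proof.
move=> hF; apply: (Hol_coind oU (P := holgen U)) => // {hF}F.
elim=> {F}.
- by move=> F hF; exists (cD F); [apply/holgen_atom/Hol_cD|exact: Hol_hol].
- by move=> a; exists (cst 0); [exact: holgen_cst|exact: hol_cst].
- move=> F G _ [F' hF1 hF2] _ [G' hG1 hG2].
  by exists (fun z => F' z + G' z); [exact: holgen_add|exact: holD].
- move=> F _ [F' hF1 hF2].
  by exists (fun z => - F' z); [exact: holgen_opp|exact: holN].
- move=> F G hF [F' hF1 hF2] hG [G' hG1 hG2].
  exists (fun z => F' z * G z + F z * G' z); last exact: holM.
  by apply: holgen_add; exact: holgen_mul.
- move=> F hF [F' hF1 hF2] F0.
  exists (fun z => - (F' z / F z ^+ 2)); last exact: hol_inv.
  apply: holgen_opp; apply: holgen_mul => //.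
  apply: (holgen_inv (F := fun z => F z * F z)); first exact: holgen_mul.
  by move=> z Uz; rewrite mulf_neq0 ?F0.
- move=> F hF [F' hF1 hF2].
  exists (fun z => F' z * cexp (F z)); last exact: hol_exp.
  by apply: holgen_mul => //; exact: holgen_exp.
- move=> F G hF [F' hF1 hF2] e; exists F' => //.
  exact: hol_eq hF2.
Qed.

Lemma Hol_cst a : Hol U (cst a).
Proof. exact/holgen_Hol/holgen_cst. Qed.
Lemma HolD F G : Hol U F -> Hol U G -> Hol U (fun z => F z + G z).
Proof. by move=> hF hG; apply/holgen_Hol/holgen_add; exact/holgen_atom. Qed.
Lemma HolN F : Hol U F -> Hol U (fun z => - F z).
Proof. by move=> hF; apply/holgen_Hol/holgen_opp; exact/holgen_atom. Qed.
Lemma HolB F G : Hol U F -> Hol U G -> Hol U (fun z => F z - G z).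
Proof. by move=> hF hG; exact: (HolD hF (HolN hG)). Qed.
Lemma HolM F G : Hol U F -> Hol U G -> Hol U (fun z => F z * G z).
Proof. by move=> hF hG; apply/holgen_Hol/holgen_mul; exact/holgen_atom. Qed.
Lemma HolV F : Hol U F -> (forall z, U z -> F z != 0) -> Hol U (fun z => (F z)^-1).
Proof. by move=> hF hG; apply/holgen_Hol/holgen_inv => //; exact/holgen_atom. Qed.
Lemma Hol_exp F : Hol U F -> Hol U (fun z => cexp (F z)).
Proof. by move=> hF; apply/holgen_Hol/holgen_exp; exact/holgen_atom. Qed.

Lemma Hol_prim F G : hol U F G -> Hol U G -> Hol U F.
Proof.
move=> h hG; apply: (Hol_coind oU (P := fun H => H = F \/ Hol U H)); last by left.
move=> H [->|hH]; first by exists G => //; right.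
by exists (cD H); [right; exact: Hol_cD|exact: Hol_hol].
Qed.

Lemma Hol_cz : Hol U cz.
Proof. exact: (Hol_prim hol_cz (Hol_cst 1)). Qed.

End holrules.
End Hol.

(** * Smooth functions *)

Section Smooth.
Variable R : realType.

Lemma nearU (T : topologicalType) (U : set T) z : open U -> U z -> \forall x \near z, U x.
Proof. by move=> oU Uz; have := open_nbhs_nbhs (conj oU Uz). Qed.

Lemma smooth_onD (V W : normedModType R) (U : set V) (f : V -> W) v :
  smooth_on U f -> smooth_on U ('D_v f).
Proof. by move=> h vs x Ux; have := h (rcons vs v) x Ux; rewrite foldr_rcons. Qed.

Lemma smooth_on_diff (V W : normedModType R) (U : set V) (f : V -> W) x :
  smooth_on U f -> U x -> differentiable f x.
Proof. by move=> h Ux; exact: (h [::] x Ux). Qed.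

Lemma smooth_on_sub (V W : normedModType R) (U U' : set V) (f : V -> W) :
  U' `<=` U -> smooth_on U f -> smooth_on U' f.
Proof. by move=> s h vs x /s; exact: h. Qed.

Lemma derive_on (V W : normedModType R) (U : set V) (f g : V -> W) v : open U ->
  {in U, f =1 g} -> {in U, 'D_v f =1 'D_v g}.
Proof.
move=> oU e x /[!inE] Ux; apply: near_eq_derive.
have := nearU oU Ux; apply: filterS => y Uy; exact: (e y (mem_set Uy)).
Qed.

(** The analogue of [Hol_coind] for directional derivatives: iterated derivatives agree on [U] with
    members of the class [P]. *)
Lemma smooth_coind (V W : normedModType R) (U : set V) (P : (V -> W) -> Prop) f :
  open U ->
  (forall f, P f -> (forall x, U x -> differentiable f x) /\
     forall v, exists2 g, P g & {in U, 'D_v f =1 g}) ->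
  P f -> smooth_on U f.
Proof.
move=> oU H Pf vs.
have K : exists2 g, P g & {in U, foldr (fun v (g : V -> W) => 'D_v g) f vs =1 g}.
  elim: vs => [|v vs [g Pg e]]; first by exists f.
  have [_ /(_ v)[g' Pg' e']] := H _ Pg.
  exists g' => // z Uz /=; rewrite -e'//. exact: (derive_on v oU e Uz).
move=> x Ux; have [g Pg e] := K.
have [/(_ x Ux) dg _] := H _ Pg.
have : is_diff x g ('d g x) by exact: differentiableP.
move/is_diff_near => /(_ (foldr (fun v (g : V -> W) => 'D_v g) f vs)) [] //.
by apply: filterS (nearU oU Ux) => y /mem_set /e ->.
Qed.

Lemma is_diff_line (V : normedModType R) (p w : V) (s : R) :
  is_diff s (fun s : R => p + s *: w) (fun h : R => h *: w).
Proof.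
apply: (is_diff_eq (is_diffD (is_diff_cst p s) (is_diff_scalel s w))).
by apply/funext => h /=; rewrite fctE add0r.
Qed.

Lemma is_derive_of_diff (W : normedModType R) (f : R -> W) (df : R -> W) (s : R) :
  is_diff s f df -> is_derive s 1 f (df 1).
Proof.
move=> h; split; first by apply: diff_derivable; case: h.
by rewrite (is_diff_derive _ h).
Qed.

Lemma is_derive_line (V W : normedModType R) (f : V -> W) (p w : V) (s : R) :
  differentiable f (p + s *: w) ->
  is_derive s 1 (fun s : R => f (p + s *: w)) ('D_w f (p + s *: w)).
Proof.
move=> /differentiableP df.
have := is_derive_of_diff (is_diff_comp (is_diff_line p w s) df).
by rewrite /= scale1r -deriveE//; exact: (ex_diff (is_diff_def := df)).
Qed.

(* The mean value theorem applied to the second difference of [f]. *)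
Lemma schwarz_aux (V : normedModType R) (U : set V) (f : V -> R) (z v w : V) :
  open U -> U z -> (forall x, U x -> differentiable f x) ->
  differentiable ('D_w f) z ->
  forall e : R, 0 < e -> \forall t \near 0^'+,
   `|(f (z + t *: v + t *: w) - f (z + t *: v) - f (z + t *: w) + f z)
      - t ^+ 2 * 'D_v ('D_w f) z| <= e * t ^+ 2.
Proof.
move=> oU Uz df dg e e0.
(* [t * M] bounds the norm of [t *: v + s *: w] when s <= t; the expansion of [g] at [z] is used at
   two points, hence the factor 2. *)
set g := 'D_w f; set M : R := `|v| + `|w| + 1.
have M0 : 0 < M by rewrite ltr_wpDl// addr_ge0.
have e1 : 0 < e / (2 * M) by rewrite divr_gt0// mulr_gt0.
have : g \o shift z = cst (g z) + 'd g z +o_ 0 id by exact: diff_locally.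
move/eqaddoP => /(_ _ e1) H.
have H2 : \forall h \near (0 : V), U (z + h).
  have : shift z x @[x --> (0:V)] --> z.
    by rewrite -{2}(add0r z); apply: cvgD; [exact: cvg_id|exact: cvg_cst].
  move=> /(_ _ (nearU oU Uz)) HH.
  have S2 : \forall x \near (0:V), U (x + z) by exact: HH.
  by apply: filterS S2 => x; rewrite addrC.
have [d /= d0 Hd] : exists2 d : R, 0 < d & forall h : V, `|h| < d -> U (z + h) /\
   `|g (z + h) - g z - 'd g z h| <= e / (2 * M) * `|h|.
  have /nbhs_ballP[d /= d0 Hd] : \forall h \near (0 : V), U (z + h) /\
     `|g (z + h) - g z - 'd g z h| <= e / (2 * M) * `|h|.
    apply: filterS2 H H2 => h h1 h2; split=> //.
    by move: h1; rewrite !fctE/= opprD addrA [h + z]addrC.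
  by exists d => // h hd; apply: Hd; rewrite -ball_normE /= sub0r normrN.
near=> t.
have t0 : 0 < t by [].
have tM : t * M < d.
  rewrite -ltr_pdivlMr//; near: t.
  apply: nbhs_right_lt; exact: divr_gt0.
have b (s : R) (a : bool) : 0 <= s <= t -> `|t *: (if a then v else 0) + s *: w| <= t * M.
  move=> /andP[s0 st].
  rewrite (le_trans (ler_normD _ _))// !normrZ (ger0_norm s0) (gtr0_norm t0).
  rewrite /M mulrDr mulr1 mulrDr -addrA lerD//.
    by rewrite ler_wpM2l ?(ltW t0)//; case: a; rewrite ?normr0.
  by rewrite (le_trans (ler_wpM2r (normr_ge0 _) st))// lerDl ltW.
have small (s : R) (a : bool) : 0 <= s <= t -> `|t *: (if a then v else 0) + s *: w| < d.
  by move=> /b h; exact: le_lt_trans (h a) tM.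
(* The second difference is [phi t - phi 0]. *)
pose phi s := f (z + t *: v + s *: w) - f (z + s *: w).
pose phi' s := g (z + t *: v + s *: w) - g (z + s *: w).
have dphi s : 0 <= s <= t -> is_derive s 1 phi (phi' s).
  move=> st; apply: is_deriveB; apply: is_derive_line; apply: df.
    by have [] := Hd _ (small _ true st); rewrite addrA.
  by have [] := Hd _ (small _ false st); rewrite scaler0 add0r.
have [||| xi] := @MVT_segment R phi phi' 0 t.
- exact: ltW.
- by move=> s; rewrite in_itv /= => /andP[s0 st]; apply: dphi; rewrite !ltW.
- apply: derivable_within_continuous => s; rewrite in_itv /= => st.
  by have [] := dphi _ st.
rewrite in_itv /= => xit; rewrite subr0 => E.
have -> : f (z + t *: v + t *: w) - f (z + t *: v) - f (z + t *: w) + f z =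
  phi t - phi 0 by rewrite /phi scale0r !addr0; ring.
rewrite E /phi'.
have [_ h1] := Hd _ (small _ true xit).
have [_ h2] := Hd _ (small _ false xit).
rewrite scaler0 add0r in h2.
have dgE : 'D_v g z = 'd g z v by rewrite deriveE.
have L1 : 'd g z (t *: v + xi *: w) = t * 'd g z v + 'd g z (xi *: w).
  by rewrite linearD linearZ.
rewrite -/g dgE.
have -> : (g (z + t *: v + xi *: w) - g (z + xi *: w)) * t - t ^+ 2 * 'd g z v =
  t * ((g (z + (t *: v + xi *: w)) - g z - 'd g z (t *: v + xi *: w))
     - (g (z + xi *: w) - g z - 'd g z (xi *: w))).
  rewrite L1 addrA; ring.
rewrite normrM (gtr0_norm t0) expr2 mulrCA ler_wpM2l ?(ltW t0)//.
apply: le_trans (ler_normB _ _) _.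
have b1 := b _ true xit; have b2 := b _ false xit.
rewrite scaler0 add0r in b2.
have -> : e * t = e / (2 * M) * (t * M) + e / (2 * M) * (t * M).
  by field; rewrite gt_eqF.
by apply: lerD; [apply: le_trans h1 _|apply: le_trans h2 _]; rewrite ler_wpM2l ?(ltW e1).
Unshelve. all: by end_near.
Qed.

(** The second difference of [f] is symmetric in [v] and [w], and divided by t^2 it tends to either
    of the mixed derivatives. *)
Lemma schwarz (V : normedModType R) (U : set V) (f : V -> R) (v w z : V) :
  open U -> smooth_on U f -> U z -> 'D_v ('D_w f) z = 'D_w ('D_v f) z.
Proof.
move=> oU sf Uz.
have df x : U x -> differentiable f x by exact: smooth_on_diff.
have h1 := schwarz_aux v oU Uz df (smooth_on_diff (smooth_onD w sf) Uz).
have h2 := schwarz_aux w oU Uz df (smooth_on_diff (smooth_onD v sf) Uz).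
apply/eqP; rewrite -subr_eq0 -normr_le0; apply/ler_addgt0Pr => e e0.
rewrite add0r.
have e20 : 0 < e / 2 by rewrite divr_gt0.
have [t /= [t1 [t2 t0]]] := filter_ex (filterI (h1 _ e20) (filterI (h2 _ e20) (nbhs_right_gt (0 : R)))).
have tt : 0 < t ^+ 2 by rewrite exprn_gt0.
rewrite -(ler_pM2r tt) -[X in _ * X <= _](gtr0_norm tt) -normrM.
set A := f (z + t *: v + t *: w) - f (z + t *: v) - f (z + t *: w) + f z in t1.
have EA : f (z + t *: w + t *: v) - f (z + t *: w) - f (z + t *: v) + f z = A.
  rewrite /A -!addrA [t *: w + t *: v]addrC; ring.
rewrite EA in t2.
clear EA h1 h2; move: A ('D_v ('D_w f) z) ('D_w ('D_v f) z) t1 t2 => A a b t1 t2.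
have -> : (a - b) * t ^+ 2 = (A - t ^+ 2 * b) - (A - t ^+ 2 * a) by ring.
apply: le_trans (ler_normB _ _) _.
have -> : e * t ^+ 2 = e / 2 * t ^+ 2 + e / 2 * t ^+ 2 by field.
exact: lerD.
Qed.

Local Notation d10 f := ('D_((1, 0) : R * R) f).
Local Notation d01 f := ('D_((0, 1) : R * R) f).

Lemma pairE (h : R * R) : h = h.1 *: (1, 0) + h.2 *: (0, 1).
Proof.
apply: injective_projections => /=.
  by rewrite /GRing.scale /= mulr1 mulr0 addr0.
by rewrite /GRing.scale /= mulr1 mulr0 add0r.
Qed.

Lemma is_diff_plane (f : R * R -> R) z : differentiable f z ->
  is_diff z f (fun h => h.1 * d10 f z + h.2 * d01 f z).
Proof.
move=> df; apply: DiffDef => //; apply/funext => h.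
by rewrite {1}(pairE h) linearD !linearZ !deriveE.
Qed.

(** The class of pairs of smooth functions satisfying the Cauchy-Riemann equations is stable under
    d/du, by symmetry of the second derivatives. *)
Lemma Hol_smooth (U : set (R * R)) (x y : R * R -> R) : open U ->
  smooth_on U x -> smooth_on U y ->
  (forall z, U z -> d10 x z = d01 y z) -> (forall z, U z -> d01 x z = - d10 y z) ->
  Hol U (fun z => x z +i* y z).
Proof.
move=> oU sx sy c1 c2.
pose P F := exists x y : R * R -> R, [/\ smooth_on U x, smooth_on U y,
  (forall z, U z -> d10 x z = d01 y z), (forall z, U z -> d01 x z = - d10 y z) &
  F = (fun z => x z +i* y z)].
apply: (Hol_coind oU (P := P)); last by exists x, y.
move=> _ {x y sx sy c1 c2}[x [y [sx sy c1 c2 ->]]].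
exists (fun z => d10 x z +i* d10 y z).
  exists (d10 x), (d10 y); split; [exact: smooth_onD|exact: smooth_onD| | |reflexivity].
  - move=> z Uz; rewrite (schwarz _ _ oU sy Uz).
    by apply: (derive_on _ oU) => //; rewrite ?inE// => ? /[!inE] /c1.
  - move=> z Uz; rewrite (schwarz _ _ oU sx Uz).
    rewrite -deriveN.
      by apply: (derive_on _ oU) => //; rewrite ?inE// => ? /[!inE] /c2.
    exact/diff_derivable/(smooth_on_diff (smooth_onD _ sy)).
move=> z Uz; split.
- apply: (is_diff_eq (is_diff_plane (smooth_on_diff sx Uz))).
  apply/funext => h /=; rewrite c2//; ring.
- apply: (is_diff_eq (is_diff_plane (smooth_on_diff sy Uz))).
  apply/funext => h /=; rewrite -c1//; ring.
Qed.

Lemma smooth_scale (U : set (R * R)) (k : R) (g : R * R -> R) : open U -> smooth_on U g -> smooth_on U (fun z => k * g z).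
Proof.
move=> oU sg.
pose P h := exists2 g : R * R -> R, smooth_on U g & h = (fun z => k * g z).
apply: (smooth_coind oU (P := P)); last by exists g.
move=> _ [h sh ->]; split.
  by move=> z Uz; apply: (@differentiableZ R _ _ h k); exact: smooth_on_diff sh Uz.
move=> v; exists (fun z => k * 'D_v h z).
  by exists ('D_v h) => //; exact: smooth_onD.
move=> z /[!inE] Uz; have := @deriveZ R _ _ h k z v; rewrite /GRing.scale /= => <- //.
exact/diff_derivable/(smooth_on_diff sh).
Qed.

(** For l_u - i l_v the Cauchy-Riemann equations are the harmonicity of [l] and the symmetry of its
    second derivatives. *)
Lemma Hol_harmonic (U : set (R * R)) (l : R * R -> R) : open U ->
  smooth_on U l -> (forall z, U z -> d10 (d10 l) z + d01 (d01 l) z = 0) ->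
  Hol U (fun z => d10 l z +i* (- d01 l z)).
Proof.
move=> oU sl H.
have sN : smooth_on U (fun z => - d01 l z).
  have -> : (fun z => - d01 l z) = (fun z => -1 * d01 l z) by apply/funext => z; rewrite mulN1r.
  exact: (smooth_scale (-1) oU (smooth_onD _ sl)).
have N v z : U z -> 'D_v (fun z => - d01 l z) z = - 'D_v (d01 l) z.
  move=> Uz; rewrite -deriveN//.
  exact/diff_derivable/(smooth_on_diff (smooth_onD _ sl)).
apply: Hol_smooth => //; first exact: smooth_onD.
- by move=> z Uz; rewrite N//; apply/eqP; rewrite -subr_eq0 opprK; exact/eqP/H.
- by move=> z Uz; rewrite N// opprK (schwarz _ _ oU sl Uz).
Qed.

End Smooth.

(** * Connectedness, segments, and criteria of differentiability *)

Section Basics.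
Variable R : realType.
Implicit Types (z : R * R) (F G : R * R -> R[i]) (U S : set (R * R)).

(** The points of [S] where [P] holds and those where it fails are both open. *)
Lemma connected_ind (T : topologicalType) (S : set T) (P : T -> Prop) (z0 : T) :
  open S -> connected S -> S z0 -> P z0 ->
  (forall z : T, S z -> P z -> \forall w \near z, P w) ->
  (forall z : T, S z -> ~ P z -> \forall w \near z, ~ P w) ->
  forall z : T, S z -> P z.
Proof.
move=> oS cS Sz0 Pz0 hP hN z Sz.
have oP : open (S `&` [set z : T | P z]).
  rewrite openE => w [Sw Pw]; apply: filterI; first exact: nearU.
  exact: hP.
have oN : open (S `&` [set z : T | ~ P z]).
  rewrite openE => w [Sw Pw]; apply: filterI; first exact: nearU.
  exact: hN.
have : S `&` [set z : T | P z] = S.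
  apply: cS; first by exists z0.
  - exists (S `&` [set z : T | P z]) => //; by rewrite setIA setIid.
  - exists (~` (S `&` [set z : T | ~ P z])); first exact: open_closedC.
    apply/seteqP; split=> w [Sw Pw]; split=> //; first by move=> [].
    by apply: contrapT => h; apply: Pw; split.
by move=> E; move: Sz; rewrite -{1}E => -[].
Qed.

Lemma seg_MVT (f : R -> R) (df : R -> R) :
  (forall s : R, 0 <= s <= 1 -> is_derive s 1 f (df s)) ->
  exists2 s : R, 0 <= s <= 1 & f 1 - f 0 = df s.
Proof.
move=> h; have [||| s s01] := @MVT_segment R f df 0 1.
- exact: ler01.
- by move=> s; rewrite in_itv /= => /andP[s0 s1]; apply: h; rewrite !ltW.
- apply: derivable_within_continuous => s; rewrite in_itv /= => st.
  by have [] := h _ st.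
by rewrite subr0 mulr1 => E; exists s => //; rewrite in_itv in s01.
Qed.

Lemma ball_seg (V : normedModType R) (z0 x y : V) (r s : R) :
  ball z0 r x -> ball z0 r y -> 0 <= s <= 1 -> ball z0 r (x + s *: (y - x)).
Proof.
rewrite -!ball_normE /= => hx hy /andP[s0 s1].
have -> : z0 - (x + s *: (y - x)) = (1 - s) *: (z0 - x) + s *: (z0 - y).
  have -> : z0 - y = (z0 - x) - (y - x) by rewrite opprB addrA subrK.
  by rewrite scalerBl scale1r (scalerBr s (z0 - x)) addrA subrK opprD addrA.
have hs : 0 <= 1 - s by rewrite subr_ge0.
apply: le_lt_trans (ler_normD _ _) _.
rewrite !normrZ (ger0_norm hs) (ger0_norm s0).
have [->|sn] := eqVneq s 1; first by rewrite subrr mul0r add0r mul1r.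
have s10 : 0 < 1 - s by rewrite subr_gt0 lt_neqAle sn.
have -> : r = (1 - s) * r + s * r by ring.
by apply: ltr_leD; [rewrite ltr_pM2l|rewrite ler_wpM2l// ltW].
Qed.

Lemma seg_const U F x y : hol U F (cst 0) ->
  (forall s, 0 <= s <= 1 -> U (x + s *: (y - x))) -> F x = F y.
Proof.
move=> h bxy.
have key (f : R * R -> R) : (forall z, U z -> is_diff z f (fun=> 0)) -> f x = f y.
  move=> hf; apply/eqP; rewrite eq_sym -subr_eq0; apply/eqP.
  have [|s _] := @seg_MVT (fun s => f (x + s *: (y - x))) (fun=> 0).
    move=> s s01; have hd := hf _ (bxy s s01).
    have := is_derive_of_diff (is_diff_comp (is_diff_line x (y - x) s) hd); exact.
  by rewrite scale1r scale0r addr0 addrCA subrr addr0.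
apply: cplx_eq.
- apply: (key (@complex.Re R \o F)) => z bz; have [h1 _] := h z bz.
  by apply: (is_diff_eq h1); apply/funext => v; rewrite /comp /cst mul0r.
- apply: (key (@complex.Im R \o F)) => z bz; have [_ h1] := h z bz.
  by apply: (is_diff_eq h1); apply/funext => v; rewrite /comp /cst mul0r.
Qed.

Lemma ball_const F z0 (r : R) : hol (ball z0 r) F (cst 0) ->
  forall x y, ball z0 r x -> ball z0 r y -> F x = F y.
Proof. by move=> h x y bx by_; apply: (seg_const h) => s; exact: ball_seg. Qed.

Lemma open_ball_sub U z : open U -> U z -> exists2 r : R, 0 < r & ball z r `<=` U.
Proof. by move=> oU Uz; have /nbhs_ballP := nearU oU Uz. Qed.

Lemma hol_const S F : open S -> connected S -> hol S F (cst 0) ->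
  forall x y, S x -> S y -> F x = F y.
Proof.
move=> oS cS h x y Sx Sy.
have bc z : S z -> \forall w \near z, F w = F z.
  move=> Sz; have [r r0 rS] := open_ball_sub oS Sz.
  apply/nbhs_ballP; exists r => // w bw.
  apply: (ball_const (hol_sub rS h)) => //; exact: ballxx.
apply/esym; apply: (@connected_ind _ S (fun z => F z = F x) x) => // z Sz Pz.
- by apply: filterS (bc z Sz) => w ->.
- by apply: filterS (bc z Sz) => w ->.
Qed.

(** The differential is left existential, for the places where only continuity is at stake. *)
Definition cdf (V : normedModType R) (z : V) (F : V -> R[i]) := exists dF, cdiff z F dF.

Lemma cdf_continuous_Re (V : normedModType R) (z : V) (F : V -> R[i]) :
  cdf z F -> {for z, continuous (@complex.Re R \o F)}.
Proof. by move=> [dF [[h _] _]]; exact: differentiable_continuous. Qed.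
Lemma cdf_continuous_Im (V : normedModType R) (z : V) (F : V -> R[i]) :
  cdf z F -> {for z, continuous (@complex.Im R \o F)}.
Proof. by move=> [dF [_ [h _]]]; exact: differentiable_continuous. Qed.

Lemma pt_diff (V : normedModType R) (p : V) (C dC : V -> R[i]) :
  cdiff p C dC -> is_diff p (@pt R \o C) (@pt R \o dC).
Proof. by move=> [h1 h2]; exact: (is_diff_pair h1 h2). Qed.

Lemma cdiff_hol_comp (V : normedModType R) (p : V) (C dC : V -> R[i]) F a :
  cdiff p C dC -> cdiff (pt (C p)) F (fun h => a * cz h) ->
  cdiff p (fun p => F (pt (C p))) (fun h => a * dC h).
Proof.
move=> hC hF; apply: cdiff_eq (cdiff_comp (pt_diff hC) hF) _ => h /=.
by rewrite ptK.
Qed.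

Lemma cdiff_real (a : R) : cdiff a (fun a : R => a%:C) (fun h : R => h%:C).
Proof. by split; [exact: (is_diff_id a)|exact: (is_diff_cst 0 a)]. Qed.

Lemma cdiff_fst (p : R * R) : cdiff p (fun p => (p.1)%:C) (fun h => (h.1)%:C).
Proof. by split; [exact: fst_diff|exact: (is_diff_cst 0 p)]. Qed.
Lemma cdiff_snd (p : R * R) : cdiff p (fun p => (p.2)%:C) (fun h => (h.2)%:C).
Proof. by split; [exact: snd_diff|exact: (is_diff_cst 0 p)]. Qed.

Lemma cdfD (V : normedModType R) (z : V) (F G : V -> R[i]) : cdf z F -> cdf z G -> cdf z (fun x => F x + G x).
Proof. by move=> [dF hF] [dG hG]; exists (fun h => dF h + dG h); exact: cdiffD. Qed.
Lemma cdfM (V : normedModType R) (z : V) (F G : V -> R[i]) : cdf z F -> cdf z G -> cdf z (fun x => F x * G x).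
Proof. by move=> [dF hF] [dG hG]; exists (fun h => dF h * G z + F z * dG h); exact: cdiffM. Qed.
Lemma cdf_cst (V : normedModType R) (z : V) a : cdf z (cst a).
Proof. by exists (cst 0); exact: cdiff_cst. Qed.
Lemma cdf_comp (V : normedModType R) (p : V) (C : V -> R[i]) U (F G : R * R -> R[i]) :
  cdf p C -> hol U F G -> U (pt (C p)) -> cdf p (fun p => F (pt (C p))).
Proof. by move=> [dC hC] hF Up; exists (fun h => G (pt (C p)) * dC h); apply: (cdiff_hol_comp hC); exact: hF. Qed.

Lemma cdiff_is_derive (F : R -> R[i]) (t : R) (dF : R -> R[i]) :
  cdiff t F dF -> is_derive t 1 (fun t => Re (F t)) (Re (dF 1)).
Proof. by move=> [h _]; exact: is_derive_of_diff h. Qed.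

Lemma within_cdf (V : normedModType R) (A : set V) (F : V -> R[i]) :
  (forall z : V, A z -> cdf z F) -> {within A, continuous (fun z : V => Re (F z))}.
Proof.
move=> h; apply: continuous_in_subspaceT => z /[!inE] /h; exact: cdf_continuous_Re.
Qed.

Lemma is_diff_criterion (V W : normedModType R) (f : V -> W) (L : {linear V -> W}) (z : V) :
  continuous L ->
  (forall e : R, 0 < e -> \forall h \near (0 : V), `|f (z + h) - f z - L h| <= e * `|h|) ->
  is_diff z f L.
Proof.
move=> cL H.
have E : f \o shift z = cst (f z) + L +o_ 0 id.
  apply/eqaddoP => e e0; apply: filterS (H e e0) => h.
  by rewrite !fctE /= [h + z]addrC opprD addrA.
have du := diff_unique cL E.
have dg : differentiable f z by apply/diff_locallyP; rewrite du; split.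
by apply: DiffDef; [exact: dg|rewrite du].
Qed.

(** The mean value theorem on the segment from z to z + h writes the increment of [A] as Re (k F h)
    with [F] taken at an intermediate point, and [F] is continuous at [z]. *)
Lemma Gateaux_diff U (A : R * R -> R) F (k : R[i]) z : open U -> U z ->
  cdf z F ->
  (forall x v : R * R, U x -> is_derive (0:R) 1 (fun a : R => A (x + a *: v)) (Re (k * F x * cz v))) ->
  is_diff z A (fun h => Re (k * F z * cz h)).
Proof.
move=> oU Uz cF hA.
pose L h : R := Re (k * F z * cz h).
have Llin : linear L.
  move=> a x y; rewrite /L czD czZ !ReImE /= /GRing.scale /=; ring.
pose LM := GRing.isLinear.Build _ _ _ _ _ Llin.
pose LL : {linear (R * R)%type -> R} := HB.pack L LM.
have dL : is_diff z L L.
  have : is_diff z (@complex.Re R \o (fun h => k * F z * cz h))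
      (@complex.Re R \o (fun h : R * R => 0 * cz z + k * F z * cz h)).
    by have [] := cdiffM (cdiff_cst z (k * F z)) (cdiff_cz z).
  by move=> h; apply: (is_diff_eq h); apply/funext => v /=; rewrite mul0r add0r.
have cL : continuous L.
  have c0 x : cdf x (fun h => k * F z * cz h).
    by apply: cdfM; [exact: cdf_cst|eexists; exact: cdiff_cz].
  by move=> x; exact: (cdf_continuous_Re (c0 x)).
have -> : (fun h => Re (k * F z * cz h)) = LL by [].
apply: is_diff_criterion => // _/posnumP[e].
have ckF : cdf z (fun x => k * F x) by apply: cdfM => //; exact: cdf_cst.
have e3 : 0 < e%:num / 2 by [].
have /nbhs_ballP[d1 /= d10 h1] : \forall x \near z, `|Re (k * F x) - Re (k * F z)| < e%:num / 2.
  have := cdf_continuous_Re ckF; move/cvgrPdist_lt => /(_ _ e3).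
  by apply: filterS => x; rewrite distrC.
have /nbhs_ballP[d2 /= d20 h2] : \forall x \near z, `|Im (k * F x) - Im (k * F z)| < e%:num / 2.
  have := cdf_continuous_Im ckF; move/cvgrPdist_lt => /(_ _ e3).
  by apply: filterS => x; rewrite distrC.
have [r r0 rU] := open_ball_sub oU Uz.
pose d := Num.min r (Num.min d1 d2).
have d0 : 0 < d by rewrite !lt_min r0 d10 d20.
apply/nbhs_ballP; exists d => //= h.
rewrite -ball_normE /= sub0r normrN !lt_min => /and3P[hr hd1 hd2].
have seg (s : R) : 0 <= s <= 1 -> `|s *: h| <= `|h|.
  by move=> /andP[s0 s1]; rewrite normrZ ger0_norm// ler_piMl.
have inb (s rr : R) : 0 <= s <= 1 -> `|h| < rr -> ball z rr (z + s *: h).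
  move=> s01 hh; rewrite -ball_normE /= opprD addrA subrr sub0r normrN.
  exact: le_lt_trans (seg s s01) hh.
have [|s s01] := @seg_MVT (fun s : R => A (z + s *: h)) (fun s : R => Re (k * F (z + s *: h) * cz h)).
  move=> s s01.
  have hs := hA (z + s *: h) h (rU _ (inb s _ s01 hr)).
  have -> : (fun s : R => A (z + s *: h)) =
    (fun a : R => A (z + s *: h + a *: h)) \o (fun t : R => t - s).
    by apply/funext => t /=; rewrite -addrA -scalerDl addrCA subrr addr0.
  have hs' : is_derive (s - s) 1 (fun a : R => A (z + s *: h + a *: h)) (Re (k * F (z + s *: h) * cz h)).
    by rewrite subrr.
  have hl : is_derive s 1 (fun t : R => t - s) 1.
    apply: is_derive_eq; by rewrite oppr0 addr0.
  have := @is_derive1_comp R (fun a : R => A (z + s *: h + a *: h)) (fun t : R => t - s) s _ _ hs' hl.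
  by rewrite mulr1.
rewrite scale1r scale0r addr0 => E.
rewrite E /= /L.
have b1 := h1 _ (inb s _ s01 hd1); have b2 := h2 _ (inb s _ s01 hd2).
rewrite /= in b1 b2.
move: (k * F (z + s *: h)) (k * F z) b1 b2 => a b b1 b2.
have n1 : `|h.1| <= `|h| by rewrite prod_normE le_max lexx.
have n2 : `|h.2| <= `|h| by rewrite prod_normE le_max lexx orbT.
have -> : Re (a * cz h) - Re (b * cz h) = (Re a - Re b) * h.1 - (Im a - Im b) * h.2.
  rewrite !ReImE /=; ring.
apply: le_trans (ler_normB _ _) _; rewrite !normrM.
have -> : e%:num * `|h| = e%:num / 2 * `|h| + e%:num / 2 * `|h| by field.
by apply: lerD; apply: ler_pM => //; exact: ltW.
Qed.

End Basics.

(** * Primitives on simply connected domains *)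

Section Primitive.
Variable R : realType.
Local Notation mu := (@lebesgue_measure R).

(** The constant [M] dominates the derivative of the integrand; the integral of [psi 0] is then
    evaluated by the fundamental theorem of calculus, [T] being a primitive. *)
Lemma param_int (phi psi : R -> R -> R) (T : R -> R) (d M : R) : 0 < d ->
  (forall a t : R, `|a| < d -> 0 <= t <= 1 -> is_derive a 1 (phi^~ t) (psi a t)) ->
  (forall a : R, `|a| < d -> {within `[0, 1], continuous (phi a)}) ->
  (forall a t : R, `|a| < d -> 0 <= t <= 1 -> `|psi a t| <= M) ->
  (forall t : R, 0 <= t <= 1 -> is_derive t 1 T (psi 0 t)) ->
  {within `[0, 1], continuous (psi 0)} ->
  is_derive (0 : R) 1 (fun a => \int[mu]_(t in `[0, 1]) phi a t) (T 1 - T 0).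
Proof.
move=> d0 dphi cphi bpsi dT cpsi.
have I (a : R) : (`]-d, d[%classic : set R) a -> `|a| < d.
  by rewrite /= in_itv /= ltr_norml.
have J (t : R) : (`[0, 1]%classic : set R) t -> 0 <= t <= 1 by rewrite /= in_itv.
have I0 : (`]-d, d[%classic : set R) 0 by rewrite /= in_itv /= oppr_lt0 d0.
have M0 : 0 <= M.
  apply: le_trans (bpsi 0 0 _ _); rewrite ?normr0 ?lexx ?ler01//.
have intc (f : R -> R) : {within `[0, 1], continuous f} ->
    mu.-integrable `[0, 1] (EFin \o f).
  by apply: continuous_compact_integrable; exact: segment_compact.
have h1 (x : R) : (`]-d, d[%classic : set R) x -> mu.-integrable `[0, 1] (EFin \o phi x).
  by move=> /I xd; exact/intc/cphi.
have h2 (x y : R) : (`]-d, d[%classic : set R) x -> (`[0, 1]%classic : set R) y -> derivable (phi^~ y) x 1.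
  by move=> /I xd /J y01; have [] := dphi x y xd y01.
have h3 (x y : R) : (`]-d, d[%classic : set R) x -> (`[0, 1]%classic : set R) y ->
    `|partial1of2 phi x y| <= M.
  move=> /I xd /J y01; rewrite partial1of2E; have [_ ->] := dphi x y xd y01.
  exact: bpsi.
have intM : mu.-integrable `[0, 1] (EFin \o cst M).
  by apply: intc; apply: continuous_subspaceT => x; exact: cvg_cst.
have mI : measurable (`[0, 1]%classic : set R) by exact: measurable_itv.
have der := @derivable_under_integral R _ _ mu phi `[0, 1]%classic mI 0 _ _ I0 h1 h2 (cst M) (fun=> M0) intM h3.
have val := @differentiation_under_integral R _ _ mu phi `[0, 1]%classic mI 0 _ _ I0 h1 h2 (cst M) (fun=> M0) intM h3.
split; first exact: der.
rewrite -derive1E val.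
have -> : \int[mu]_(t in `[0, 1]) partial1of2 phi 0 t = \int[mu]_(t in `[0, 1]) psi 0 t.
  apply: eq_Rintegral => t /[!inE] /J t01; rewrite partial1of2E.
  by have [] := dphi 0 t _ t01; rewrite ?normr0.
rewrite /Rintegral (@continuous_FTC2 _ (psi 0) T 0 1)//.
- have D t : 0 <= t <= 1 -> derivable T t 1 by move=> /dT [].
  have C t : 0 <= t <= 1 -> {for t, continuous T}.
    by move=> /D /derivable1_diffP; exact: differentiable_continuous.
  split.
  + by move=> x; rewrite in_itv /= => /andP[x0 x1]; apply: D; rewrite !ltW.
  + by apply: cvg_at_right_filter; apply: C; rewrite lexx ler01.
  + by apply: cvg_at_left_filter; apply: C; rewrite lexx ler01.
- move=> x; rewrite in_itv /= => /andP[x0 x1]; rewrite derive1E.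
  by have [] := dT x; rewrite ?ltW.
Qed.

Lemma compact_bounded (T : topologicalType) (K : set T) (f : T -> R) :
  compact K -> {within K, continuous f} -> exists2 M : R, 0 <= M & forall x, K x -> `|f x| <= M.
Proof.
move=> cK cf; have [->|/set0P K0] := eqVneq K set0; first by exists 0.
have cN : {within K, continuous (fun x => `|f x|)}.
  move=> x; apply: (@continuous_comp (subspace K) R^o R^o f (fun x => `|x|)); first exact: cf.
  exact: norm_continuous.
have [c cK' h] := compact_EVT_max K0 cK cN.
by exists `|f c| => // x Kx; apply: h; rewrite inE.
Qed.

(* The primitive is the integral along the segment issued from the center; its
   derivative in direction [v] is obtained under the integral sign, where the
   integrand is the derivative of [t F(c_t) v]. *)
Lemma ball_primitive (z0 : R * R) (r : R) (F : R * R -> R[i]) : 0 < r ->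
  Hol (ball z0 r) F -> exists G, hol (ball z0 r) G F.
Proof.
move=> r0 HF.
pose U := ball z0 r.
have oU : open U by exact: ball_open.
have hF : hol U F (cD F) by exact: Hol_hol.
have hF' : hol U (cD F) (cD (cD F)) by exact/Hol_hol/Hol_cD.
pose c0 := cz z0.
(* The factor [k] selects a component of the integral: 1 gives the real part and - i the imaginary
   part. *)
pose A (k : R[i]) (x : R * R) := \int[mu]_(t in `[0, 1])
  Re (k * (F (pt (c0 + t%:C * (cz x - c0))) * (cz x - c0))).
have key k x v : U x -> is_derive (0:R) 1 (fun a : R => A k (x + a *: v)) (Re (k * F x * cz v)).
  move=> Ux.
  have [e e0 eU] := open_ball_sub oU Ux.
  (* With this [d] even the closed range |a| <= d keeps x + a v in the ball, so that the integrand
     is controlled on the compact set [K] below. *)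
  pose d := e / (2 * (`|v| + 1)).
  have v1 : 0 < `|v| + 1 by rewrite ltr_wpDl.
  have d0 : 0 < d by rewrite divr_gt0// mulr_gt0.
  have xa (a : R) : `|a| <= d -> U (x + a *: v).
    move=> ad; apply: eU; rewrite -ball_normE /= opprD addrA subrr sub0r normrN normrZ.
    apply: (@le_lt_trans _ _ (d * (`|v| + 1))).
      by rewrite ler_pM// lerDl.
    have -> : d * (`|v| + 1) = e / 2 by rewrite /d; field; rewrite gt_eqF.
    by rewrite ltr_pdivrMr// mulr_natr mulr2n ltrDl.
  pose Cc (a t : R) := c0 + t%:C * (cz x + a%:C * cz v - c0).
  have CU (a t : R) : `|a| <= d -> 0 <= t <= 1 -> U (pt (Cc a t)).
    move=> ad t01; have -> : pt (Cc a t) = z0 + t *: (x + a *: v - z0).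
      by apply: (can_inj (@czK R)); rewrite ptK czD czZ czD czN czD czZ.
    by apply: ball_seg => //; [exact: ballxx|exact: xa].
  pose phi (a t : R) := Re (k * (F (pt (Cc a t)) * (cz x + a%:C * cz v - c0))).
  pose Psi (a t : R) := k * (cD F (pt (Cc a t)) * (t%:C * cz v) * (cz x + a%:C * cz v - c0)
                      + F (pt (Cc a t)) * cz v).
  pose psi (a t : R) := Re (Psi a t).
  pose T (t : R) := Re (k * (t%:C * F (pt (Cc 0 t)) * cz v)).
  have -> : (fun a : R => A k (x + a *: v)) = (fun a => \int[mu]_(t in `[0, 1]) phi a t).
    by apply/funext => a; rewrite /A /phi /Cc; apply: eq_Rintegral => t _;
       rewrite czD czZ.
  have -> : Re (k * F x * cz v) = T 1 - T 0.
    rewrite /T /Cc.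
    have -> : pt (c0 + 1%:C * (cz x + 0%:C * cz v - c0)) = x.
      by rewrite mul1r mul0r addr0 addrC subrK czK.
    by rewrite mul1r !mul0r mulr0 subr0 mulrA.
  have dC1 (a t : R) : cdiff a (fun a => Cc a t) (fun h : R => t%:C * (h%:C * cz v)).
    apply: cdiff_eq (cdiffD (cdiff_cst a c0) (cdiffM (cdiff_cst a (t%:C))
      (cdiffB (cdiffD (cdiff_cst a (cz x)) (cdiffM (cdiff_real a) (cdiff_cst a (cz v)))) (cdiff_cst a c0)))) _ => h.
    rewrite /cst; ring.
  have dC2 (a t : R) : cdiff t (fun t => Cc a t) (fun h : R => h%:C * (cz x + a%:C * cz v - c0)).
    apply: cdiff_eq (cdiffD (cdiff_cst t c0) (cdiffM (cdiff_real t)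
      (cdiff_cst t (cz x + a%:C * cz v - c0)))) _ => h.
    rewrite /cst; ring.
  have dxa (a : R) : cdiff a (fun a : R => cz x + a%:C * cz v - c0) (fun h : R => h%:C * cz v).
    apply: cdiff_eq (cdiffB (cdiffD (cdiff_cst a (cz x)) (cdiffM (cdiff_real a) (cdiff_cst a (cz v)))) (cdiff_cst a c0)) _ => h.
    rewrite /cst; ring.
  pose CC (p : R * R) := c0 + (p.2)%:C * (cz x + (p.1)%:C * cz v - c0).
  have dCC p : cdf p CC.
    apply: cdfD; first exact: cdf_cst.
    apply: cdfM; first by eexists; exact: cdiff_snd.
    apply: cdfD; last exact: cdf_cst.
    apply: cdfD; first exact: cdf_cst.
    by apply: cdfM; [eexists; exact: cdiff_fst|exact: cdf_cst].
  pose K : set (R * R) := `[-d, d]%classic `*` `[0, 1]%classic.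
  have cK : compact K by apply: compact_setX; exact: segment_compact.
  have KU p : K p -> `|p.1| <= d /\ 0 <= p.2 <= 1.
    by move=> []; rewrite /= !in_itv /= ler_norml.
  have dPsi p : K p -> cdf p (fun p => Psi p.1 p.2).
    move=> /KU [p1 p2].
    have Up : U (pt (CC p)) by exact: CU.
    apply: cdfM; first exact: cdf_cst.
    apply: cdfD.
      apply: cdfM.
        apply: cdfM; first exact: (cdf_comp (dCC p) hF' Up).
        by apply: cdfM; [eexists; exact: cdiff_snd|exact: cdf_cst].
      apply: cdfD; last exact: cdf_cst.
      apply: cdfD; first exact: cdf_cst.
      by apply: cdfM; [eexists; exact: cdiff_fst|exact: cdf_cst].
    by apply: cdfM; [exact: (cdf_comp (dCC p) hF Up)|exact: cdf_cst].
  have [M M0 HM] := compact_bounded cK (within_cdf dPsi).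
  apply: (@param_int phi psi T d M) => //.
  - move=> a t /ltW ad t01.
    have := cdiff_is_derive (cdiffM (cdiff_cst a k) (cdiffM (cdiff_hol_comp (dC1 a t) (hF _ (CU a t ad t01))) (dxa a))).
    move=> h; apply: is_derive_eq; rewrite /psi /Psi /cst; congr (Re _); rewrite /Cc; ring.
  - move=> a /ltW ad; apply: within_cdf => t; rewrite /= in_itv /= => t01.
    apply: cdfM; first exact: cdf_cst.
    apply: cdfM; last exact: cdf_cst.
    by eexists; exact: (cdiff_hol_comp (dC2 a t) (hF _ (CU a t ad t01))).
  - move=> a t /ltW ad t01; apply: (HM (a, t)).
    by split; rewrite /= in_itv /= -?ler_norml.
  - move=> t t01.
    have d00 : `|0 : R| <= d by rewrite normr0 ltW.
    have := cdiff_is_derive (cdiffM (cdiff_cst t k) (cdiffM (cdiffM (cdiff_real t) (cdiff_hol_comp (dC2 0 t) (hF _ (CU 0 t d00 t01)))) (cdiff_cst t (cz v)))).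
    move=> h; apply: is_derive_eq; rewrite /psi /Psi /cst; congr (Re _); rewrite /Cc; ring.
  - apply: within_cdf => t; rewrite /= in_itv /= => t01.
    have d00 : `|0 : R| <= d by rewrite normr0 ltW.
    have Up := CU 0 t d00 t01.
    have dt : cdf t (fun t => Cc 0 t) by eexists; exact: dC2.
    apply: cdfM; first exact: cdf_cst.
    apply: cdfD.
      apply: cdfM; last exact: cdf_cst.
      apply: cdfM; first exact: (cdf_comp dt hF' Up).
      by apply: cdfM; [eexists; exact: cdiff_real|exact: cdf_cst].
    by apply: cdfM; [exact: (cdf_comp dt hF Up)|exact: cdf_cst].
exists (fun z => A 1 z +i* A (- 'i) z) => z Uz.
have cF : cdf z F by eexists; exact: hF.
split.
- apply: (is_diff_eq (Gateaux_diff oU Uz cF (fun x v Ux => key 1 x v Ux))).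
  by apply/funext => h /=; rewrite mul1r.
- apply: (is_diff_eq (Gateaux_diff oU Uz cF (fun x v Ux => key (- 'i) x v Ux))).
  by apply/funext => h /=; rewrite !ReImE /=; ring.
Qed.

End Primitive.

(** * Continuation of primitives along paths *)

Section Monodromy.
Variable R : realType.
Variables (S : set (R * R)) (F : R * R -> R[i]).
Hypotheses (oS : open S) (HF : Hol S F).
Implicit Types (x y z w : R * R) (s t : R) (c : R -> R * R) (A : R -> R[i]).

(* The increment from [x] to [y] of a local primitive of [F]. *)
Definition inc x y (v : R[i]) := exists z (r : R) (G : R * R -> R[i]),
  [/\ hol (ball z r) G F, ball z r x, ball z r y & v = G y - G x].

(** The segment from [x] to [y] lies in both balls by convexity, and on it the two primitives differ
    by a constant. *)
Lemma inc_fun x y v v' : inc x y v -> inc x y v' -> v = v'.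
Proof.
move=> [z [r [G [hG bx by_ ->]]]] [z' [r' [G' [hG' bx' by' ->]]]].
have h : hol (ball z r `&` ball z' r') (fun w => G w - G' w) (cst 0).
  apply: (@hol_eqr _ _ _ (fun w => F w - F w)) => [w _|]; first by rewrite subrr.
  by apply: holB; [apply: hol_sub hG => ? []|apply: hol_sub hG' => ? []].
have sg s : 0 <= s <= 1 -> (ball z r `&` ball z' r') (x + s *: (y - x)).
  by move=> s01; split; exact: ball_seg.
have E := seg_const h sg; rewrite /= in E.
have -> : G y = G x - G' x + G' y by rewrite E subrK.
ring.
Qed.

(** The default [0] is taken when no ball containing both points carries a primitive. *)
Definition incf x y : R[i] := xget 0 [set v | inc x y v].

Lemma incf_eq x y v : inc x y v -> incf x y = v.
Proof.
move=> h; exact: (inc_fun (@xgetPex _ 0 [set v | inc x y v] (ex_intro _ v h)) h).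
Qed.

Definition cball z (r : R) := 0 < r /\ ball z r `<=` S.

Lemma incf_prim z r : cball z r -> exists2 G, hol (ball z r) G F &
  forall x y, ball z r x -> ball z r y -> incf x y = G y - G x.
Proof.
move=> [r0 bS]; have [G hG] := ball_primitive r0 (Hol_sub bS HF).
by exists G => // x y bx by_; apply: incf_eq; exists z, r, G.
Qed.

Lemma incfD z r x y w : cball z r -> ball z r x -> ball z r y -> ball z r w ->
  incf x y + incf y w = incf x w.
Proof.
move=> /incf_prim[G _ h] bx by_ bw; rewrite !h//.
by rewrite addrC addrA subrK.
Qed.

Lemma incfxx x : S x -> incf x x = 0.
Proof.
move=> Sx; have [r r0 bS] := open_ball_sub oS Sx.
have [G _ h] := @incf_prim x r (conj r0 bS).
by rewrite h ?subrr//; exact: ballxx.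
Qed.

(** Clamping the argument to [a, b] gives a locally constant function on the whole line, which is
    connected. *)
Lemma clamp_const (T : Type) (f : R -> T) (a b : R) : a <= b ->
  (forall s, a <= s <= b -> exists2 d : R, 0 < d &
    forall s', a <= s' <= b -> `|s' - s| < d -> f s' = f s) -> f b = f a.
Proof.
move=> ab h.
have cR : connected [set: R] by apply/connected_intervalP.
have cl s : exists2 d : R, 0 < d & forall s', `|s' - s| < d ->
    f (Num.max a (Num.min b s')) = f (Num.max a (Num.min b s)).
  have inab s' : a <= Num.max a (Num.min b s') <= b.
    by rewrite le_max lexx /= ge_max ab ge_min lexx.
  have [d d0 hd] := h _ (inab s); exists d => // s' ss'.
  apply: hd => //; apply: le_lt_trans ss'.
  have := ler_norm (s' - s); have := ler_norm (s - s'); rewrite (distrC s s').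
  rewrite /Num.max /Num.min => n1 n2.
  case: (ltP b s') => h1; case: (ltP b s) => h2;
    do ?[case: (ltP a b) => h3]; do ?[case: (ltP a s') => h4]; do ?[case: (ltP a s) => h5];
    rewrite ?subrr ?normr0//; rewrite ler_norml; lra.
have near_eq s : \forall s' \near s, f (Num.max a (Num.min b s')) = f (Num.max a (Num.min b s)).
  have [d d0 hd] := cl s; apply/nbhs_ballP; exists d => // s'.
  by rewrite /ball /= distrC => /hd.
have := @connected_ind R setT (fun s => f (Num.max a (Num.min b s)) = f a) a openT cR I _ _ _ b I.
rewrite minxx (max_idPr ab); apply.
- by rewrite (min_idPr ab) maxxx.
- by move=> s _ Ps; apply: filterS (near_eq s) => s' ->.
- by move=> s _ Ps; apply: filterS (near_eq s) => s' ->.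
Qed.

(* [A] continues a primitive of [F] along the path [c]. *)
Definition along c A := continuous c /\ forall s, 0 <= s <= 1 -> S (c s) /\
  exists2 d : R, 0 < d & forall s', 0 <= s' <= 1 -> `|s' - s| < d ->
    A s' - A s = incf (c s) (c s').

(** As long as the path stays in one ball, [A s - incf (c a) (c s)] is locally constant, by
    additivity of the increments. *)
Lemma along_local c A (a b : R) z r : along c A -> 0 <= a -> a <= b -> b <= 1 ->
  cball z r -> (forall s, a <= s <= b -> ball z r (c s)) ->
  A b - A a = incf (c a) (c b).
Proof.
move=> [_ hA] a0 ab b1 cb hb.
have sub s : a <= s <= b -> 0 <= s <= 1.
  by move=> /andP[h1 h2]; rewrite (le_trans a0)// (le_trans h2).
have ba : ball z r (c a) by apply: hb; rewrite lexx ab.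
suff : A b - incf (c a) (c b) = A a - incf (c a) (c a).
  move/eqP; rewrite subr_eq => /eqP ->.
  have aab : a <= a <= b by rewrite lexx ab.
  by have [Sa _] := hA a (sub a aab); rewrite incfxx//; ring.
apply: (@clamp_const _ (fun s => A s - incf (c a) (c s)) a b) => // s sab.
have [_ [d d0 hd]] := hA s (sub s sab).
exists d => // s' s'ab ss'.
have := hd s' (sub s' s'ab) ss'.
rewrite -(incfD cb ba (hb s sab) (hb s' s'ab)) => E.
by rewrite opprD addrA addrAC -E; ring.
Qed.

Lemma along_seg z r x y : cball z r -> ball z r x -> ball z r y ->
  along (fun s => x + s *: (y - x)) (fun s => incf x (x + s *: (y - x))).
Proof.
move=> cb bx by_; split.
  by move=> s; have [h _] := is_diff_line x (y - x) s; exact: differentiable_continuous.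
move=> s s01; have bs := ball_seg bx by_ s01.
split; first by case: cb => _; exact.
exists 1 => // s' s'01 _; have bs' := ball_seg bx by_ s'01.
by rewrite -(incfD cb bx bs bs') addrC addKr.
Qed.

Lemma along_rev c A : along c A -> along (fun s => c (1 - s)) (fun s => A (1 - s)).
Proof.
move=> [cc h]; split.
  move=> s; apply: (@continuous_comp R R (R * R)%type (fun s => 1 - s) c); last exact: cc.
  by apply: cvgB; [exact: cvg_cst|exact: cvg_id].
move=> s s01; have s01' : 0 <= 1 - s <= 1 by lra.
have [Sc [d d0 hd]] := h _ s01'; split => //; exists d => // s' s'01 ss'.
apply: hd; first by lra.
have -> : 1 - s' - (1 - s) = - (s' - s) by ring.
by rewrite normrN.
Qed.

(* Used both for paths with [f 1 = g 0] and for increments that accumulate. *)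
Definition catp (T : zmodType) (f g : R -> T) s : T :=
  f (Num.min 1 (2 * s)) + g (Num.max 0 (2 * s - 1)) - g 0.

Lemma catpl (T : zmodType) (f g : R -> T) s : s <= 1 / 2 -> catp f g s = f (2 * s).
Proof.
move=> h; rewrite /catp (min_idPr _); last by lra.
by rewrite (max_idPl _) ?addrK//; lra.
Qed.

Lemma catpr (T : zmodType) (f g : R -> T) s : 1 / 2 <= s ->
  catp f g s = f 1 + (g (2 * s - 1) - g 0).
Proof.
move=> h; rewrite /catp (min_idPl _); last by lra.
by rewrite (max_idPr _) ?addrA//; lra.
Qed.

Lemma along_cat c A c' A' : along c A -> along c' A' -> c 1 = c' 0 ->
  along (catp c c') (catp A A').
Proof.
move=> [cc h] [cc' h'] e.
have e' s : 1 / 2 <= s -> catp c c' s = c' (2 * s - 1).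
  by move=> hs; rewrite catpr// e addrCA subrr addr0.
split.
  move=> s.
  have c2 : {for s, continuous (fun s => 2 * s : R)}.
    by apply: cvgM; [exact: cvg_cst|exact: cvg_id].
  have cmin : {for s, continuous (fun s : R => Num.min 1 (2 * s))}.
    by apply: (@continuous_min R R (fun=> 1)); [exact: cvg_cst|].
  have cmax : {for s, continuous (fun s : R => Num.max 0 (2 * s - 1))}.
    by apply: (@continuous_max R R (fun=> 0)); [exact: cvg_cst|apply: cvgB => //; exact: cvg_cst].
  apply: cvgB; last exact: cvg_cst.
  apply: cvgD.
    by apply: (@continuous_comp R R (R * R)%type (fun s => Num.min 1 (2 * s)) c) => //; exact: cc.
  by apply: (@continuous_comp R R (R * R)%type (fun s => Num.max 0 (2 * s - 1)) c') => //; exact: cc'.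
move=> s s01; have [s2|s2|s2] := ltgtP s (1 / 2).
- have s01' : 0 <= 2 * s <= 1 by lra.
  have [Sc [d d0 hd]] := h _ s01'; rewrite !catpl ?ltW//; split => //.
  exists (Num.min (d / 2) (1 / 2 - s)); first by rewrite lt_min divr_gt0//= subr_gt0.
  move=> s' s'01; rewrite lt_min => /andP[h1 h2].
  have s'2 : s' <= 1 / 2 by have := ler_norm (s' - s); lra.
  rewrite !catpl//; apply: hd; first by lra.
  by rewrite -mulrBr normrM ger0_norm//; lra.
- have s01' : 0 <= 2 * s - 1 <= 1 by lra.
  have [Sc [d d0 hd]] := h' _ s01'; rewrite !e' ?ltW//; split => //.
  exists (Num.min (d / 2) (s - 1 / 2)); first by rewrite lt_min divr_gt0//= subr_gt0.
  move=> s' s'01; rewrite lt_min => /andP[h1 h2].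
  have s'2 : 1 / 2 <= s' by have := ler_norm (s - s'); rewrite distrC; lra.
  rewrite !e'// ?(ltW s2)// !catpr ?(ltW s2)//.
  have -> (a b p q : R[i]) : (a + (b - p)) - (a + (q - p)) = b - q by ring.
  apply: hd; first by lra.
  have -> : 2 * s' - 1 - (2 * s - 1) = 2 * (s' - s) by ring.
  by rewrite normrM ger0_norm//; lra.
(* At the junction s = 1/2 both halves are compared with the common point c 1 = c' 0; each half runs
   at double speed, which halves the radii. *)
- have u1 : 0 <= (1 : R) <= 1 by rewrite ler01 lexx.
  have u0 : 0 <= (0 : R) <= 1 by rewrite ler01 lexx.
  have [Sc [d d0 hd]] := h _ u1; have [_ [d' d'0 hd']] := h' _ u0.
  have es : catp c c' s = c 1 by rewrite catpl ?s2//; congr c; field.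
  have eA : catp A A' s = A 1 by rewrite catpl ?s2//; congr A; field.
  rewrite es eA; split => //.
  exists (Num.min (d / 2) (d' / 2)); first by rewrite lt_min !divr_gt0.
  move=> s' s'01; rewrite lt_min s2 => /andP[h1 h2].
  have [s'2|s'2] := leP s' (1 / 2).
    rewrite !catpl//; apply: hd; first by lra.
    have -> : 2 * s' - 1 = 2 * (s' - 1 / 2) by field.
    by rewrite normrM ger0_norm//; lra.
  rewrite e' ?(ltW s'2)// catpr ?(ltW s'2)// e [A 1 + _]addrC addrK.
  apply: hd'; first by lra.
  have -> : 2 * s' - 1 - 0 = 2 * (s' - 1 / 2) by field.
  by rewrite normrM ger0_norm//; lra.
Qed.

Hypothesis scS : simply_connected S.

(** Compactness of the square makes the continuity of [h] uniform relative to the balls contained in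
    [S]. *)
Lemma lebesgue_number (h : R * R -> R * R) :
  {within `[0, 1] `*` `[0, 1], continuous h} ->
  h @` (`[0, 1] `*` `[0, 1]) `<=` S ->
  exists2 d : R, 0 < d & forall p, (`[0, 1] `*` `[0, 1])%classic p ->
    exists z r, cball z r /\ forall q, (`[0, 1] `*` `[0, 1])%classic q ->
      `|q - p| < d -> ball z r (h q).
Proof.
set K := (_ `*` _)%classic => ch hS.
have cK : compact K by apply: compact_setX; exact: segment_compact.
pose P (d : R) p := exists z r, cball z r /\ forall q, K q -> `|q - p| < d -> ball z r (h q).
suff H : \forall d \near (0 : R)^'+, K `<=` P d.
  have [d /= [d0 hd]] := filter_ex (filterI (nbhs_right_gt (0 : R)) H).
  by exists d.
move/compact_near_coveringP : cK => /(_ R (0 : R)^'+ P _); apply => x Kx.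
have Sx : S (h x) by apply: hS; exists x.
have [r r0 bS] := open_ball_sub oS Sx.
move/subspace_continuousP : ch => /(_ x Kx) /(_ (ball (h x) r) (nbhsx_ballx _ _ r0)).
move=> /nbhs_ballP[e /= e0 he].
exists (ball x (e / 2), [set d : R | d < e / 2]) => /=.
  split; first by apply: nbhsx_ballx; rewrite divr_gt0.
  by apply: nbhs_right_lt; rewrite divr_gt0.
move=> [p d] /= [bp de]; exists (h x), r; split => // q Kq qp.
apply: he => //; rewrite -ball_normE /=; move: bp; rewrite -ball_normE /= => bp.
have -> : x - q = (x - p) - (q - p) by rewrite opprB addrA subrK.
apply: le_lt_trans (ler_normB _ _) _.
by rewrite [e]splitr ltrD// (lt_trans qp).
Qed.

(* On the squares of a fine enough grid of the homotopy the increments around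
   each square cancel; [rho j], the sum over the j-th row, is thus independent
   of [j], and vanishes on the last row, where the loop is constant. *)
Lemma loop_zero c A : along c A -> c 0 = c 1 -> A 1 = A 0.
Proof.
move=> hcA c01; have [cc hA] := hcA.
have [_ /(_ c)] := scS.
move=> /(_ (continuous_subspaceT cc)) [|//|h [ch hS h0 h1 hlr]].
  by move=> _ [s /= + <-]; rewrite in_itv /= => /hA [].
have [d d0 hd] := lebesgue_number ch hS.
have [n] := ltr_add_invr d0; rewrite add0r => nd.
pose N := n.+1.
have N0 : 0 < N%:R :> R by rewrite ltr0n.
pose u (i : nat) : R := i%:R / N%:R.
have u01 i : (i <= N)%N -> 0 <= u i <= 1.
  by move=> iN; rewrite divr_ge0//= ler_pdivrMr// mul1r ler_nat.
have uS i : u i.+1 - u i = N%:R^-1 by rewrite /u -mulrBl -natr1 addrAC subrr add0r mul1r.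
have u0 : u 0%N = 0 by rewrite /u mul0r.
have uN : u N = 1 by rewrite /u divff// gt_eqF.
pose g i j := h (u i, u j).
have Ku i j : (i <= N)%N -> (j <= N)%N -> (`[0, 1] `*` `[0, 1])%classic (u i, u j).
  by move=> iN jN; split; rewrite /= in_itv /= u01.
have sq i j : (i < N)%N -> (j < N)%N -> exists z r, cball z r /\
    forall s t, u i <= s <= u i.+1 -> u j <= t <= u j.+1 -> ball z r (h (s, t)).
  move=> iN jN; have [z [r [cb hb]]] := hd _ (Ku i j (ltnW iN) (ltnW jN)).
  exists z, r; split => // s t /andP[s1 s2] /andP[t1 t2]; apply: hb.
    have := u01 _ (ltnW iN); have := u01 _ iN; have := u01 _ (ltnW jN); have := u01 _ jN.
    by split; rewrite /= in_itv /=; lra.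
  apply: le_lt_trans nd; rewrite prod_normE ge_max /=.
  by apply/andP; split; rewrite ger0_norm ?subr_ge0// -/N; [rewrite -(uS i)|rewrite -(uS j)]; rewrite lerD2r.
have sqp i j : (i < N)%N -> (j < N)%N -> exists z r, [/\ cball z r, ball z r (g i j),
   ball z r (g i.+1 j), ball z r (g i j.+1) & ball z r (g i.+1 j.+1)].
  move=> iN jN; have [z [r [cb hb]]] := sq i j iN jN.
  have le k : u k <= u k.+1 by rewrite -subr_ge0 uS invr_ge0 ltW.
  by exists z, r; split => //; apply: hb; rewrite !lexx ?le.
pose rho j := \sum_(i < N) incf (g i j) (g i.+1 j).
have rhoS j : (j < N)%N -> rho j = rho j.+1.
  move=> jN.
  have E (i : 'I_N) : incf (g i j) (g i.+1 j) =
     incf (g i j.+1) (g i.+1 j.+1) + (incf (g i j) (g i j.+1) - incf (g i.+1 j) (g i.+1 j.+1)).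
    have [z [r [cb b1 b2 b3 b4]]] := sqp i j (ltn_ord i) jN.
    have E1 := incfD cb b1 b2 b4; have E2 := incfD cb b1 b3 b4.
    rewrite -E2 in E1.
    by apply: (addIr (incf (g i.+1 j) (g i.+1 j.+1))); rewrite E1; ring.
  rewrite /rho (eq_bigr _ (fun i _ => E i)) big_split /=.
  rewrite (_ : \sum_(i < N) (incf (g i j) (g i j.+1) - _) = 0) ?addr0//.
  (* The vertical increments telescope to the difference between the left and right sides, which
     agree because every stage of the homotopy is a closed loop. *)
  have -> : \sum_(i < N) (incf (g i j) (g i j.+1) - incf (g i.+1 j) (g i.+1 j.+1)) =
    - \sum_(0 <= i < N) (incf (g i.+1 j) (g i.+1 j.+1) - incf (g i j) (g i j.+1)).
    by rewrite big_mkord -sumrN; apply: eq_bigr => i _; rewrite opprB.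
  rewrite (telescope_sumr (fun i => incf (g i j) (g i j.+1)))//.
  have e k : (k <= N)%N -> g N k = g 0%N k.
    by move=> kN; rewrite /g u0 uN -hlr// in_itv /= u01.
  by rewrite !e ?(ltnW jN)// subrr oppr0.
have rho0 : rho 0%N = rho N.
  suff : forall j, (j <= N)%N -> rho 0%N = rho j by apply.
  by elim=> // j IH jN; rewrite IH ?(ltnW jN)// rhoS.
have rhoN : rho N = 0.
  rewrite /rho big1// => i _.
  have e k : (k <= N)%N -> g k N = h (0, 1) by move=> kN; rewrite /g uN h1// in_itv /= u01.
  rewrite !e// ?(ltnW (ltn_ord i))// incfxx//; apply: hS; exists (0, 1) => //.
  by split; rewrite /= in_itv /= ?lexx ?ler01.
have : A 1 - A 0 = rho 0%N.
  rewrite /rho -(big_mkord xpredT (fun i => incf (g i 0%N) (g i.+1 0%N))).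
  rewrite -uN -u0 -(telescope_sumr (fun i => A (u i)))//.
  rewrite !big_nat; apply: eq_bigr => i /= iN.
  have [z [r [cb hb]]] := sq i 0%N iN isT.
  have le k : u k <= u k.+1 by rewrite -subr_ge0 uS invr_ge0 ltW.
  have e k : (k <= N)%N -> g k 0%N = c (u k).
    by move=> kN; rewrite /g u0 h0// in_itv /= u01.
  rewrite !e// ?(ltnW iN)//; apply: (along_local hcA _ _ _ cb) => //.
  - by have /andP[] := u01 i (ltnW iN).
  - by have /andP[] := u01 _ iN.
  - move=> s si; rewrite -h0; last first.
      have := u01 _ iN; have := u01 _ (ltnW iN); rewrite in_itv /=; lra.
    by apply: hb => //; rewrite u0 lexx -u0 le.
rewrite rho0 rhoN => /eqP; rewrite subr_eq0 => /eqP.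
exact.
Qed.

(** [G z] is the value at [z] of the continuation of [0] along a path from a base point. Two paths
    give the same value because one followed by the reverse of the other is a loop, to which
    [loop_zero] applies. *)
Lemma sc_primitive : S !=set0 -> exists G, hol S G F.
Proof.
move=> [z0 Sz0]; have [cS _] := scS.
pose reach z (v : R[i]) := exists c A, [/\ along c A, c 0 = z0, c 1 = z, A 0 = 0 & A 1 = v].
have reach_fun z v v' : reach z v -> reach z v' -> v = v'.
  move=> [c [A [cA c0 c1 A0 A1]]] [c' [A' [cA' c0' c1' A0' A1']]].
  have al := along_cat cA (along_rev cA').
  have e12 : 0 <= 1 / 2 :> R by lra.
  have e12' : 1 / 2 <= 1 :> R by lra.
  have := loop_zero (al _).
  rewrite !(catpl _ _ e12) !(catpr _ _ e12') !mulr0 mulr1 !subr0.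
  have -> : 2 - 1 = 1 :> R by ring.
  rewrite subrr c0 c1 c0' c1' A0 A1 A0' A1' => H.
  have : v + (0 - v') = 0 by apply: H => //; rewrite addrCA subrr addr0.
  by rewrite add0r => /eqP; rewrite subr_eq0 => /eqP.
have reachS z v x y r : cball z r -> ball z r x -> ball z r y -> reach x v ->
    reach y (v + incf x y).
  move=> cb bx by_ [c [A [cA c0 c1 A0 A1]]].
  have sg := along_seg cb bx by_.
  have e12 : 0 <= 1 / 2 :> R by lra.
  have e12' : 1 / 2 <= 1 :> R by lra.
  have E0 : c 1 = x + 0 *: (y - x) by rewrite scale0r addr0.
  have := along_cat cA sg E0 => al.
  eexists; eexists; split; first exact: al.
  - by rewrite catpl// mulr0.
  - rewrite catpr// scale0r addr0 c1; have -> : 2 * 1 - 1 = 1 :> R by ring.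
    by rewrite scale1r addrCA subrr addr0 addrCA subrr addr0.
  - by rewrite catpl// mulr0.
  - rewrite catpr// scale0r addr0; have -> : 2 * 1 - 1 = 1 :> R by ring.
    have -> : x + 1 *: (y - x) = y by rewrite scale1r addrCA subrr addr0.
    rewrite A1 incfxx ?subr0//.
    by case: cb => _; exact.
have reach0 : reach z0 0.
  have [r r0 bS] := open_ball_sub oS Sz0.
  have bz : ball z0 r z0 by exact: ballxx.
  have sg := along_seg (conj r0 bS) bz bz.
  eexists; eexists; split; first exact: sg.
  - by rewrite subrr scaler0 addr0.
  - by rewrite subrr scaler0 addr0.
  - by rewrite subrr scaler0 addr0 incfxx.
  - by rewrite subrr scaler0 addr0 incfxx.
have reach_all : forall z, S z -> exists v, reach z v.
  apply: (@connected_ind _ S (fun z => exists v, reach z v) z0) => //; first by exists 0.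
  - move=> z Sz [v rv]; have [r r0 bS] := open_ball_sub oS Sz.
    apply/nbhs_ballP; exists r => // w bw; exists (v + incf z w).
    by apply: (reachS z v z w r) => //; exact: ballxx.
  - move=> z Sz nv; have [r r0 bS] := open_ball_sub oS Sz.
    apply/nbhs_ballP; exists r => // w bw [v rv]; apply: nv; exists (v + incf w z).
    by apply: (reachS z v w z r) => //; exact: ballxx.
pose G z := xget 0 [set v | reach z v].
have GP z : S z -> reach z (G z).
  by move=> /reach_all h; exact: (@xgetPex _ 0 [set v | reach z v] h).
exists G => z Sz; have [r r0 bS] := open_ball_sub oS Sz.
have [P hP eP] := @incf_prim z r (conj r0 bS).
have bz : ball z r z by exact: ballxx.
have hPz : cdiff z (fun w => P w + (G z - P z)) (fun h => F z * cz h).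
  by apply: cdiff_eq (cdiffD (hP z bz) (cdiff_cst z _)) _ => h; rewrite addr0.
apply: cdiff_near hPz _; apply/nbhs_ballP; exists r => // w bw.
have := reachS z (G z) z w r (conj r0 bS) bz bw (GP z Sz).
move=> /(reach_fun _ _ _ (GP w (bS _ bw))) ->; rewrite eP//; ring.
Qed.

End Monodromy.

(** * Level lines of the imaginary part of a holomorphic function *)

Section Flow.
Variable R : realType.
Implicit Types (z x y : R * R) (t s : R).

Lemma Re_le_norm (v : R * R) : `|v.1| <= `|v|. Proof. by rewrite prod_normE le_max lexx. Qed.
Lemma Im_le_norm (v : R * R) : `|v.2| <= `|v|. Proof. by rewrite prod_normE le_max lexx orbT. Qed.

Lemma cdiff_line (F : R * R -> R[i]) z (v : R * R) a s : cdiff (z + s *: v) F (fun h => a * cz h) ->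
  cdiff s (fun s : R => F (z + s *: v)) (fun h : R => a * cz (h *: v)).
Proof.
by move=> h; exact: (cdiff_eq (cdiff_comp (is_diff_line z v s) h)).
Qed.

(** The mean value theorem is applied to the real and imaginary parts of g - id, obtained with the
    factors [k] = 1 and - i; in the sup norm the two bounds 1/8 add up to 1/4. *)
Lemma near_identity (U : set (R * R)) (g g' : R * R -> R[i]) z0 (r : R) :
  hol U g g' -> ball z0 r `<=` U ->
  (forall z, ball z0 r z -> `|Re (g' z) - 1| <= 1 / 8 /\ `|Im (g' z)| <= 1 / 8) ->
  forall x y, ball z0 r x -> ball z0 r y ->
   `|pt (g y - g x) - (y - x)| <= 1 / 4 * `|y - x|.
Proof.
move=> hg bU small x y bx by_.
have n1 := Re_le_norm (y - x); have n2 := Im_le_norm (y - x).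
have H (k : R[i]) : `|Re k| + `|Im k| = 1 -> (Re k == 0) || (Im k == 0) ->
   `|Re (k * (g y - g x - cz (y - x)))| <= 1 / 4 * `|y - x|.
  move=> k1 k0.
  have [|s s01] := @seg_MVT R (fun s => Re (k * (g (x + s *: (y - x)) - s%:C * cz (y - x))))
    (fun s => Re (k * ((g' (x + s *: (y - x)) - 1) * cz (y - x)))).
    move=> s s01; have bs := ball_seg bx by_ s01.
    have := cdiff_is_derive (cdiffM (cdiff_cst s k)
      (cdiffB (cdiff_line (hg _ (bU _ bs))) (cdiffM (cdiff_real s) (cdiff_cst s (cz (y - x)))))).
    by move=> h; apply: is_derive_eq; rewrite scale1r /cst; congr (Re _); ring.
  rewrite !scale1r scale0r addr0 [x + _]addrCA subrr addr0 mul0r subr0 => E.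
  have -> : Re (k * (g y - g x - cz (y - x))) = Re (k * (g y - 1%:C * cz (y - x))) - Re (k * g x).
    by rewrite !ReImE /=; ring.
  rewrite E; have [] := small _ (ball_seg bx by_ s01).
  move: (g' _) => G' ha hb; rewrite ReM.
  have eR : Re ((G' - 1) * cz (y - x)) = (Re G' - 1) * (y - x).1 - Im G' * (y - x).2.
    by rewrite !ReImE /= oppr0 addr0.
  have eI : Im ((G' - 1) * cz (y - x)) = (Re G' - 1) * (y - x).2 + Im G' * (y - x).1.
    by rewrite !ReImE /= oppr0 addr0.
  rewrite eR eI.
  have hh : 1 / 4 * `|y - x| = 1 / 8 * `|y - x| + 1 / 8 * `|y - x| by field.
  have e1 : `|(Re G' - 1) * (y - x).1 - Im G' * (y - x).2| <= 1 / 4 * `|y - x|.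
    rewrite hh; apply: le_trans (ler_normB _ _) _; rewrite !normrM.
    by apply: lerD; apply: ler_pM.
  have e2 : `|(Re G' - 1) * (y - x).2 + Im G' * (y - x).1| <= 1 / 4 * `|y - x|.
    rewrite hh; apply: le_trans (ler_normD _ _) _; rewrite !normrM.
    by apply: lerD; apply: ler_pM.
  move: k1; case/orP: k0 => /eqP ->; rewrite normr0 ?add0r ?addr0 => k1.
    by apply: le_trans e2; rewrite mul0r sub0r normrN normrM k1 mul1r.
  by apply: le_trans e1; rewrite mul0r subr0 normrM k1 mul1r.
rewrite prod_normE ge_max; apply/andP; split.
- have := H 1; rewrite /= normr1 normr0 addr0 eqxx orbT mul1r => /(_ erefl isT).
  by rewrite !ReImE.
- have := H (- 'i); rewrite /= oppr0 normr0 normrN normr1 add0r eqxx => /(_ erefl isT).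
  rewrite ReM /= oppr0 mul0r sub0r mulN1r opprK.
  by rewrite !ReImE.
Qed.

(** The constant is 1 / (1 - 1/4). *)
Lemma near_identity_lower (U : set (R * R)) (g g' : R * R -> R[i]) z0 (r : R) :
  hol U g g' -> ball z0 r `<=` U ->
  (forall z, ball z0 r z -> `|Re (g' z) - 1| <= 1 / 8 /\ `|Im (g' z)| <= 1 / 8) ->
  forall x y, ball z0 r x -> ball z0 r y -> `|y - x| <= 4 / 3 * `|pt (g y - g x)|.
Proof.
move=> hg bU small x y bx by_.
have := near_identity hg bU small bx by_.
have := ler_normB (pt (g y - g x)) (pt (g y - g x) - (y - x)).
rewrite subKr; lra.
Qed.

(* A minimum of [normsq (g - g z0 - tau)] over a square is interior, and there
   the nonvanishing of [g'] forces the value [0]. *)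
Lemma near_identity_surj (U : set (R * R)) (g g' : R * R -> R[i]) z0 (r rho : R) (tau : R[i]) :
  hol U g g' -> ball z0 r `<=` U -> 0 < rho -> rho < r ->
  (forall z, ball z0 r z -> `|Re (g' z) - 1| <= 1 / 8 /\ `|Im (g' z)| <= 1 / 8) ->
  `|pt tau| <= rho / 4 -> exists2 z, ball z0 r z & g z = g z0 + tau.
Proof.
move=> hg bU rho0 rr small ht.
have r0 : 0 < r by exact: lt_trans rr.
pose K : set (R * R) := `[z0.1 - rho, z0.1 + rho]%classic `*` `[z0.2 - rho, z0.2 + rho]%classic.
have KE z : K z <-> `|z - z0| <= rho.
  rewrite prod_normE ge_max /K /= !in_itv /= !ler_norml /=; split.
    by move=> [] /andP[? ?] /andP[? ?]; lra.
  by move=> h; split; lra.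
have Kb z : K z -> ball z0 r z.
  by move=> /KE h; rewrite -ball_normE /= distrC; exact: le_lt_trans h rr.
have cK : compact K by apply: compact_setX; exact: segment_compact.
pose w z := g z - g z0 - tau.
have dw z : ball z0 r z -> cdiff z w (fun h => g' z * cz h).
  move=> bz; apply: cdiff_eq (cdiffB (cdiffB (hg _ (bU _ bz)) (cdiff_cst z (g z0))) (cdiff_cst z tau)) _ => h.
  by rewrite /cst !subr0.
pose N z := normsq (w z).
have cN : {within K, continuous N}.
  have -> : N = (fun z => Re (w z * (Re (w z) -i* Im (w z)))).
    by apply/funext => z; rewrite /N /normsq ReM /=; ring.
  apply: within_cdf => z /Kb bz; have [w1 w2] := dw z bz.
  apply: cdfM; first by eexists; exact: dw.
  exists (fun h => Re (g' z * cz h) -i* Im (g' z * cz h)); split; first exact: w1.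
  exact: (is_diffN w2).
have K0 : K !=set0 by exists z0; apply/KE; rewrite subrr normr0 ltW.
have [m /[!inE] Km hm] := compact_EVT_min K0 cK cN.
have bm := Kb m Km.
have bz0 : ball z0 r z0 by exact: ballxx.
(* At distance [rho] from [z0] the norm of [w] would be at least 3 rho / 4 - rho / 4, so [N] at
   least rho^2 / 4, whereas [N z0] is at most 2 (rho / 4)^2. *)
have mrho : `|m - z0| < rho.
  rewrite lt_neqAle; move/KE: (Km) => ->; rewrite andbT; apply/eqP => E.
  have l := near_identity_lower hg bU small bz0 bm.
  have Kz0 : K z0 by apply/KE; rewrite subrr normr0 ltW.
  have h0 := hm z0 (mem_set Kz0).
  have wz0 : N z0 <= rho ^+ 2 / 8.
    rewrite /N /w subrr sub0r /normsq !ReImE !sqrrN.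
    have := Re_le_norm (pt tau); have := Im_le_norm (pt tau); rewrite /= => h1 h2.
    rewrite -[Re tau ^+ 2]real_normK ?num_real// -[Im tau ^+ 2]real_normK ?num_real//.
    have : `|Im tau| ^+ 2 <= (rho / 4) ^+ 2.
      by rewrite ler_sqr ?nnegrE//; [exact: le_trans h1 ht|rewrite divr_ge0// ltW].
    have : `|Re tau| ^+ 2 <= (rho / 4) ^+ 2.
      by rewrite ler_sqr ?nnegrE//; [exact: le_trans h2 ht|rewrite divr_ge0// ltW].
    by rewrite !expr2; lra.
  have wm : rho / 2 <= `|pt (w m)|.
    have -> : pt (w m) = pt (g m - g z0) - pt tau.
      by apply: (can_inj (@czK R)); rewrite czD czN !ptK.
    by have := ler_normB (pt (g m - g z0) - pt tau) (- pt tau); rewrite opprK subrK normrN; lra.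
  have wN : (rho / 2) ^+ 2 <= N m.
    rewrite /N /normsq.
    move: wm; rewrite prod_normE le_max => /orP[] /= h.
    - apply: (@le_trans _ _ (Re (w m) ^+ 2)); last by rewrite lerDl sqr_ge0.
      by rewrite -[leRHS]real_normK ?num_real// ler_sqr ?nnegrE// divr_ge0// ltW.
    - apply: (@le_trans _ _ (Im (w m) ^+ 2)); last by rewrite lerDr sqr_ge0.
      by rewrite -[leRHS]real_normK ?num_real// ler_sqr ?nnegrE// divr_ge0// ltW.
  have : 0 < rho ^+ 2 by rewrite exprn_gt0.
  move: wN wz0 h0; rewrite !expr2 -/(N _); lra.
exists m => //.
have gm0 : g' m != 0.
  have [h _] := small m bm; apply: contraTneq h => -> /=.
  by rewrite sub0r normrN normr1 -ltNge; lra.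
(* In this direction the derivative of [w] at [m] is [w m] itself, so that the derivative of [N],
   zero at the minimum, is [2 * normsq (w m)]. *)
pose v := pt (w m / g' m).
have [d d0 hd] : exists2 d : R, 0 < d & forall s, `|s| < d -> K (m + s *: v).
  pose q := rho - `|m - z0|.
  have q0 : 0 < q by rewrite subr_gt0.
  have v1 : 0 < `|v| + 1 by rewrite ltr_wpDl.
  exists (q / (`|v| + 1)); first exact: divr_gt0.
  move=> s; rewrite ltr_pdivlMr// => hs; apply/KE.
  rewrite addrAC; apply: le_trans (ler_normD _ _) _.
  rewrite normrZ -lerBrDl -/q ltW//; apply: le_lt_trans hs.
  by rewrite ler_wpM2l// lerDl.
have Nd s : `|s| < d -> is_derive s 1 (fun s => N (m + s *: v))
    (2 * (Re (w (m + s *: v)) * Re (g' (m + s *: v) * cz v) + Im (w (m + s *: v)) * Im (g' (m + s *: v) * cz v))).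
  move=> /hd /Kb bs.
  have h := is_derive_of_diff (is_diff_normsq (cdiff_line (dw _ bs))).
  by apply: (is_derive_eq h); rewrite scale1r; ring.
have : is_derive (0:R) 1 (fun s => N (m + s *: v)) 0.
  apply: (@derive1_at_min _ _ (- d) d).
  - lra.
  - by move=> s; rewrite in_itv /= -ltr_norml => /Nd [].
  - by rewrite in_itv /= oppr_lt0 d0.
  - move=> s; rewrite in_itv /= -ltr_norml => /hd Ks.
    by rewrite scale0r addr0; apply: hm; rewrite inE.
move=> [_ D0].
have s0d : `|0 : R| < d by rewrite normr0.
have [_ D1] := Nd 0 s0d.
move: D0; rewrite D1 scale0r addr0 /v ptK.
have -> : g' m * (w m / g' m) = w m by field.
move=> /eqP; rewrite mulf_eq0 pnatr_eq0 orFb -!expr2 -/(normsq (w m)) normsq_eq0 => /eqP w0.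
by move: w0; rewrite /w -addrA -opprD => /eqP; rewrite subr_eq0 => /eqP.
Qed.

Lemma is_diff_eps (V W : normedModType R) (f df : V -> W) (x : V) (e : R) :
  is_diff x f df -> 0 < e -> \forall h \near (0 : V), `|f (x + h) - f x - df h| <= e * `|h|.
Proof.
move=> [dfx <-] e0.
have : f \o shift x = cst (f x) + 'd f x +o_ 0 id by exact: diff_locally.
move/eqaddoP => /(_ _ e0); apply: filterS => h.
by rewrite !fctE /= [h + x]addrC opprD addrA.
Qed.

Lemma norm_pt_mul (a b : R[i]) : `|pt (a * b)| <= 2 * `|pt a| * `|pt b|.
Proof.
have a1 := Re_le_norm (pt a); have a2 := Im_le_norm (pt a).
have b1 := Re_le_norm (pt b); have b2 := Im_le_norm (pt b).
rewrite /= in a1 a2 b1 b2.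
have e : 2 * `|pt a| * `|pt b| = `|pt a| * `|pt b| + `|pt a| * `|pt b| by ring.
rewrite e [leLHS]prod_normE ge_max /= !ReImE; apply/andP; split.
  by apply: le_trans (ler_normB _ _) _; rewrite !normrM; apply: lerD; apply: ler_pM.
by apply: le_trans (ler_normD _ _) _; rewrite !normrM; apply: lerD; apply: ler_pM.
Qed.

Lemma pt_real_mul (h : R) (a : R[i]) : pt (h%:C * a) = h *: pt a.
Proof. by apply: (can_inj (@czK R)); rewrite czZ !ptK. Qed.

(* [c t] is the solution of [zeta (c t) = zeta z0 + t]. *)
Lemma flow (U : set (R * R)) (zeta Zp : R * R -> R[i]) z0 : open U -> U z0 ->
  hol U zeta Zp -> Hol U Zp -> Zp z0 != 0 ->
  exists e : R, exists c : R -> R * R, [/\ 0 < e, c 0 = z0 &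
    forall t, `|t| < e -> [/\ U (c t), Zp (c t) != 0 &
      is_diff t c (fun h : R => pt (h%:C / Zp (c t)))]].
Proof.
move=> oU Uz0 hz HZ a0; set a := Zp z0 in a0.
(* Dividing by [a] makes the derivative equal to 1 at [z0], as the near-identity lemmas require on a
   small ball. *)
pose g z := zeta z * a^-1; pose g' z := Zp z * a^-1.
have hg : hol U g g'.
  move=> z Uz; apply: cdiff_eq (cdiffM (hz _ Uz) (cdiff_cst z a^-1)) _ => h.
  rewrite /cst /g'; ring.
have cg : cdf z0 g'.
  by apply: cdfM; [eexists; exact: (Hol_hol HZ)|exact: cdf_cst].
have g'z0 : g' z0 = 1 by rewrite /g' -/a divff.
have [r r0 hr] : exists2 r : R, 0 < r & forall z, ball z0 r z -> U z /\
    (`|Re (g' z) - 1| <= 1 / 8 /\ `|Im (g' z)| <= 1 / 8).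
  have e8 : 0 < 1 / 8 :> R by lra.
  have /nbhs_ballP[r r0 hr] : \forall z \near z0, U z /\
    (`|Re (g' z) - 1| <= 1 / 8 /\ `|Im (g' z)| <= 1 / 8).
    have h1 := nearU oU Uz0.
    have /cvgrPdist_le/(_ _ e8) h2 := cdf_continuous_Re cg.
    have /cvgrPdist_le/(_ _ e8) h3 := cdf_continuous_Im cg.
    apply: filterS3 h1 h2 h3 => z Uz /=; rewrite g'z0 /= sub0r normrN distrC.
    by move=> ? ?.
  by exists r.
have bU : ball z0 r `<=` U by move=> z /hr [].
have small z : ball z0 r z -> `|Re (g' z) - 1| <= 1 / 8 /\ `|Im (g' z)| <= 1 / 8.
  by move=> /hr [].
have lower := near_identity_lower hg bU small.
have r2 : 0 < r / 2 by rewrite divr_gt0.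
have r2r : r / 2 < r by lra.
pose L := `|pt a^-1|.
have Lge0 : 0 <= L by exact: normr_ge0.
have L1 : 0 < L + 1 by rewrite ltr_wpDl.
(* For |t| < e the shift t / a has norm at most (r / 2) / 4, the bound in [near_identity_surj] with
   [rho] = r / 2. *)
pose e := r / 2 / 4 / (L + 1).
have e0 : 0 < e by rewrite !divr_gt0.
have tL t : `|t| < e -> `|pt (t%:C * a^-1)| <= r / 2 / 4.
  rewrite /e ltr_pdivlMr// pt_real_mul normrZ -/L => /ltW; apply: le_trans.
  by rewrite ler_wpM2l// lerDl.
pose c t := xget z0 [set z | ball z0 r z /\ g z = g z0 + t%:C * a^-1].
have cP t : `|t| < e -> ball z0 r (c t) /\ g (c t) = g z0 + t%:C * a^-1.
  move=> te; apply: (@xgetPex _ z0 [set z | ball z0 r z /\ g z = g z0 + t%:C * a^-1]).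
  by have [z bz gz] := near_identity_surj hg bU r2 r2r small (tL t te); exists z.
have g'0 z : ball z0 r z -> g' z != 0.
  move=> /small [h _]; apply: contraTneq h => ->.
  by rewrite sub0r normrN normr1 -ltNge; lra.
have Z0 z : ball z0 r z -> Zp z != 0.
  by move=> /g'0; rewrite /g' mulf_eq0 negb_or => /andP[].
have bz0 : ball z0 r z0 by exact: ballxx.
exists e, c; split => //.
  have [|b0 gc] := cP 0; first by rewrite normr0.
  have := lower _ _ bz0 b0; rewrite gc mul0r addr0 subrr.
  have -> : pt (0 : R[i]) = 0 by [].
  by rewrite normr0 mulr0 normr_le0 subr_eq0 => /eqP.
move=> t te; have [bt gt] := cP t te; split; [exact: bU|exact: Z0|].
pose Lf (h : R) := pt (h%:C / Zp (c t)).
have Llin : linear Lf.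
  by move=> k x y; apply: (can_inj (@czK R)); rewrite /Lf czD czZ !ptK rmorphD rmorphM/=; ring.
pose LM := GRing.isLinear.Build _ _ _ _ _ Llin.
pose LL : {linear R -> (R * R)%type} := HB.pack Lf LM.
have -> : (fun h : R => pt (h%:C / Zp (c t))) = LL by [].
have cL : continuous LL.
  have -> : (LL : R -> R * R) = (fun h : R => h *: pt (Zp (c t))^-1).
    by apply/funext => h; rewrite /= /Lf pt_real_mul.
  exact: scalel_continuous.
apply: is_diff_criterion => // eps eps0.
set x := c t in bt gt *; set q := g' x; have q0 : q != 0 by exact: g'0.
(* Inverting the expansion of [g] costs the factor 2 |1 / q|, and the increment [D] of [c] is at
   most 4/3 L |h|; adding 1 keeps [M] positive. *)
pose M := 2 * `|pt q^-1| * (4 / 3 * L) + 1.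
have M0 : 0 < M by rewrite ltr_wpDl// !mulr_ge0.
have e1 : 0 < eps / M by rewrite divr_gt0.
have [hRe hIm] := hg x (bU _ bt).
have /nbhs_ballP[d1 /= d10 hd1] := is_diff_eps hRe e1.
have /nbhs_ballP[d2 /= d20 hd2] := is_diff_eps hIm e1.
pose d := Num.min d1 d2; have d0 : 0 < d by rewrite lt_min d10.
pose de := Num.min (e - `|t|) (d / (4 / 3 * L + 1)).
have LL1 : 0 < 4 / 3 * L + 1 by rewrite ltr_wpDl// mulr_ge0.
have de0 : 0 < de by rewrite lt_min subr_gt0 te divr_gt0.
apply/nbhs_ballP; exists de => // h; rewrite -ball_normE /= sub0r normrN lt_min => /andP[h1 h2].
have the : `|t + h| < e by apply: le_lt_trans (ler_normD _ _) _; lra.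
have [bth gth] := cP _ the.
pose D := c (t + h) - x.
have gD : g (c (t + h)) - g x = h%:C * a^-1.
  by rewrite gth gt rmorphD /=; ring.
have Dn : `|D| <= 4 / 3 * L * `|h|.
  by have := lower _ _ bt bth; rewrite gD pt_real_mul normrZ -/L -/D; lra.
have Dd : `|D| < d.
  apply: le_lt_trans Dn _; move: h2; rewrite ltr_pdivlMr// mulrC; apply: le_lt_trans.
  by rewrite ler_wpM2r// lerDl.
have [E1 E2] : `|(@complex.Re R \o g) (x + D) - (@complex.Re R \o g) x - (@complex.Re R \o (fun h => g' x * cz h)) D| <= eps / M * `|D| /\
  `|(@complex.Im R \o g) (x + D) - (@complex.Im R \o g) x - (@complex.Im R \o (fun h => g' x * cz h)) D| <= eps / M * `|D|.
  move: Dd; rewrite lt_min => /andP[Dd1 Dd2].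
  by split; [apply: hd1|apply: hd2]; rewrite -ball_normE /= sub0r normrN.
have xD : x + D = c (t + h) by rewrite /D addrCA subrr addr0.
rewrite xD /= in E1 E2.
have EE : `|pt (h%:C * a^-1 - q * cz D)| <= eps / M * `|D|.
  rewrite prod_normE ge_max -gD /=; apply/andP; split.
    by move: E1; rewrite !ReD !ReN.
  by move: E2; rewrite !ImD !ImN.
have -> : c (t + h) - c t - LL h = pt (- (h%:C * a^-1 - q * cz D) * q^-1).
  apply: (can_inj (@czK R)); rewrite czD czN ptK /= /Lf ptK -/x -/D.
  have -> : Zp x = q * a by rewrite /q /g' mulfVK.
  by field; rewrite q0 a0.
apply: le_trans (norm_pt_mul _ _) _.
have -> : `|pt (- (h%:C * a^-1 - q * cz D))| = `|pt (h%:C * a^-1 - q * cz D)|.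
  by rewrite -normrN; congr `|_|; apply: (can_inj (@czK R)); rewrite czN !ptK opprK.
apply: (@le_trans _ _ (2 * (eps / M * (4 / 3 * L * `|h|)) * `|pt q^-1|)).
  rewrite ler_wpM2r// ler_wpM2l//; apply: le_trans EE _.
  by rewrite ler_wpM2l// ltW.
have -> : 2 * (eps / M * (4 / 3 * L * `|h|)) * `|pt q^-1| = eps / M * (M - 1) * `|h|.
  by rewrite /M; ring.
rewrite ler_wpM2r//.
have -> : eps / M * (M - 1) = eps - eps / M by field; rewrite gt_eqF.
by rewrite gerBl ltW.
Qed.

Lemma hol_neq0_near (F : R * R -> R[i]) z : cdf z F -> F z != 0 ->
  \forall w \near z, F w != 0.
Proof.
move=> cF z0.
have z0' : 0 < normsq (F z) by rewrite normsq_gt0.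
have cN : {for z, continuous (fun z => normsq (F z))}.
  by apply: cvgD; apply: cvgM; [exact: cdf_continuous_Re|exact: cdf_continuous_Re|exact: cdf_continuous_Im|exact: cdf_continuous_Im].
have := cN _ (lt_nbhsr z0'); rewrite /nbhs /=.
by apply: filterS => w /=; rewrite normsq_gt0.
Qed.

Lemma open_neq0 (U : set (R * R)) (F : R * R -> R[i]) : open U -> Hol U F ->
  open (U `&` [set z | F z != 0]).
Proof.
move=> oU HF; rewrite openE => z [Uz z0].
have h1 := nearU oU Uz.
have h2 : \forall w \near z, F w != 0.
  by apply: hol_neq0_near => //; eexists; exact: (Hol_hol HF).
exact: filterI h1 h2.
Qed.

(** Since c' = 1 / [Zp] along [c], all derivatives of [c] have the form H (c t) with [H] holomorphic
    where [Zp] does not vanish. *)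
Lemma flow_smooth (U : set (R * R)) (Zp : R * R -> R[i]) (e : R) (c : R -> R * R) :
  open U -> Hol U Zp ->
  (forall t, `|t| < e -> [/\ U (c t), Zp (c t) != 0 &
      is_diff t c (fun h : R => pt (h%:C / Zp (c t)))]) ->
  smooth_on `]- e, e[%classic c.
Proof.
move=> oU HZ hc.
pose U' := U `&` [set z | Zp z != 0].
have oU' : open U' by exact: open_neq0 oU HZ.
have U'U : U' `<=` U by move=> z [].
have HZ' := Hol_sub U'U HZ.
have HV : Hol U' (fun z => (Zp z)^-1) by apply: HolV => // z [].
pose P (f : R -> R * R) := exists2 H, Hol U' H & f = (fun t => pt (H (c t))).
apply: (smooth_coind (P := P)); first exact: interval_open.
  move=> _ [H HH ->].
  have D t : `]- e, e[%classic t -> is_diff t (fun t => pt (H (c t)))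
      (fun h : R => pt (cD H (c t) * (h%:C / Zp (c t)))).
    rewrite /= in_itv /= -ltr_norml => /hc [Ut Zt dt].
    have := pt_diff (cdiff_comp dt (Hol_hol HH (conj Ut Zt))).
    by move=> h; apply: (is_diff_eq h); apply/funext => k /=; rewrite ptK.
  split; first by move=> t /D [].
  move=> v; exists (fun t => pt (v%:C * (cD H (c t) * (Zp (c t))^-1))).
    exists (fun z => v%:C * (cD H z * (Zp z)^-1)); last reflexivity.
    exact: (HolM oU' (Hol_cst oU' _) (HolM oU' (Hol_cD HH) HV)).
  move=> t /[!inE] /D /is_diff_derive ->; congr pt; ring.
exists (@cz R); first exact: Hol_cz.
by apply/funext => t; rewrite czK.
Qed.

End Flow.

(** * Gauss map and second fundamental form *)

Section Mink.
Variable R : realType.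
Implicit Types Y Z : 'cV[R]_4.

Definition o0 : 'I_4 := @Ordinal 4 0 isT.
Definition o1 : 'I_4 := @Ordinal 4 1 isT.
Definition o2 : 'I_4 := @Ordinal 4 2 isT.
Definition o3 : 'I_4 := @Ordinal 4 3 isT.

Lemma sum_ord4 (V : nmodType) (F : 'I_4 -> V) :
  \sum_i F i = F o0 + F o1 + F o2 + F o3.
Proof.
rewrite !big_ord_recr big_ord0 /= add0r.
by congr (F _ + F _ + F _ + F _); apply: val_inj.
Qed.

Lemma ord4_case (i : 'I_4) (P : 'I_4 -> Prop) : P o0 -> P o1 -> P o2 -> P o3 -> P i.
Proof.
move=> p0 p1 p2 p3.
case: i => [[|[|[|[|//]]]] h].
- by rewrite (_ : Ordinal h = o0)//; exact: val_inj.
- by rewrite (_ : Ordinal h = o1)//; exact: val_inj.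
- by rewrite (_ : Ordinal h = o2)//; exact: val_inj.
- by rewrite (_ : Ordinal h = o3)//; exact: val_inj.
Qed.

Lemma minkE Y Z : mink Y Z = - (Y o0 0 * Z o0 0) + Y o1 0 * Z o1 0 + Y o2 0 * Z o2 0 + Y o3 0 * Z o3 0.
Proof.
rewrite /mink /minkowski_mx mul_mx_diag mxE sum_ord4 !mxE /=.
by rewrite !mulr1 mulrN1 mulNr.
Qed.

Lemma pvecE : [/\ @pvec R o0 0 = 1, @pvec R o1 0 = 0, @pvec R o2 0 = 0 & @pvec R o3 0 = 1].
Proof. by split; rewrite mxE. Qed.

Lemma mink_pvec Y : mink Y pvec = Y o3 0 - Y o0 0.
Proof. by rewrite minkE; have [-> -> -> ->] := pvecE; rewrite !mulr1 !mulr0 !addr0 addrC. Qed.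

Lemma I3E Y : I3 Y <-> Y o3 0 = Y o0 0.
Proof.
rewrite /I3 /= mink_pvec; split; first by move/eqP; rewrite subr_eq0 => /eqP.
by move=> ->; rewrite subrr.
Qed.

Lemma mink_I3 Y Z : I3 Y -> mink Y Z = Y o0 0 * (Z o3 0 - Z o0 0) + Y o1 0 * Z o1 0 + Y o2 0 * Z o2 0.
Proof. by rewrite I3E minkE => ->; ring. Qed.

Lemma mink_I3I3 Y Z y1 y2 z1 z2 : I3 Y -> I3 Z -> Y o1 0 = y1 -> Y o2 0 = y2 ->
  Z o1 0 = z1 -> Z o2 0 = z2 -> mink Y Z = y1 * z1 + y2 * z2.
Proof.
by move=> YI /I3E ZI <- <- <- <-; rewrite mink_I3// ZI subrr mulr0 add0r.
Qed.

Lemma mink_I3_eq Y Z y0 y1 y2 : I3 Y -> Y o0 0 = y0 -> Y o1 0 = y1 -> Y o2 0 = y2 ->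
  mink Y Z = y0 * (Z o3 0 - Z o0 0) + y1 * Z o1 0 + y2 * Z o2 0.
Proof. by move=> YI <- <- <-; rewrite mink_I3. Qed.

Lemma cV4_eq Y Z : Y o0 0 = Z o0 0 -> Y o1 0 = Z o1 0 -> Y o2 0 = Z o2 0 -> Y o3 0 = Z o3 0 -> Y = Z.
Proof.
move=> h0 h1 h2 h3; apply/matrixP => i j; rewrite (ord1 j).
exact: (@ord4_case i (fun i => Y i 0 = Z i 0)).
Qed.

Definition vec4 (a b c d : R) : 'cV[R]_4 :=
  \col_i (if i == o0 then a else if i == o1 then b else if i == o2 then c else d).

Lemma vec4E a b c d : [/\ vec4 a b c d o0 0 = a, vec4 a b c d o1 0 = b,
  vec4 a b c d o2 0 = c & vec4 a b c d o3 0 = d].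
Proof. by split; rewrite mxE. Qed.

End Mink.

Section SurfaceForms.
Variable R : realType.
Variables (U : set (R * R)) (X : R * R -> 'cV[R]_4) (eps : R) (f : R * R -> R[i]).
Hypotheses (oU : open U) (sX : smooth_on U X) (XI : forall z, U z -> I3 (X z)).
Hypothesis eps1 : eps * eps = 1.
Hypothesis Hf : Hol U f.
Implicit Types z v w : R * R.

Definition crd (i : 'I_4) z : R := X z i 0.

Lemma smooth_coord (V : normedModType R) (D : set V) (Y : V -> 'cV[R]_4) (i : 'I_4) : open D ->
  smooth_on D Y -> smooth_on D (fun z : V => Y z i 0).
Proof.
move=> oD sY.
pose P (g : V -> R) := exists2 Y : V -> 'cV[R]_4, smooth_on D Y & g = (fun z : V => Y z i 0).
apply: (smooth_coind oD (P := P)); last by exists Y.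
move=> _ {}[Y' sY' ->]; split.
  move=> x Dx; apply: (@differentiable_comp R _ _ _ Y' (fun M : 'cV[R]_4 => M i 0)).
    exact: (smooth_on_diff sY').
  exact: differentiable_coord.
move=> v; exists (fun z : V => 'D_v Y' z i 0).
  by exists ('D_v Y') => //; exact: smooth_onD.
move=> x /[!inE] Dx; rewrite derive_mx ?mxE//.
exact/diff_derivable/(smooth_on_diff sY').
Qed.

Lemma derive_coord (V : normedModType R) (D : set V) (Y : V -> 'cV[R]_4) (i : 'I_4) (v x : V) :
  smooth_on D Y -> D x -> ('D_v Y x) i 0 = 'D_v (fun z : V => Y z i 0) x.
Proof.
move=> sY Dx; rewrite derive_mx ?mxE//.
exact/diff_derivable/(smooth_on_diff sY).
Qed.

Lemma derive2_coord (i : 'I_4) v w z : U z ->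
  ('D_w ('D_v X) z) i 0 = 'D_w ('D_v (crd i)) z.
Proof.
move=> Uz; rewrite (derive_coord _ _ (smooth_onD v sX) Uz).
apply: (derive_on _ oU); last exact: mem_set.
by move=> x /[!inE] Ux; exact: (derive_coord _ _ sX Ux).
Qed.

Lemma crd3 v z : U z -> 'D_v (crd o3) z = 'D_v (crd o0) z.
Proof.
move=> Uz; apply: (derive_on _ oU); last exact: mem_set.
by move=> x /[!inE] Ux; have /I3E := XI Ux.
Qed.

Lemma dX i v z : U z -> ('D_v X z) i 0 = 'D_v (crd i) z.
Proof. by move=> Uz; exact: (derive_coord i v sX Uz). Qed.

Lemma derive_I3 v z : U z -> I3 ('D_v X z).
Proof.
move=> Uz; apply: (I3E ('D_v X z)).2.
by rewrite (dX o3 v Uz) (dX o0 v Uz) crd3.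
Qed.

Lemma derive2_I3 v w z : U z -> I3 ('D_w ('D_v X) z).
Proof.
move=> Uz; apply: (I3E ('D_w ('D_v X) z)).2.
rewrite (derive2_coord o3 v w Uz) (derive2_coord o0 v w Uz).
apply: (derive_on _ oU); last exact: mem_set.
by move=> x /[!inE] Ux; exact: crd3.
Qed.

Hypothesis hx : forall z v, U z -> 'D_v (crd o1) z = Re (f z * cz v).
Hypothesis hy : forall z v, U z -> 'D_v (crd o2) z = eps * Im (f z * cz v).

(* [2 dl/dz] *)
Definition gradl z : R[i] := 'D_((1, 0) : R * R) (crd o0) z -i* 'D_((0, 1) : R * R) (crd o0) z.

Lemma gradlE z v : U z -> 'D_v (crd o0) z = Re (gradl z * cz v).
Proof.
move=> Uz; have := is_diff_plane (smooth_on_diff (smooth_coord o0 oU sX) Uz).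
move=> /is_diff_derive ->; rewrite ReM /=; ring.
Qed.

Lemma first_formE z v w : U z ->
  first_form X z v w = normsq (f z) * (v.1 * w.1 + v.2 * w.2).
Proof.
move=> Uz.
rewrite /first_form (mink_I3I3 (derive_I3 v Uz) (derive_I3 w Uz) (dX o1 v Uz)
  (dX o2 v Uz) (dX o1 w Uz) (dX o2 w Uz)) (hx v Uz) (hx w Uz) (hy v Uz) (hy w Uz).
have -> : eps * Im (f z * cz v) * (eps * Im (f z * cz w)) =
  (eps * eps) * (Im (f z * cz v) * Im (f z * cz w)) by ring.
rewrite eps1 mul1r !ReImE /normsq /=; ring.
Qed.

Let p z := gradl z / f z.
(** Tangency fixes the coordinates 1 and 2 through the complex gradient [p] of the height over the
    horizontal plane, the normalization gives n_3 = n_0 + 1, and lightlikeness then gives n_0. *)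
Definition gauss_formula z : 'cV[R]_4 :=
  vec4 (- (1 + normsq (p z)) / 2) (- Re (p z)) (eps * Im (p z)) ((1 - normsq (p z)) / 2).

Lemma gaussE z : [/\ gauss_formula z o0 0 = - (1 + normsq (p z)) / 2,
  gauss_formula z o1 0 = - Re (p z), gauss_formula z o2 0 = eps * Im (p z) &
  gauss_formula z o3 0 = (1 - normsq (p z)) / 2].
Proof. exact: vec4E. Qed.

Lemma mink_gauss z Y : I3 Y ->
  mink Y (gauss_formula z) = Y o0 0 - Re (p z) * Y o1 0 + eps * Im (p z) * Y o2 0.
Proof.
move=> YI; rewrite mink_I3//; have [-> -> -> ->] := gaussE z.
by field.
Qed.

Lemma gauss_mapE z : U z -> f z != 0 -> gauss_map X z = gauss_formula z.
Proof.
move=> Uz f0.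
have G : is_gauss_vector X z (gauss_formula z).
  split.
  - rewrite /lightcone /= minkE; have [-> -> -> ->] := gaussE z.
    have -> : eps * Im (p z) * (eps * Im (p z)) = (eps * eps) * (Im (p z) * Im (p z)) by ring.
    by rewrite eps1 /normsq; field.
  - move=> v; rewrite mink_gauss; last exact: derive_I3.
    rewrite (dX o0 v Uz) (dX o1 v Uz) (dX o2 v Uz) (hx v Uz) (hy v Uz) (gradlE v Uz).
    have -> : gradl z = p z * f z by rewrite /p mulfVK.
    have -> : eps * Im (p z) * (eps * Im (f z * cz v)) = (eps * eps) * (Im (p z) * Im (f z * cz v)) by ring.
    rewrite eps1 -mulrA [in X in X - _]ReM; ring.
  - rewrite mink_pvec; have [-> _ _ ->] := gaussE z.
    by field.
apply: xget_unique => // n [nl nt np].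
have n30 : n o3 0 = n o0 0 + 1 by move: np; rewrite mink_pvec => <-; rewrite addrC subrK.
have nv v : Re ((p z + (n o1 0 -i* (eps * n o2 0))) * (f z * cz v)) = 0.
  have := nt v; rewrite (mink_I3_eq _ (derive_I3 v Uz) (dX o0 v Uz) (dX o1 v Uz) (dX o2 v Uz)).
  rewrite (hx v Uz) (hy v Uz) (gradlE v Uz).
  have -> : gradl z = p z * f z by rewrite /p mulfVK.
  rewrite -mink_pvec np mulr1 -mulrA => E.
  rewrite -E; move: (f z * cz v) (p z) => A B.
  rewrite !ReImE /=; ring.
(* As [f z] is invertible, there are tangent vectors with [f z * cz v] equal to 1 and to i; they
   isolate the real and imaginary parts. *)
have pe : p z + (n o1 0 -i* (eps * n o2 0)) = 0.
  set a := _ + _ in nv *.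
  have e1 := nv (pt (f z)^-1); rewrite ptK mulfV// mulr1 in e1.
  have e2 := nv (pt ('i / f z)); rewrite ptK in e2.
  have fe : f z * ('i / f z) = 'i by rewrite mulrCA mulfV ?mulr1.
  rewrite fe ReM /= mulr0 sub0r mulr1 in e2.
  by apply: cplx_eq => //; apply/eqP; rewrite -oppr_eq0 e2.
have n1 : n o1 0 = - Re (p z).
  by have := congr1 (@complex.Re R) pe; rewrite ReD /= => /eqP; rewrite addr_eq0 => /eqP ->; rewrite opprK.
have n2 : n o2 0 = eps * Im (p z).
  have := congr1 (@complex.Im R) pe; rewrite ImD /= => /eqP; rewrite subr_eq0 => /eqP ->.
  by rewrite mulrA eps1 mul1r.
have n0 : n o0 0 = - (1 + normsq (p z)) / 2.
  move: nl; rewrite /lightcone /= minkE n30 n1 n2.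
  have -> : eps * Im (p z) * (eps * Im (p z)) = (eps * eps) * (Im (p z) * Im (p z)) by ring.
  rewrite eps1 mul1r /normsq => E.
  have E2 : 2 * n o0 0 = - (1 + (Re (p z) ^+ 2 + Im (p z) ^+ 2)).
    by apply/eqP; rewrite -subr_eq0; apply/eqP; rewrite -E; ring.
  by rewrite -E2; field.
have [g0 g1 g2 g3] := gaussE z.
by apply: cV4_eq; rewrite ?n30 ?n0 ?n1 ?n2 ?g0 ?g1 ?g2 ?g3//; field.
Qed.

Lemma derive_cxM (F : R * R -> R[i]) v w z : Hol U F -> U z ->
  'D_w (fun z => Re (F z * cz v)) z = Re (cD F z * cz w * cz v) /\
  'D_w (fun z => Im (F z * cz v)) z = Im (cD F z * cz w * cz v).
Proof.
move=> HF Uz.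
have h := cdiffM (Hol_hol HF Uz) (cdiff_cst z (cz v)).
have := cdiff_derive_Re w h; have := cdiff_derive_Im w h.
rewrite /comp /cst mulr0 addr0 => -> ->; split; reflexivity.
Qed.

(** The second derivatives of the height are left as they stand, because [zmc_data] deduces the
    harmonicity of the height from this formula. *)
Lemma mink_second z v w : U z -> f z != 0 ->
  mink ('D_w ('D_v X) z) (gauss_map X z) =
  'D_w ('D_v (crd o0)) z - Re (p z * (cD f z * cz w * cz v)).
Proof.
move=> Uz f0; rewrite gauss_mapE// mink_gauss; last exact: derive2_I3.
rewrite (derive2_coord o0 v w Uz) (derive2_coord o1 v w Uz) (derive2_coord o2 v w Uz).
have -> : 'D_w ('D_v (crd o1)) z = Re (cD f z * cz w * cz v).
  rewrite -(derive_cxM v w Hf Uz).1; apply: (derive_on _ oU); last exact: mem_set.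
  by move=> x /[!inE] Ux; exact: hx.
have -> : 'D_w ('D_v (crd o2)) z = eps * Im (cD f z * cz w * cz v).
  rewrite -(derive_cxM v w Hf Uz).2.
  have h := cdiffM (Hol_hol Hf Uz) (cdiff_cst z (cz v)).
  have [_ h2] := h.
  rewrite -[RHS]/(eps *: _) -deriveZ; last by apply: diff_derivable; case: h2.
  apply: (derive_on _ oU); last exact: mem_set.
  by move=> x /[!inE] Ux; exact: hy.
have -> a : eps * Im (p z) * (eps * a) = (eps * eps) * (Im (p z) * a) by ring.
rewrite eps1; move: (cD f z * cz w * cz v) (p z) => A B.
by rewrite [Re (B * A)]ReM; ring.
Qed.

Section HolP.
Variable P : R * R -> R[i].
Hypothesis HP : Hol U P.
Hypothesis hl : forall z v, U z -> 'D_v (crd o0) z = Re (P z * cz v).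

(* The second fundamental form is [Re (hopfQ dz^2)]. *)
Definition hopfQ z : R[i] := cD P z - P z * cD f z / f z.

Lemma gradl_P z : U z -> gradl z = P z.
Proof.
move=> Uz; rewrite /gradl !hl// !ReM /=.
by apply: cplx_eq => /=; rewrite ?mulr0 ?mulr1 ?subr0 ?sub0r ?opprK.
Qed.

Lemma mink_secondQ z v w : U z -> f z != 0 ->
  mink ('D_w ('D_v X) z) (gauss_map X z) = Re (hopfQ z * cz w * cz v).
Proof.
move=> Uz f0; rewrite mink_second//.
have -> : 'D_w ('D_v (crd o0)) z = Re (cD P z * cz w * cz v).
  rewrite -(derive_cxM v w HP Uz).1; apply: (derive_on _ oU); last exact: mem_set.
  by move=> x /[!inE] Ux; exact: hl.
rewrite /p gradl_P// /hopfQ -ReN -ReD; congr (Re _); ring.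
Qed.

Lemma LMN_coefE z : U z -> f z != 0 -> [/\ L_coef X z = Re (hopfQ z),
  M_coef X z = - Im (hopfQ z) & N_coef X z = - Re (hopfQ z)].
Proof.
move=> Uz f0; split.
- rewrite /L_coef /X_u (mink_secondQ (1, 0) (1, 0) Uz f0).
  by move: (hopfQ z) => Q; rewrite cz10 !mulr1.
- rewrite /M_coef /X_u /X_v (mink_secondQ (1, 0) (0, 1) Uz f0).
  by move: (hopfQ z) => Q; rewrite cz10 cz01 !ReM /=; ring.
- rewrite /N_coef /X_v (mink_secondQ (0, 1) (0, 1) Uz f0).
  by move: (hopfQ z) => Q; rewrite cz01 !ReImE /=; ring.
Qed.

Lemma second_formE z v w : U z -> f z != 0 ->
  second_form X z v w = Re (hopfQ z * cz v * cz w).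
Proof.
move=> Uz f0; rewrite /second_form; have [-> -> ->] := LMN_coefE Uz f0.
by move: (hopfQ z) => Q; rewrite !ReImE /=; ring.
Qed.

Lemma mean_curvature0 z : U z -> f z != 0 -> mean_curvature X z = 0.
Proof.
move=> Uz f0; rewrite /mean_curvature; have [-> _ ->] := LMN_coefE Uz f0.
by rewrite subrr mulr0.
Qed.

(** The eigenvalue equation says that Q v is a real multiple of the conjugate of v, in other words
    that Q v^2 is real. *)
Lemma principalE z v : U z -> f z != 0 ->
  principal_direction X z v <-> v != 0 /\ Im (hopfQ z * cz v ^+ 2) = 0.
Proof.
move=> Uz f0.
have nf : normsq (f z) != 0 by rewrite normsq_eq0.
split=> -[v0].
  move=> [k hk]; split=> //.
  have h1 := hk (1, 0); have h2 := hk (0, 1).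
  rewrite second_formE// first_formE// cz10 in h1.
  rewrite second_formE// first_formE// cz01 in h2.
  have e : hopfQ z * cz v = (k * normsq (f z))%:C * (v.1 -i* v.2).
    move: h1 h2; move: (hopfQ z * cz v) (normsq (f z)) => B n.
    rewrite mulr1 ReM /= => h1 h2; apply: cplx_eq; rewrite !ReImE /=.
      by rewrite h1; ring.
    have -> : Im B = - (Re B * 0 - Im B * 1) by ring.
    by rewrite h2; ring.
  by rewrite expr2 mulrA e !ReImE /=; ring.
move=> h; split => //.
have nv : normsq (cz v) != 0.
  rewrite normsq_eq0; apply: contraNneq v0 => e; apply/eqP.
  by apply: (can_inj (@czK R)); rewrite e.
exists (Re (hopfQ z * cz v ^+ 2) / (normsq (f z) * normsq (cz v))) => w.
rewrite second_formE// first_formE//.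
have E : hopfQ z * cz v = (Re (hopfQ z * cz v ^+ 2))%:C * (v.1 -i* v.2) / (normsq (cz v))%:C.
  have nv' : (normsq (cz v))%:C != 0 by rewrite eq_complex /= (negbTE nv).
  apply: (mulIf nv'); rewrite mulfVK//.
  have -> : (normsq (cz v))%:C = cz v * (v.1 -i* v.2).
    by apply: cplx_eq; rewrite !ReImE /= /normsq; ring.
  rewrite mulrA; congr (_ * _); apply: cplx_eq; first by rewrite -mulrA -expr2.
  by rewrite -mulrA -expr2 h.
rewrite E; move: (Re (hopfQ z * _)) => q.
have -> : (normsq (cz v))%:C^-1 = ((normsq (cz v))^-1)%:C by rewrite -fmorphV.
rewrite !ReImE /= !(mul0r, mulr0, addr0, subr0, add0r, sub0r).
by field; rewrite nf nv.
Qed.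

End HolP.
End SurfaceForms.

(** * Real-valued holomorphic functions and square roots *)

Section HolTools.
Variable R : realType.
Implicit Types (U : set (R * R)) (F G h Q : R * R -> R[i]) (z : R * R).

(** The differential v |-> Im (G v) of the imaginary part vanishes; taking v = 1 and v = i kills
    both parts of [G]. *)
Lemma real_hol_const U F G : open U -> hol U F G -> (forall z, U z -> Im (F z) = 0) ->
  forall z, U z -> G z = 0.
Proof.
move=> oU hF F0 z Uz; have [_ h2] := hF z Uz.
have h0 : is_diff z (@complex.Im R \o F) (fun=> 0).
  apply: (is_diff_near (is_diff_cst (0 : R) z)).
  by apply: filterS (nearU oU Uz) => w /F0.
have e v : Im (G z * cz v) = 0 := etrans (esym (is_diff_derive v h2)) (is_diff_derive v h0).
have := e (1, 0); have := e (0, 1); rewrite cz10 cz01 mulr1 ImM /= mulr1 mulr0 addr0.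
by move=> e1 e2; apply: cplx_eq.
Qed.

(** [A] is a logarithm of [Q] up to a constant, because exp (A - A z0) / Q has derivative 0. The
    constancy of functions with zero derivative is taken as a hypothesis so that the lemma serves
    both balls and connected open sets. *)
Lemma hol_sqrt U Q A : open U ->
  (forall F, hol U F (cst 0) -> forall x y, U x -> U y -> F x = F y) ->
  Hol U Q -> (forall z, U z -> Q z != 0) -> hol U A (fun z => cD Q z / Q z) ->
  exists2 h, Hol U h & forall z, U z -> h z * h z = Q z.
Proof.
move=> oU cU HQ Q0 hA.
have [[z0 Uz0]|U0] := pselect (exists z, U z); last first.
  by exists (cst 0); [exact: Hol_cst|move=> z Uz; case: U0; exists z].
have HA : Hol U A.
  apply: (Hol_prim oU hA); apply: (HolM oU (Hol_cD HQ) (HolV oU HQ Q0)).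
pose s0 := sqrtC (Q z0).
pose h z := cexp ((A z + - A z0) * (2^-1)) * s0.
have Hh : Hol U h.
  exact: (HolM oU (Hol_exp oU (HolM oU (HolD oU HA (Hol_cst oU _)) (Hol_cst oU _))) (Hol_cst oU _)).
exists h => // z Uz.
have e : h z * h z = cexp (A z + - A z0) * Q z0.
  rewrite /h mulrACA -cexpD -(sqrtCK (Q z0)) expr2; congr (cexp _ * _); by field.
have hE := holM (hol_exp (holD hA (hol_cst (- A z0)))) (hol_inv (Hol_hol HQ) Q0).
have hE0 : hol U (fun z => cexp (A z + - A z0) * (Q z)^-1) (cst 0).
  apply: hol_eqr hE => w /[!inE] Uw; rewrite /cst addr0.
  by field; exact: Q0.
have := cU _ hE0 z z0 Uz Uz0; rewrite subrr cexp0 mul1r => E.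
rewrite e -[X in X * _](mulfVK (Q0 z Uz)) E mulrAC mulVf ?mul1r//; exact: Q0.
Qed.

Lemma hol_sqrt_derive U h Q z : hol U h (cD h) -> hol U Q (cD Q) -> open U ->
  (forall z, U z -> h z * h z = Q z) -> U z -> cD Q z = cD h z * h z + h z * cD h z.
Proof.
move=> hh hQ oU hE Uz.
have H := holM hh hh; rewrite -(hol_cD H Uz).
apply/esym; apply: (@hol_cD _ U) => //.
by apply: (hol_eq oU _ _ hQ) => // w /[!inE] Uw; rewrite -hE.
Qed.

End HolTools.

(** * Planar curvature lines *)

Section Planarity.
Variable R : realType.
Variables (S : set (R * R)) (f P W : R * R -> R[i]) (l : R * R -> R).
Hypotheses (oS : open S) (Hf : Hol S f) (HP : Hol S P).
Hypothesis f0 : forall z, S z -> f z != 0.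
Hypothesis hW : hol S W f.
Hypothesis hl : forall z, S z -> is_diff z l (fun v => Re (P z * cz v)).
Let Q := hopfQ f P.

Lemma HolQ : Hol S Q.
Proof.
exact: (HolB oS (Hol_cD HP) (HolM oS (HolM oS HP (Hol_cD Hf)) (HolV oS Hf f0))).
Qed.

(* The curvature lines are the curves with [Im (Q c'^2) = 0], and the planes of
   the isotropic space the sets [al * l + Re (be * w) = d]. *)
Definition planar_lines := forall (a b : R) (c : R -> R * R), a < b ->
  smooth_on `]a, b[%classic c ->
  (forall t, a < t < b -> [/\ S (c t), derive1 c t != 0 & Im (Q (c t) * cz (derive1 c t) ^+ 2) = 0]) ->
  exists (al : R) (be : R[i]) (d : R), ((al != 0) || (be != 0)) /\
    forall t, a < t < b -> al * l (c t) + Re (be * W (c t)) = d.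

Let Om := S `&` [set z | Q z != 0].
(* With [rho = f / sqrt Q] and derivatives with respect to [zeta = int sqrt Q],
   [sg = rho'] and [KK = (2 rho rho'' - rho'^2) / rho^2]; these expressions do not
   involve the choice of the square root. *)
Definition sg z := cD f z / Q z - f z * cD Q z / (2 * Q z ^+ 2).
Definition KK z := (2 * f z * cD sg z - Q z * sg z ^+ 2) / f z ^+ 2.

Lemma oOm : open Om. Proof. exact: (open_neq0 oS HolQ). Qed.

Lemma OmS : Om `<=` S. Proof. by move=> z []. Qed.

Lemma Hol_sg : Hol Om sg.
Proof.
have oO := oOm.
have Hf' := Hol_sub OmS Hf; have HQ' := Hol_sub OmS HolQ.
have Q0 z : Om z -> Q z != 0 by case.
have Q20 z : Om z -> 2 * (Q z * Q z) != 0.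
  by move=> /Q0 q; rewrite !mulf_neq0// pnatr_eq0.
exact: (HolB oO (HolM oO (Hol_cD Hf') (HolV oO HQ' Q0)) (HolM oO (HolM oO Hf' (Hol_cD HQ'))
  (HolV oO (HolM oO (Hol_cst oO 2) (HolM oO HQ' HQ')) Q20))).
Qed.

Lemma Hol_KK : Hol Om KK.
Proof.
have oO := oOm.
have Hf' := Hol_sub OmS Hf; have HQ' := Hol_sub OmS HolQ.
have ff0 z : Om z -> f z * f z != 0.
  by move=> /OmS /f0 q; rewrite !mulf_neq0// pnatr_eq0.
exact: (HolM oO (HolB oO (HolM oO (HolM oO (Hol_cst oO 2) Hf') (Hol_cD Hol_sg))
  (HolM oO HQ' (HolM oO Hol_sg Hol_sg))) (HolV oO (HolM oO Hf' Hf') ff0)).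
Qed.

(* The three equations are the successive derivatives of the equation of a plane
   along a curvature line, with [g = rho' / rho] and [d2 = rho'' / rho]. *)
Lemma planar_algebra (al : R) (m rho g d2 : R[i]) :
  rho != 0 -> Re (m * rho) = 0 -> al + Re (m * (g * rho)) = 0 ->
  al * Re g + Re (m * (d2 * rho)) = 0 -> (al != 0) || (m != 0) ->
  Im (2 * d2 - g ^+ 2) = 0.
Proof.
move=> rho0 h1 h2 h3 am.
have mE : m = (Im (m * rho))%:C * 'i / rho.
  apply: (mulIf rho0); rewrite mulfVK//; apply: cplx_eq; rewrite ?h1 !ReImE /=; ring.
have t0 : Im (m * rho) != 0.
  apply: contraTneq am => t0.
  have m0 : m = 0 by rewrite mE t0 !mul0r.
  by move: h2; rewrite m0 mul0r addr0 => ->; rewrite !eqxx.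
have key a : Re (m * (a * rho)) = - (Im (m * rho) * Im a).
  have -> : m * (a * rho) = (m * rho) * a by ring.
  by rewrite ReM h1; ring.
rewrite !key in h2 h3.
have {}h2 : al = Im (m * rho) * Im g by apply/eqP; rewrite -subr_eq0 h2.
move: h3; rewrite h2 -mulrA -mulrBr => /eqP; rewrite mulf_eq0 (negbTE t0) /= => /eqP h3.
rewrite expr2 !ReImE /=.
have -> : Im d2 = Im g * Re g by apply/eqP; rewrite eq_sym -subr_eq0 h3.
ring.
Qed.

(** The curve tested is the line zeta (c t) = zeta z + t: there c' = 1 / sqrt Q, hence Q c'^2 = 1
    and [c] is a curvature line through [z]. The plane equation is differentiated along it at t =
    0. *)
Lemma planar_real z : planar_lines -> Om z -> Im (KK z) = 0.
Proof.
move=> pl Oz; have oO := oOm.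
have [r r0 rO] := open_ball_sub oO Oz.
set B := ball z r in rO; have oB : open B by exact: ball_open.
have Bz : B z by exact: ballxx.
have BS : B `<=` S by move=> w /rO [].
have Q0 w : B w -> Q w != 0 by move=> /rO [].
have HQ := Hol_sub BS HolQ; have HfB := Hol_sub BS Hf; have HPB := Hol_sub BS HP.
have Hsg := Hol_sub rO Hol_sg.
have [A hA] := ball_primitive r0 (HolM oB (Hol_cD HQ) (HolV oB HQ Q0)).
have [h Hh hE] := hol_sqrt oB (@ball_const R ^~ z ^~ r) HQ Q0 hA.
have h0 w : B w -> h w != 0.
  by move=> Bw; apply: contraTneq (Q0 w Bw) => e; rewrite -hE// e mul0r eqxx.
have [zeta hz] := ball_primitive r0 Hh.
have [e [c [e0 c0 hc]]] := flow oB Bz hz Hh (h0 z Bz).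
have sc : smooth_on `]- e, e[%classic c := flow_smooth oB Hh hc.
have oI : open (`]- e, e[%classic : set R) by exact: interval_open.
have te t : - e < t < e -> `|t| < e by rewrite ltr_norml.
have dc t : `|t| < e -> derive1 c t = pt ((h (c t))^-1).
  move=> /hc [_ _ /is_diff_derive]; rewrite derive1E => ->; by rewrite mul1r.
have [| |al [be [d [ab H]]]] := pl (- e) e c _ sc.
- by rewrite gtrN.
- move=> t /te te'; have [Bt ht dt] := hc t te'; split; first exact: BS.
    rewrite dc//; apply/eqP => E; have := congr1 (@cz R) E; rewrite ptK.
    by move/eqP; rewrite (_ : cz 0 = 0)// invr_eq0 (negbTE ht).
  rewrite dc// ptK -hE//.
  by have -> : h (c t) * h (c t) * (h (c t))^-1 ^+ 2 = 1 by field.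
have ddt F G t : hol B F G -> `|t| < e -> is_diff t (fun t => Re (F (c t)))
    (fun k : R => Re (G (c t) * (k%:C / h (c t)))).
  move=> hF te'; have [Bt ht dt] := hc t te'.
  have [h1 _] := cdiff_comp dt (hF _ Bt).
  by apply: (is_diff_eq h1); apply/funext => k /=; rewrite ptK.
have dd F G : hol B F G -> (forall t, `|t| < e -> Re (F (c t)) = 0) ->
    forall t, `|t| < e -> Re (G (c t) / h (c t)) = 0.
  move=> hF F0 t te'.
  have h1 := is_diff_derive (1 : R) (ddt _ _ t hF te').
  rewrite mul1r in h1; rewrite -h1.
  have E : \forall s \near t, Re (F (c s)) = (cst 0 : R -> R) s.
    have : `]- e, e[%classic t by rewrite /= in_itv /= -ltr_norml.
    move=> /(nearU oI); apply: filterS => s.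
    by rewrite /= in_itv /= -ltr_norml => /F0.
  by rewrite (near_eq_derive _ E) derive_cst.
(* [M1] is m rho with m = al P / f + be, and [M2] below is its derivative with respect to [zeta]; on
   the curve the real part of each vanishes. *)
pose M1 w := (al%:C * P w + be * f w) * (h w)^-1.
have R1 t : `|t| < e -> Re (M1 (c t)) = 0.
  move=> te'; have [Bt ht dt] := hc t te'.
  have d1 := is_diff_comp dt (hl (BS _ Bt)).
  have hW' : hol B (fun w => be * W w) (fun w => 0 * W w + be * f w).
    exact: (holM (hol_cst be) (hol_sub BS hW)).
  have d2 := ddt _ _ t hW' te'.
  have d3 := is_diffD (is_diffZ al d1) d2.
  have h1 := is_diff_derive (1 : R) d3.
  have E : \forall s \near t, al *: (l (c s)) + Re (be * W (c s)) = (cst d : R -> R) s.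
    have : `]- e, e[%classic t by rewrite /= in_itv /= -ltr_norml.
    move=> /(nearU oI); apply: filterS => s.
    by rewrite /= in_itv /= => /H.
  move: h1; rewrite (near_eq_derive _ E) derive_cst !fctE /= ptK mul1r mul0r add0r => ->.
  by rewrite /M1 mulrDl ReD /GRing.scale /= !ReImE /=; ring.
have Hhi := HolV oB Hh h0.
have HM1 : Hol B M1.
  exact: (HolM oB (HolD oB (HolM oB (Hol_cst oB _) HPB) (HolM oB (Hol_cst oB _) HfB)) Hhi).
pose M2 w := cD M1 w * (h w)^-1.
have R2 := dd _ _ (Hol_hol HM1) R1.
have HM2 : Hol B M2 by exact: (HolM oB (Hol_cD HM1) Hhi).
have R3 := dd _ _ (Hol_hol HM2) R2.
have dh w : B w -> cD Q w = cD h w * h w + h w * cD h w.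
  by move=> Bw; apply: (hol_sqrt_derive (Hol_hol Hh) (Hol_hol HQ) oB hE Bw).
have Qf w : B w -> cD P w = Q w + P w * cD f w / f w.
  by move=> Bw; rewrite /Q /hopfQ subrK.
have fB0 w : B w -> f w != 0 by move=> /BS /f0.
have M2E w : B w -> M2 w = al%:C + (al%:C * P w / f w + be) * sg w.
  move=> Bw; rewrite /M2.
  have hM := holM (holD (holM (hol_cst al%:C) (Hol_hol HPB)) (holM (hol_cst be) (Hol_hol HfB))) (hol_inv (Hol_hol Hh) h0).
  rewrite (hol_cD hM Bw) /cst /sg dh// Qf// -!hE//.
  by field; rewrite h0// fB0.
have hM2' : hol B M2 (fun w => (al%:C * Q w / f w ^+ 1) * sg w + (al%:C * P w / f w + be) * cD sg w).
  have hM := holD (hol_cst al%:C) (holM (holD (holM (holM (hol_cst al%:C) (Hol_hol HPB)) (hol_inv (Hol_hol HfB) fB0)) (hol_cst be)) (Hol_hol Hsg)).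
  apply: (hol_eq oB _ _ hM) => w /[!inE] Bw; first by rewrite M2E.
  rewrite /cst Qf// expr1.
  by field; rewrite fB0.
have t0 : `|0 : R| < e by rewrite normr0.
have := R1 0 t0; have := R2 0 t0; have := R3 0 t0.
rewrite c0 (hol_cD hM2' Bz) -/(M2 z) M2E// expr1.
set m := al%:C * P z / f z + be => E3 E2 E1.
have h0z := h0 z Bz; have f0z := fB0 z Bz.
have KE : KK z = 2 * (cD sg z / f z) - (sg z * h z / f z) ^+ 2.
  by rewrite /KK -hE//; field.
rewrite KE; apply: (@planar_algebra al m (f z / h z)).
- by rewrite mulf_neq0// invr_eq0.
- by rewrite -E1 /M1 /m; congr (Re _); field; rewrite h0z f0z.
- have -> : m * (sg z * h z / f z * (f z / h z)) = m * sg z by field; rewrite h0z f0z.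
  by rewrite -E2 ReD.
- have -> : m * (cD sg z / f z * (f z / h z)) = m * cD sg z / h z by field; rewrite h0z f0z.
  move: E3; rewrite mulrDl ReD => <-; congr (_ + _).
  rewrite -hE//.
  have -> : al%:C * (h z * h z) / f z * sg z / h z = al%:C * (sg z * h z / f z).
    by field; rewrite h0z f0z.
  by move: (sg z * h z / f z) => G'; rewrite ReM /=; ring.
- move: ab; case: eqP => //= al0 be0; rewrite /m al0 /=.
  by rewrite (_ : 0%:C = 0)// !mul0r add0r.
Qed.

Lemma KK_const z : planar_lines -> Om z -> cD KK z = 0.
Proof.
move=> pl Oz; apply: (real_hol_const oOm (Hol_hol Hol_KK)) => // w.
exact: planar_real.
Qed.

End Planarity.

(** * A Gronwall argument on a segment *)

Section Dichotomy.
Variable R : realType.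

Lemma normsq_add (a b : R[i]) : normsq (a + b) <= 2 * normsq a + 2 * normsq b.
Proof.
rewrite -subr_ge0.
have -> : 2 * normsq a + 2 * normsq b - normsq (a + b) = normsq (a - b).
  by rewrite /normsq !ReImE; ring.
exact: normsq_ge0.
Qed.

Lemma normsqN (a : R[i]) : normsq (- a) = normsq a.
Proof. by rewrite /normsq !ReImE !sqrrN. Qed.

(** If [T] were the first zero, N e^(M s) would be at least N 0 > 0 on [0, T) and vanish at [T]. The
    bound [M] may depend on [T] and is requested only before the first zero, since the first
    integral that provides it is defined only where [Q] is nonzero. *)
Lemma no_zero_1d (N N' : R -> R) :
  (forall s : R, 0 <= s <= 1 -> is_derive s 1 N (N' s)) ->
  (forall s : R, 0 <= N s) -> 0 < N 0 ->
  (forall T : R, 0 < T <= 1 -> (forall s : R, 0 <= s < T -> N s != 0) ->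
     exists M : R, forall s : R, 0 <= s < T -> - (M * N s) <= N' s) ->
  0 < N 1.
Proof.
move=> dN Nge N0 H.
have cN s : 0 <= s <= 1 -> {for s, continuous N}.
  by move=> /dN [/derivable1_diffP + _]; exact: differentiable_continuous.
rewrite lt0r Nge andbT; apply/negP => /eqP N10.
pose Z : set R := [set s | 0 <= s <= 1 /\ N s = 0].
have Z1 : Z 1 by split => //; rewrite ler01 lexx.
have lbZ : lbound Z 0 by move=> s [/andP[]].
have hZ : has_inf Z by split; [exists 1|exists 0].
pose T := inf Z.
have T0 : 0 <= T by apply: lb_le_inf => //; exists 1.
have T1 : T <= 1 by apply: ge_inf => //; exists 0.
have T01 : 0 <= T <= 1 by rewrite T0 T1.
have below s : 0 <= s < T -> N s != 0.
  move=> /andP[s0 sT]; apply/eqP => Ns.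
  have : T <= s.
    apply: ge_inf; first by exists 0.
    by split => //; rewrite s0 (le_trans (ltW sT)).
  by rewrite leNgt sT.
have NT : N T = 0.
  apply/eqP/negPn/negP => NTn.
  have NTp : 0 < N T by rewrite lt0r NTn Nge.
  have /nbhs_ballP[d /= d0 hd] := cN _ T01 _ (lt_nbhsr NTp).
  have [z Zz zT] := inf_adherent d0 hZ.
  have Tz : T <= z by apply: ge_inf => //; exists 0.
  have : 0 < N z.
    apply: hd; rewrite /ball /= distrC ger0_norm ?subr_ge0// ltrBlDl.
    exact: zT.
  by case: Zz => _ ->; rewrite ltxx.
have Tpos : 0 < T.
  rewrite lt_neqAle T0 andbT; apply/eqP => e.
  by move: N0; rewrite [X in N X]e NT ltxx.
have [|M hM] := H T _ below; first by rewrite Tpos.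
pose phi s := N s * expR (M * s).
pose phi' s := N' s * expR (M * s) + N s * (expR (M * s) * M).
have dphi (s : R) : 0 <= s <= 1 -> is_derive s 1 phi (phi' s).
  move=> s01.
  have h1 : is_derive s 1 (fun s : R => M * s) M.
    by apply: (is_derive_eq (is_deriveZ M (is_derive_id s 1))); rewrite /GRing.scale /= mulr1.
  have h2 := is_derive1_comp (is_derive_expR (M * s)) h1.
  apply: (is_derive_eq (is_deriveM (dN s s01) h2)).
  by rewrite /phi' /GRing.scale /=; ring.
have mono (s : R) : 0 <= s < T -> N 0 <= phi s.
  move=> /andP[s0 sT].
  have [||| xi xi01] := @MVT_segment R phi phi' 0 s.
  - exact: s0.
  - move=> u; rewrite in_itv /= => /andP[u0 us]; apply: dphi.
    by rewrite (ltW u0) /= (le_trans (ltW us))// (le_trans (ltW sT)).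
  - apply: derivable_within_continuous => u; rewrite in_itv /= => /andP[u0 us].
    by have [] := dphi u _; rewrite // u0 /= (le_trans us)// (le_trans (ltW sT)).
  move: xi01; rewrite in_itv /= => /andP[xi0 xis] E.
  have p0 : phi 0 = N 0 by rewrite /phi mulr0 expR0 mulr1.
  rewrite -p0 -subr_ge0 E mulr_ge0 ?subr_ge0//.
  have := hM xi; rewrite xi0 (le_lt_trans xis sT) => /(_ isT) h.
  have -> : phi' xi = (N' xi + M * N xi) * expR (M * xi) by rewrite /phi'; ring.
  by rewrite mulr_ge0 ?expR_ge0// -lerBlDr sub0r.
have phiT : phi T = 0 by rewrite /phi NT mul0r.
have [/derivable1_diffP dT _] := dphi T T01.
have cT : {for T, continuous phi} := differentiable_continuous dT.
have lt : phi T < N 0 by rewrite phiT.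
have /nbhs_ballP[d /= d0 hd] := cT _ (lt_nbhsl lt).
pose s := Num.max 0 (T - d / 2).
have sT : 0 <= s < T by rewrite le_max lexx /= gt_max Tpos /= gtrBl divr_gt0.
have := mono s sT; rewrite leNgt => /negP; apply; apply: hd.
move/andP: sT => [s0 sT]; rewrite /ball /= ger0_norm ?subr_ge0 ?(ltW sT)//.
have : T - d / 2 <= s by rewrite le_max lexx orbT.
lra.
Qed.

End Dichotomy.

(** * Umbilic points *)

Section Umbilics.
Variable R : realType.
Variables (S : set (R * R)) (f P W : R * R -> R[i]) (l : R * R -> R).
Hypotheses (oS : open S) (cS : connected S) (Hf : Hol S f) (HP : Hol S P).
Hypothesis f0 : forall z, S z -> f z != 0.
Hypothesis hW : hol S W f.
Hypothesis hl : forall z, S z -> is_diff z l (fun v => Re (P z * cz v)).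
Hypothesis pl : planar_lines S f P W l.
Local Notation Q := (hopfQ f P).
Local Notation Om := (S `&` [set z | Q z != 0]).
Local Notation sg := (sg f P).
Local Notation KK := (KK f P).

(** Together with [Q_derive], this reads the definitions of [KK] and [sg] as a first-order system
    for [sg] and [Q]. *)
Lemma sg_derive z : Om z -> cD sg z = (KK z * f z ^+ 2 + Q z * sg z ^+ 2) / (2 * f z).
Proof.
move=> [Sz Qz]; have fz := f0 Sz; rewrite /KK.
by move: (cD sg z) (sg z) (Q z) (f z) fz => a b c d d0; field.
Qed.

Lemma Q_derive z : Om z -> cD Q z = 2 * cD f z * Q z / f z - 2 * Q z ^+ 2 * sg z / f z.
Proof.
move=> [Sz Qz]; have fz := f0 Sz; have Qz' : Q z != 0 by [].
rewrite /sg; move: (cD f z) (cD Q z) (Q z) (f z) fz Qz' => a b c d d0 c0.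
by field; rewrite d0 c0.
Qed.

(* As [KK] is constant, [EE] is a first integral; it bounds [Q sg^2] near a zero
   of [Q]. *)
Definition EE z := (Q z * sg z ^+ 2 - KK z * f z ^+ 2) ^+ 2 / (f z ^+ 2 * Q z).

Lemma hol_EE : hol Om EE (cst 0).
Proof.
have oO := oOm oS Hf HP f0.
have OS : Om `<=` S by move=> z [].
have HQ := Hol_sub OS (HolQ oS Hf HP f0).
have hQ := Hol_hol HQ; have hf := Hol_hol (Hol_sub OS Hf).
have hs := Hol_hol (Hol_sg oS Hf HP f0); have hK := Hol_hol (Hol_KK oS Hf HP f0).
have hB := holB (holM hQ (holM hs hs)) (holM hK (holM hf hf)).
have n0 z : Om z -> f z * f z * Q z != 0.
  by move=> [Sz Qz]; rewrite !mulf_neq0// f0.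
have hE := holM (holM hB hB) (hol_inv (holM (holM hf hf) hQ) n0).
apply: (hol_eq oO _ _ hE) => z /[!inE] Oz.
  by rewrite /EE !expr2.
have [Sz Qz] := Oz; have fz := f0 Sz; have Qz' : Q z != 0 by [].
rewrite /cst (KK_const oS Hf HP f0 hW hl pl Oz) (sg_derive Oz) (Q_derive Oz).
move: (cD f z) (KK z) (sg z) (Q z) (f z) fz Qz' => a k s q g g0 q0.
by field; rewrite g0 q0.
Qed.

Lemma seg_bounded F z d : Hol S F -> (forall s : R, 0 <= s <= 1 -> S (z + s *: d)) ->
  exists2 C : R, 0 <= C & forall s : R, 0 <= s <= 1 -> normsq (F (z + s *: d)) <= C.
Proof.
move=> HF hS.
have c1 (s : R) : (`[0, 1]%classic : set R) s -> cdf s (fun s : R => F (z + s *: d)).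
  rewrite /= in_itv /= => s01; eexists; apply: cdiff_line; exact: (Hol_hol HF (hS s s01)).
have c2 (s : R) : (`[0, 1]%classic : set R) s -> cdf s (fun s : R => - 'i * F (z + s *: d)).
  by move=> /c1 h; apply: cdfM => //; exact: cdf_cst.
have cI := @segment_compact R 0 1.
have [M1 M10 h1] := compact_bounded cI (within_cdf c1).
have [M2 M20 h2] := compact_bounded cI (within_cdf c2).
exists (M1 ^+ 2 + M2 ^+ 2); first by rewrite addr_ge0 ?sqr_ge0.
move=> s s01; have sI : (`[0, 1]%classic : set R) s by rewrite /= in_itv.
rewrite /normsq; apply: lerD.
  by rewrite -[leLHS]real_normK ?num_real// ler_sqr ?nnegrE//; exact: h1.
rewrite -[leLHS]real_normK ?num_real// ler_sqr ?nnegrE//.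
by have := h2 s sI; rewrite ReM /= oppr0 mul0r sub0r mulN1r opprK.
Qed.

(* Along a segment the bound [|Q'| = O(|Q|)], which follows from that on
   [Q sg^2], prevents [Q] from reaching [0]. *)
Lemma umbilic_segment z1 z2 : (forall s : R, 0 <= s <= 1 -> S (z1 + s *: (z2 - z1))) ->
  Q z1 != 0 -> Q z2 != 0.
Proof.
move=> hS Q1; set d := z2 - z1 in hS *.
have HQ := HolQ oS Hf HP f0.
have [Cf Cf0 hCf] := seg_bounded Hf hS.
have [Cf' Cf'0 hCf'] := seg_bounded (Hol_cD Hf) hS.
have [CQ CQ0 hCQ] := seg_bounded HQ hS.
have [Ci Ci0 hCi] := seg_bounded (HolV oS Hf f0) hS.
pose ga s := z1 + s *: d.
pose N s := normsq (Q (ga s)).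
pose N' s := 2 * (Re (Q (ga s)) * Re (cD Q (ga s) * cz d) + Im (Q (ga s)) * Im (cD Q (ga s) * cz d)).
have -> : z2 = ga 1 by rewrite /ga scale1r addrCA subrr addr0.
rewrite -normsq_gt0; apply: (@no_zero_1d R N N').
- move=> s s01; have h := is_derive_of_diff (is_diff_normsq (cdiff_line (Hol_hol HQ (hS s s01)))).
  by apply: (is_derive_eq h); rewrite /N' /ga scale1r; ring.
- by move=> s; exact: normsq_ge0.
- by rewrite /N /ga scale0r addr0 normsq_gt0.
move=> T /andP[T0 T1] below.
have s01 s : 0 <= s < T -> 0 <= s <= 1.
  by move=> /andP[-> sT] /=; rewrite (le_trans (ltW sT)).
have Og s : 0 <= s < T -> Om (ga s).
  move=> sT; split; first exact/hS/s01.
  by rewrite /= -normsq_eq0; exact: below.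
have g0 : ga 0 = z1 by rewrite /ga scale0r addr0.
have cst_along F : hol Om F (cst 0) -> forall s, 0 <= s < T -> F (ga s) = F z1.
  move=> hF s sT; apply/esym; apply: (seg_const hF) => u /andP[u0 u1].
  have -> : z1 + u *: (ga s - z1) = ga (u * s) by rewrite /ga addrAC subrr add0r scalerA.
  move/andP: sT => [s0 sT]; apply: Og; rewrite mulr_ge0//=.
  by apply: le_lt_trans sT; rewrite ler_piMl.
have oO := oOm oS Hf HP f0.
have hK0 : hol Om KK (cst 0).
  apply: hol_eqr (Hol_hol (Hol_KK oS Hf HP f0)) => w /[!inE] Ow.
  exact: (KK_const oS Hf HP f0 hW hl pl).
(* With B = Q sg^2 - KK f^2, the first integral gives B^2 = EE f^2 Q: [c1] bounds (normsq B)^2, so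
   that normsq B <= c1 + 1. Then [c2] bounds normsq (Q sg^2), [c3] the ratio of normsq (Q^2 sg) to
   normsq Q, and [c4] that of normsq Q' to normsq Q. *)
pose c1 := normsq (EE z1) * Cf ^+ 2 * CQ.
pose c2 := 2 * (c1 + 1) + 2 * (normsq (KK z1) * Cf ^+ 2).
pose c3 := c2 * CQ + 1.
pose c4 := 8 * (Cf' + c3) * Ci.
exists (1 + c4 * normsq (cz d)) => s sT.
have O := Og s sT; have ss := s01 s sT.
have b1 := hCf s ss; have b2 := hCf' s ss; have b3 := hCQ s ss; have b4 := hCi s ss.
rewrite -/(ga s) in b1 b2 b3 b4.
have eE := cst_along EE hol_EE s sT; have eK := cst_along KK hK0 s sT.
have dQ := Q_derive O.
have [Sg Qg'] := O; have fg := f0 Sg; have Qg : Q (ga s) != 0 by [].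
have E2 : (Q (ga s) * sg (ga s) ^+ 2 - KK z1 * f (ga s) ^+ 2) ^+ 2 = EE z1 * (f (ga s) ^+ 2 * Q (ga s)).
  have nn : f (ga s) ^+ 2 * Q (ga s) != 0 by rewrite mulf_neq0// expf_neq0.
  by rewrite -eE -eK /EE (mulfVK nn).
rewrite /N' /N; move: E2 dQ b1 b2 b3 b4 Qg fg.
move: (Q (ga s)) (cD Q (ga s)) (f (ga s)) (cD f (ga s)) (sg (ga s)) => q dq g dg sig E2 dqE b1 b2 b3 b4 q0 g0'.
have nq0 := normsq_ge0 q.
have c10 : 0 <= c1 by rewrite !mulr_ge0 ?normsq_ge0 ?sqr_ge0.
have sq (a b : R) : 0 <= a -> 0 <= b -> a ^+ 2 <= b ^+ 2 -> a <= b.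
  by move=> a0 b0; rewrite ler_sqr ?nnegrE.
set B := q * sig ^+ 2 - KK z1 * g ^+ 2 in E2.
have g2 : normsq (g ^+ 2) <= Cf ^+ 2.
  by rewrite expr2 normsqM -expr2 ler_sqr ?nnegrE ?normsq_ge0.
have nB : normsq B <= c1 + 1.
  apply: sq; rewrite ?normsq_ge0//; first by rewrite addr_ge0.
  have -> : normsq B ^+ 2 = normsq (EE z1 * (g ^+ 2 * q)) by rewrite -E2 (expr2 B) normsqM expr2.
  apply: (@le_trans _ _ c1); last by have := mulr_ge0 c10 c10; rewrite expr2; nra.
  rewrite (normsqM (EE z1)) (normsqM (g ^+ 2) q) /c1 -mulrA ler_wpM2l ?normsq_ge0//.
  by rewrite ler_pM ?normsq_ge0.
have nqs : normsq (q * sig ^+ 2) <= c2.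
  have -> : q * sig ^+ 2 = B + KK z1 * g ^+ 2 by rewrite /B subrK.
  apply: le_trans (normsq_add _ _) _; rewrite /c2; apply: lerD; rewrite ler_wpM2l//.
  by rewrite (normsqM (KK z1)) ler_wpM2l ?normsq_ge0.
have c20 : 0 <= c2 by exact: le_trans (normsq_ge0 _) nqs.
have c30 : 0 <= c3 by rewrite addr_ge0 ?mulr_ge0.
have neta : normsq (q ^+ 2 * sig) <= c3 * normsq q.
  apply: sq; rewrite ?normsq_ge0 ?mulr_ge0//.
  have -> : normsq (q ^+ 2 * sig) ^+ 2 = normsq (q * sig ^+ 2) * normsq q * normsq q ^+ 2.
    by rewrite !expr2 !normsqM; ring.
  rewrite exprMn ler_wpM2r ?sqr_ge0//.
  apply: (@le_trans _ _ (c2 * CQ)); first by rewrite ler_pM ?normsq_ge0.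
  by rewrite /c3; have := mulr_ge0 c20 CQ0; nra.
have ndq : normsq dq <= c4 * normsq q.
  have -> : dq = (2 * (dg * q - q ^+ 2 * sig)) * g^-1 by rewrite dqE; field.
  rewrite normsqM.
  have n2 : normsq (2 : R[i]) = 4 by rewrite /normsq /=; ring.
  have h1 : normsq (2 * (dg * q - q ^+ 2 * sig)) <= 8 * (Cf' + c3) * normsq q.
    rewrite normsqM n2.
    have := normsq_add (dg * q) (- (q ^+ 2 * sig)); rewrite normsqN normsqM => h.
    have h' : normsq dg * normsq q <= Cf' * normsq q by rewrite ler_wpM2r.
    lra.
  rewrite /c4 -[leRHS]mulrA [Ci * _]mulrC mulrA.
  by apply: ler_pM; rewrite ?normsq_ge0.
have : normsq (dq * cz d) <= c4 * normsq q * normsq (cz d).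
  by rewrite normsqM ler_wpM2r ?normsq_ge0.
move: (dq * cz d) => e; rewrite /normsq => he.
(* The real scalar product of [q] and [e], doubled, is at least minus the sum of their squared
   moduli. *)
have h1 : 0 <= (Re q + Re e) ^+ 2 by exact: sqr_ge0.
have h2 : 0 <= (Im q + Im e) ^+ 2 by exact: sqr_ge0.
rewrite mulrDl mul1r mulrAC.
move: he h1 h2; rewrite /normsq !sqrrD; move: (c4 * _ * _) => r.
lra.
Qed.

(** On a ball around a zero of [Q], a point with [Q] nonzero could be joined to the center by a
    segment, against [umbilic_segment]; so the zeros form an open set, as do the other points. *)
Lemma umbilic_dichotomy : (forall z, S z -> Q z = 0) \/ (forall z, S z -> Q z != 0).
Proof.
have [[z0 [Sz0 Q0]]|H] := pselect (exists z, S z /\ Q z != 0); last first.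
  by left => z Sz; apply/eqP/negPn/negP => h; apply: H; exists z.
right; apply: (@connected_ind _ S (fun z => Q z != 0) z0) => //.
- move=> z Sz Qz; apply: hol_neq0_near => //; eexists.
  exact: (Hol_hol (HolQ oS Hf HP f0)).
- move=> z Sz Qz; have [r r0 rS] := open_ball_sub oS Sz.
  apply/nbhs_ballP; exists r => // w bw Qw; apply: Qz.
  apply: umbilic_segment Qw => s s01; apply: rS; apply: ball_seg => //.
  exact: ballxx.
Qed.

Lemma KK_real_const : (forall z, S z -> Q z != 0) ->
  exists k : R, forall z, S z -> KK z = k%:C.
Proof.
move=> Q0.
have SO : S `<=` Om by move=> z Sz; split => //; exact: Q0.
have hK0 : hol S KK (cst 0).
  apply: hol_eqr (hol_sub SO (Hol_hol (Hol_KK oS Hf HP f0))) => w /[!inE] Sw.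
  exact: (KK_const oS Hf HP f0 hW hl pl (SO w Sw)).
have [[z0 Sz0]|U0] := pselect (exists z, S z); last first.
  by exists 0 => z Sz; case: U0; exists z.
exists (Re (KK z0)) => z Sz; rewrite (hol_const oS cS hK0 Sz Sz0).
by apply: cplx_eq => //=; exact: (planar_real oS Hf HP f0 hW hl pl (SO z0 Sz0)).
Qed.

End Umbilics.

(** * The models, and the classification *)

Section Models.
Variable R : realType.
Implicit Types (b : R) (z : R * R).

(* [wF], [phF] and [wG], [phG] give the surfaces [(Re ph, w)] with
   [w' = e^(-z) (e^z + b)^2], [Q = -1] and [w' = (1 + b z)^2], [Q = 1]. *)
Definition wF b z : R[i] := cexp (cz z) + (2 * b)%:C * cz z - (b ^+ 2)%:C * cexp (- cz z).
Definition dwF b z : R[i] := cexp (cz z) + (2 * b)%:C + (b ^+ 2)%:C * cexp (- cz z).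
Definition phF b z : R[i] := cz z - b%:C * cexp (- cz z).
Definition dphF b z : R[i] := 1 + b%:C * cexp (- cz z).

Definition wG b z : R[i] := cz z + b%:C * (cz z * cz z) + (b ^+ 2 / 3)%:C * (cz z * (cz z * cz z)).
Definition dwG b z : R[i] := (1 + b%:C * cz z) * (1 + b%:C * cz z).
Definition phG b z : R[i] := (2^-1)%:C * (cz z * cz z) + (b / 3)%:C * (cz z * (cz z * cz z)).
Definition dphG b z : R[i] := cz z * (1 + b%:C * cz z).

Let oT : open [set: R * R] := openT.

Lemma rC_D (x y : R) : (x + y)%:C = x%:C + y%:C :> R[i]. Proof. exact: rmorphD. Qed.
Lemma rC_M (x y : R) : (x * y)%:C = x%:C * y%:C :> R[i]. Proof. exact: rmorphM. Qed.
Lemma rC_N (x : R) : (- x)%:C = - x%:C :> R[i]. Proof. exact: rmorphN. Qed.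
Lemma rC_V (x : R) : (x^-1)%:C = (x%:C)^-1 :> R[i]. Proof. exact: fmorphV. Qed.
Lemma rC_nat (n : nat) : (n%:R : R)%:C = n%:R :> R[i]. Proof. exact: rmorph_nat. Qed.
Lemma rC_1 : (1 : R)%:C = 1 :> R[i]. Proof. by []. Qed.
Lemma rC_0 : (0 : R)%:C = 0 :> R[i]. Proof. by []. Qed.
Lemma rC_eq0 (x : R) : (x%:C == 0 :> R[i]) = (x == 0).
Proof. exact: fmorph_eq0. Qed.
Definition rCE := (rC_D, rC_M, rC_N, rC_V, rC_nat, rC_1, rC_0).

Lemma hol_expN : hol [set: R * R] (fun z => cexp (- cz z)) (fun z => - cexp (- cz z)).
Proof.
by apply: hol_eqr (hol_exp (holN (@hol_cz R setT))) => z _; rewrite /cst mulN1r.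
Qed.

Lemma hol_wF b : hol setT (wF b) (dwF b).
Proof.
apply: hol_eqr (holB (holD (hol_exp (@hol_cz R setT)) (holM (hol_cst (2 * b)%:C) (@hol_cz R setT)))
  (holM (hol_cst (b ^+ 2)%:C) hol_expN)) => z _; rewrite /dwF /cst; ring.
Qed.

Lemma hol_phF b : hol setT (phF b) (dphF b).
Proof.
apply: hol_eqr (holB (@hol_cz R setT) (holM (hol_cst b%:C) hol_expN)) => z _.
rewrite /dphF /cst; ring.
Qed.

Lemma hol_wG b : hol setT (wG b) (dwG b).
Proof.
have hc := @hol_cz R setT.
apply: hol_eqr (holD (holD hc (holM (hol_cst b%:C) (holM hc hc)))
  (holM (hol_cst (b ^+ 2 / 3)%:C) (holM hc (holM hc hc)))) => z _; rewrite /dwG /cst expr2 !rCE; by field.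
Qed.

Lemma hol_phG b : hol setT (phG b) (dphG b).
Proof.
have hc := @hol_cz R setT.
apply: hol_eqr (holD (holM (hol_cst (2^-1)%:C) (holM hc hc))
  (holM (hol_cst (b / 3)%:C) (holM hc (holM hc hc)))) => z _; rewrite /dphG /cst !rCE; by field.
Qed.

Lemma Hol_expN : Hol [set: R * R] (fun z => cexp (- cz z)).
Proof. exact: (Hol_exp oT (HolN oT (Hol_cz oT))). Qed.

Lemma Hol_dwF b : Hol setT (dwF b).
Proof.
exact: (HolD oT (HolD oT (Hol_exp oT (Hol_cz oT)) (Hol_cst oT _)) (HolM oT (Hol_cst oT _) Hol_expN)).
Qed.

Lemma Hol_dphF b : Hol setT (dphF b).
Proof. exact: (HolD oT (Hol_cst oT _) (HolM oT (Hol_cst oT _) Hol_expN)). Qed.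

Lemma Hol_dwG b : Hol setT (dwG b).
Proof.
have H := HolD oT (Hol_cst oT 1) (HolM oT (Hol_cst oT b%:C) (Hol_cz oT)).
exact: (HolM oT H H).
Qed.

Lemma Hol_dphG b : Hol setT (dphG b).
Proof.
exact: (HolM oT (Hol_cz oT) (HolD oT (Hol_cst oT 1) (HolM oT (Hol_cst oT b%:C) (Hol_cz oT)))).
Qed.

Lemma dwFE b z : dwF b z = cexp (- cz z) * (cexp (cz z) + b%:C) ^+ 2.
Proof.
have h : cexp (- cz z) * cexp (cz z) = 1 by rewrite -cexpD addNr cexp0.
rewrite /dwF !rCE.
have -> : cexp (- cz z) * (cexp (cz z) + b%:C) ^+ 2 =
  (cexp (- cz z) * cexp (cz z)) * cexp (cz z) + 2 * (cexp (- cz z) * cexp (cz z)) * b%:C +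
   b%:C * b%:C * cexp (- cz z) by ring.
rewrite h; ring.
Qed.

Lemma hopf_F b z : dwF b z != 0 -> hopfQ (dwF b) (dphF b) z = -1.
Proof.
rewrite dwFE => n0; rewrite /hopfQ.
have h1 := holD (hol_cst 1) (holM (hol_cst b%:C) hol_expN).
have h2 := holD (holD (hol_exp (@hol_cz R setT)) (hol_cst (2 * b)%:C)) (holM (hol_cst (b ^+ 2)%:C) hol_expN).
rewrite (hol_cD h1)// (hol_cD h2)// /cst dwFE /dphF.
have h : cexp (- cz z) = (cexp (cz z))^-1 by rewrite cexpN.
have e0 := cexp_neq0 (cz z).
rewrite h expr2 rC_M; rewrite h in n0; move: (cexp (cz z)) e0 n0 => x x0 n0.
have xb : x + b%:C != 0 by apply: contraNneq n0 => ->; rewrite expr2 !mulr0.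
by field; rewrite x0 xb.
Qed.

Lemma hopf_G b z : dwG b z != 0 -> hopfQ (dwG b) (dphG b) z = 1.
Proof.
rewrite /dwG /hopfQ mulf_eq0 orbb => n0.
have hc := @hol_cz R setT.
have h1 := holM hc (holD (hol_cst 1) (holM (hol_cst b%:C) hc)).
have h0 := holD (hol_cst 1) (holM (hol_cst b%:C) hc).
have h2 := holM h0 h0.
rewrite (hol_cD h1)// (hol_cD h2)// /cst /dphG.
by field.
Qed.

(** Polar form: [acos] gives the angle up to sign, and the sign of the sine decides. *)
Lemma cexp_surj (a : R[i]) : a != 0 -> exists s, cexp s = a.
Proof.
move=> /normsq_root[n n0]; rewrite /normsq => nn.
have x1 : -1 <= Re a / n <= 1.
  rewrite -ler_norml normrM normfV (gtr0_norm n0) ler_pdivrMr// mul1r.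
  rewrite -(ler_sqr (_ : _ \is Num.nneg)) ?nnegrE ?(ltW n0)// real_normK ?num_real// nn lerDl sqr_ge0//.
have cs : cos (acos (Re a / n)) = Re a / n by exact: acosK.
have ss : sin (acos (Re a / n)) ^+ 2 = (Im a / n) ^+ 2.
  have -> : sin (acos (Re a / n)) ^+ 2 = 1 - (Re a / n) ^+ 2.
    have := cos2Dsin2 (acos (Re a / n)); rewrite cs.
    by move: (sin _) => y <-; rewrite addrAC subrr add0r.
  have -> : (Im a / n) ^+ 2 = (n ^+ 2 - Re a ^+ 2) / n ^+ 2.
    by rewrite expr_div_n; congr (_ / _); rewrite nn; ring.
  by field; rewrite gt_eqF.
have [th [c1 s1]] : exists th, cos th = Re a / n /\ sin th = Im a / n.
  move/eqP: ss; rewrite eqf_sqr => /orP[/eqP e|/eqP e]; first by exists (acos (Re a / n)).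
  by exists (- acos (Re a / n)); rewrite cosN sinN e opprK.
exists (ln n +i* th); rewrite /cexp /= lnK ?posrE// c1 s1.
by apply: cplx_eq => /=; field; rewrite gt_eqF.
Qed.

End Models.

(** * Classification of the holomorphic data *)

Section Classification.
Variable R : realType.
Variables (S : set (R * R)) (f P W : R * R -> R[i]) (l : R * R -> R).
Hypotheses (oS : open S) (scS : simply_connected S) (S0 : S !=set0).
Hypotheses (Hf : Hol S f) (HP : Hol S P).
Hypothesis f0 : forall z, S z -> f z != 0.
Hypothesis hW : hol S W f.
Hypothesis hl : forall z, S z -> is_diff z l (fun v => Re (P z * cz v)).
Hypothesis pl : planar_lines S f P W l.
Local Notation Q := (hopfQ f P).

Let cS : connected S. Proof. by case: scS. Qed.

(* Up to the isometry and homothety given by [lam], [e], [c], [d], [d0] the data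
   [(l, W)] are those of a model reparametrized by [psi]. *)
Definition matches (wm phm : R * R -> R[i]) : Prop :=
  exists (lam : R) (e : R[i]) (psi : R * R -> R[i]) (c d : R[i]) (d0 : R),
  [/\ lam != 0, normsq e = 1, Hol S psi, (forall z, S z -> cD psi z != 0) &
    forall z, S z -> W z = lam%:C * e * wm (pt (psi z)) + d /\
      l z = lam * Re (phm (pt (psi z))) + Re (c * W z) + d0].

Lemma real_const (g : R * R -> R) : (forall z, S z -> is_diff z g (fun=> 0)) ->
  exists d, forall z, S z -> g z = d.
Proof.
move=> hg; have [z0 Sz0] := S0; exists (g z0) => z Sz.
have h : hol S (fun z => (g z)%:C) (cst 0).
  move=> w Sw; split.
    by apply: (is_diff_eq (hg w Sw)); apply/funext => v; rewrite /comp /cst mul0r.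
  by apply: (is_diff_eq (is_diff_cst (0 : R) w)); apply/funext => v; rewrite /comp /cst mul0r.
by have /(congr1 (@complex.Re R)) := hol_const oS cS h Sz Sz0.
Qed.

Lemma hol_cst_on (F : R * R -> R[i]) : hol S F (cst 0) ->
  exists d, forall z, S z -> F z = d.
Proof. by have [z0 Sz0] := S0; move=> h; exists (F z0) => z Sz; exact: hol_const h _ _ Sz Sz0. Qed.

(** Hence [f] and [Q] determine [P] up to a constant multiple of [f], and such a multiple is what a
    shear produces. *)
Lemma holP_f : hol S (fun z => P z / f z) (fun z => Q z / f z).
Proof.
apply: hol_eqr (holM (Hol_hol HP) (hol_inv (Hol_hol Hf) f0)) => z /[!inE] Sz.
by rewrite /hopfQ; have := f0 Sz; move: (cD f z) (cD P z) (f z) (P z) => a b x y x0; field.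
Qed.

Lemma l_of_P (G gm : R * R -> R[i]) (lam : R) (c : R[i]) : hol S G gm ->
  (forall z, S z -> P z = lam%:C * gm z + c * f z) ->
  exists d0, forall z, S z -> l z = lam * Re (G z) + Re (c * W z) + d0.
Proof.
move=> hG PE.
have [d hd] : exists d, forall z, S z -> l z - (lam * Re (G z) + Re (c * W z)) = d.
  apply: real_const => z Sz.
  have [h1 _] := cdiffD (cdiffM (cdiff_cst z lam%:C) (hG z Sz)) (cdiffM (cdiff_cst z c) (hW Sz)).
  have h2 := is_diffB (hl Sz) h1.
  have -> : (fun z => l z - (lam * Re (G z) + Re (c * W z))) =
    l - (@complex.Re R \o (fun x => cst lam%:C x * G x + cst c x * W x)).
    by apply/funext => x; rewrite !fctE /comp /cst ReD [Re (lam%:C * _)]ReM /= mul0r subr0.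
  apply: (is_diff_eq h2); apply/funext => v; rewrite !fctE /comp /cst PE//.
  by rewrite !mul0r !add0r -ReN -ReD (_ : _ + _ = 0)//; ring.
by exists d => z Sz; rewrite -(hd z Sz) addrC subrK.
Qed.

(** The two last hypotheses are the transformation laws of f dz and Q dz^2. Integrating the first
    gives [W] up to the translation [d]; comparing the derivatives of P / f gives [P] up to the
    shear [c]; integrating [P] gives [l] up to [d0]. *)
Lemma matching (wm dwm phm dphm psi psip : R * R -> R[i]) (lam : R) (e : R[i]) (Wc : R) :
  hol setT wm dwm -> hol setT phm dphm -> Hol setT dwm -> Hol setT dphm ->
  (forall z, dwm z != 0 -> hopfQ dwm dphm z = Wc%:C) ->
  lam != 0 -> normsq e = 1 -> hol S psi psip -> Hol S psip ->
  (forall z, S z -> f z = lam%:C * e * dwm (pt (psi z)) * psip z) ->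
  (forall z, S z -> Q z = lam%:C * Wc%:C * psip z ^+ 2) ->
  matches wm phm.
Proof.
move=> hwm hphm Hdwm Hdphm hWc lam0 e1 hpsi Hpsip fE QE.
have e0 : e != 0 by rewrite -normsq_eq0 e1 oner_eq0.
have lamC0 : lam%:C != 0 by rewrite rC_eq0.
have fn z : S z -> dwm (pt (psi z)) != 0 /\ psip z != 0.
  by move=> Sz; have := f0 Sz; rewrite fE// !mulf_eq0 !negb_or => /andP[/andP[]].
have hcomp (F G : R * R -> R[i]) : hol setT F G -> hol S (fun z => F (pt (psi z))) (fun z => G (pt (psi z)) * psip z).
  move=> hF z Sz; apply: cdiff_eq (cdiff_hol_comp (hpsi z Sz) (hF _ I)) _ => h; ring.
have [d hd] : exists d, forall z, S z -> W z - lam%:C * e * wm (pt (psi z)) = d.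
  apply: hol_cst_on.
  apply: hol_eqr (holB hW (holM (hol_cst (lam%:C * e)) (hcomp _ _ hwm))) => z /[!inE] Sz.
  by rewrite /cst fE//; ring.
have [c hc] : exists c, forall z, S z -> P z / f z - e^-1 * (dphm (pt (psi z)) / dwm (pt (psi z))) = c.
  apply: hol_cst_on.
  have dw0 z : S z -> dwm (pt (psi z)) != 0 by move=> /fn [].
  have h2 := holM (hcomp _ _ (Hol_hol Hdphm)) (hol_inv (hcomp _ _ (Hol_hol Hdwm)) dw0).
  apply: hol_eqr (holB holP_f (holM (hol_cst e^-1) h2)) => z /[!inE] Sz.
  have [n1 n2] := fn z Sz.
  have := hWc _ n1; rewrite /hopfQ => hW1.
  have E : cD dphm (pt (psi z)) = Wc%:C + dphm (pt (psi z)) * cD dwm (pt (psi z)) / dwm (pt (psi z)).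
    by rewrite -hW1 subrK.
  have QE' : cD P z - P z * cD f z / f z = lam%:C * Wc%:C * psip z ^+ 2 := QE z Sz.
  rewrite /cst QE' fE// E.
  move: (dphm _) (cD dwm _) (dwm _) (psip z) n1 n2 => x1 x2 x3 x4 n1 n2.
  by field; rewrite n1 n2 e0 lamC0.
have PE z : S z -> P z = lam%:C * (dphm (pt (psi z)) * psip z) + c * f z.
  move=> Sz; have [n1 n2] := fn z Sz; rewrite -(hc z Sz) mulrBl mulfVK ?f0//.
  rewrite fE//; move: (P z) (dphm _) (dwm _) (psip z) n1 n2 => x0 x1 x2 x3 n1 n2.
  by field; rewrite n1 e0.
have [d0 hl0] := l_of_P (hcomp _ _ hphm) PE.
exists lam, e, psi, c, d, d0; split; [exact: lam0|exact: e1| | |].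
- exact: (Hol_prim oS hpsi Hpsip).
- by move=> z Sz; rewrite (hol_cD hpsi Sz); have [] := fn z Sz.
- by move=> z Sz; split; [rewrite -(hd z Sz) addrC subrK|exact: hl0].
Qed.

(** Here P / f is constant, so the height is an affine function of [W], and [W] itself serves as the
    new parameter. *)
Lemma matches_plane : (forall z, S z -> Q z = 0) -> matches (@cz R) (cst 0).
Proof.
move=> Q0.
have [c hc] : exists c, forall z, S z -> P z / f z = c.
  apply: hol_cst_on; apply: hol_eqr holP_f => z /[!inE] Sz.
  by rewrite Q0// mul0r.
have h0 : hol S (cst 0) (cst 0 : R * R -> R[i]) by exact: hol_cst.
have PE z : S z -> P z = (1 : R)%:C * (cst 0 : R * R -> R[i]) z + c * f z.
  by move=> Sz; rewrite mulr0 add0r -(hc z Sz) mulfVK ?f0.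
have [d0 hd] := l_of_P h0 PE.
exists 1, 1, W, c, 0, d0; split.
- exact: oner_neq0.
- by rewrite /normsq /=; ring.
- exact: (Hol_prim oS hW Hf).
- by move=> z Sz; rewrite (hol_cD hW Sz) f0.
- by move=> z Sz; split; [rewrite ptK !mul1r addr0|exact: hd].
Qed.

Section NonPlane.
Hypothesis Q0 : forall z, S z -> Q z != 0.
Local Notation sg := (sg f P).

Lemma sqrtQ : exists2 h, Hol S h & forall z, S z -> h z * h z = Q z.
Proof.
have HQ := HolQ oS Hf HP f0.
have [A hA] := sc_primitive oS (HolM oS (Hol_cD HQ) (HolV oS HQ Q0)) scS S0.
apply: (hol_sqrt oS _ HQ Q0 hA) => F hF x y.
exact: hol_const.
Qed.

(** The map is sqrt k zeta: with k = K the exponentials of the general solution become exp (+- s),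
    and with k = 1 it is zeta itself. *)
Lemma dev_map (k : R[i]) : k != 0 -> exists s sp, [/\ hol S s sp, Hol S sp,
  (forall z, S z -> sp z * sp z = k * Q z), (forall z, S z -> sp z != 0) &
  (forall z, S z -> cD sp z = cD f z * sp z / f z - sp z * Q z * sg z / f z)].
Proof.
move=> k0; have [h Hh hE] := sqrtQ.
have HQ := HolQ oS Hf HP f0.
have h0 z : S z -> h z != 0.
  by move=> Sz; apply: contraTneq (Q0 Sz) => e; rewrite -hE// e mul0r eqxx.
have Hsp : Hol S (fun z => cst (sqrtC k) z * h z) by exact: (HolM oS (Hol_cst oS _) Hh).
have [s hs] := sc_primitive oS Hsp scS S0.
exists s, (fun z => cst (sqrtC k) z * h z); split => //.
- by move=> z Sz; rewrite /cst mulrACA hE// -expr2 sqrtCK.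
- by move=> z Sz; rewrite mulf_neq0 ?h0// /cst sqrtC_eq0.
- move=> z Sz; have := hol_sqrt_derive (Hol_hol Hh) (Hol_hol HQ) oS hE Sz.
  rewrite (Q_derive f0 (conj Sz (Q0 Sz))) (hol_cD (holM (hol_cst (sqrtC k)) (Hol_hol Hh)) Sz).
  rewrite -hE// /cst; have := f0 Sz; have := h0 z Sz.
  move: (h z) (cD h z) (f z) (cD f z) (sg z) => x x' y y' u x0 y0 E.
  have -> : x' = (x' * x + x * x') / (2 * x) by field.
  by rewrite -E; field; rewrite x0 y0.
Qed.

Lemma classify_F (k : R) : k != 0 -> (forall z, S z -> KK f P z = k%:C) ->
  exists2 b : R, 0 <= b & matches (wF b) (phF b).
Proof.
move=> k0 hK.
have kC0 : k%:C != 0 :> R[i] by rewrite rC_eq0.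
have [s [sp [hs Hsp spE sp0 dspE]]] := dev_map kC0.
have SO z : S z -> (S `&` [set z | Q z != 0]) z by move=> Sz; split => //; exact: Q0.
have Hsg : Hol S sg by apply: Hol_sub (Hol_sg oS Hf HP f0).
have dsg z : S z -> cD sg z = (k%:C * f z ^+ 2 + Q z * sg z ^+ 2) / (2 * f z).
  by move=> Sz; rewrite (sg_derive f0 (SO z Sz)) hK.
have dQ z : S z -> cD Q z = 2 * cD f z * Q z / f z - 2 * Q z ^+ 2 * sg z / f z.
  by move=> Sz; exact: (Q_derive f0 (SO z Sz)).
have HQ := HolQ oS Hf HP f0.
have QE z : S z -> Q z = sp z * sp z / k%:C by move=> Sz; rewrite spE// mulrAC mulfV// mul1r.
(* With primes for derivatives in [s], [r1] is rho' and [r2] is the value of rho'' given by the ODE,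
   which becomes 2 rho rho'' - rho'^2 = rho^2. Since r2' = r1, the functions r2 + r1 and r2 - r1 are
   multiples of e^s and e^(-s), and rho - r2 is constant. *)
pose rho z := f z * (sp z)^-1.
pose r1 z := sg z * (k%:C)^-1.
pose r2 z := (k%:C * (f z * f z) + Q z * (sg z * sg z)) * (2 * k%:C * f z * sp z)^-1.
have n2 z : S z -> 2 * k%:C * f z * sp z != 0.
  by move=> Sz; rewrite !mulf_neq0 ?f0 ?sp0// pnatr_eq0.
have hrho : hol S rho (fun z => sp z * r1 z).
  apply: hol_eqr (holM (Hol_hol Hf) (hol_inv (Hol_hol Hsp) sp0)) => z /[!inE] Sz.
  rewrite dspE// /r1 QE//; have := f0 Sz; have := sp0 z Sz.
  move: (sp z) (f z) (cD f z) (sg z) => x y y' u x0 y0; by field; rewrite x0 y0 kC0.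
have hr1 : hol S r1 (fun z => sp z * r2 z).
  apply: hol_eqr (holM (Hol_hol Hsg) (hol_cst (k%:C)^-1)) => z /[!inE] Sz.
  rewrite dsg// /r2 /cst; have := f0 Sz; have := sp0 z Sz.
  move: (sp z) (f z) (Q z) (sg z) => x y q u x0 y0; by field; rewrite x0 y0 kC0.
have hr2 : hol S r2 (fun z => sp z * r1 z).
  have hf := Hol_hol Hf; have hsg := Hol_hol Hsg; have hQ := Hol_hol HQ.
  apply: hol_eqr (holM (holD (holM (hol_cst k%:C) (holM hf hf)) (holM hQ (holM hsg hsg)))
    (hol_inv (holM (holM (hol_cst (2 * k%:C)) hf) (Hol_hol Hsp)) n2)) => z /[!inE] Sz.
  rewrite dspE// dQ// dsg// /r1 /cst QE//; have := f0 Sz; have := sp0 z Sz.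
  move: (sp z) (f z) (cD f z) (sg z) => x y y' u x0 y0; by field; rewrite x0 y0 kC0.
have [C hC] : exists C, forall z, S z -> rho z - r2 z = C.
  by apply: hol_cst_on; apply: hol_eqr (holB hrho hr2) => z _; rewrite subrr.
have [A hA] : exists A, forall z, S z -> (r2 z + r1 z) * cexp (- s z) = A.
  apply: hol_cst_on.
  by apply: hol_eqr (holM (holD hr2 hr1) (hol_exp (holN hs))) => z _; rewrite /cst; ring.
have [B hB] : exists B, forall z, S z -> (r2 z - r1 z) * cexp (s z) = B.
  apply: hol_cst_on.
  by apply: hol_eqr (holM (holB hr2 hr1) (hol_exp hs)) => z _; rewrite /cst; ring.
have exN z : cexp (- s z) * cexp (s z) = 1 by rewrite -cexpD addNr cexp0.
(* This is the ODE itself, in the form (rho - r2)^2 = r2^2 - r1^2; it makes A e^s / 2 + C + B e^(-s)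
   / 2 a perfect square up to an exponential factor. *)
have CAB : C ^+ 2 = A * B.
  have [z Sz] := S0; rewrite -(hC z Sz) -(hA z Sz) -(hB z Sz).
  have -> : (r2 z + r1 z) * cexp (- s z) * ((r2 z - r1 z) * cexp (s z)) =
    (r2 z ^+ 2 - r1 z ^+ 2) * (cexp (- s z) * cexp (s z)) by ring.
  rewrite exN mulr1 /rho /r1 /r2 QE//.
  have := f0 Sz; have := sp0 z Sz.
  move: (sp z) (f z) (sg z) => x y u x0 y0; by field; rewrite x0 y0 kC0.
have fE z : S z -> f z = (A / 2 * cexp (s z) + B / 2 * cexp (- s z) + C) * sp z.
  move=> Sz; rewrite -(hC z Sz) -(hA z Sz) -(hB z Sz).
  have -> : (r2 z + r1 z) * cexp (- s z) / 2 * cexp (s z) = (r2 z + r1 z) / 2 * (cexp (- s z) * cexp (s z)) by ring.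
  have -> : (r2 z - r1 z) * cexp (s z) / 2 * cexp (- s z) = (r2 z - r1 z) / 2 * (cexp (- s z) * cexp (s z)) by ring.
  rewrite exN /rho; have := sp0 z Sz; move: (sp z) (r1 z) (r2 z) => x y u x0; by field.
(* The model has Q = -1 and the new parameter satisfies psi'^2 = K Q, which forces lam = - 1 / K. *)
have [lam lam0 lamE] : exists2 lam : R, lam != 0 & lam%:C = - (k%:C)^-1 :> R[i].
  by exists (- k^-1); rewrite ?oppr_eq0 ?invr_eq0// rC_N rC_V.
have lamC : lam%:C != 0 :> R[i] by rewrite rC_eq0.
(* Used with [zeta = s], or with [zeta = - s] if the coefficient [A] of [e^s]
   vanishes. *)
have main (A' C' : R[i]) (t tp : R * R -> R[i]) : A' != 0 -> hol S t tp -> Hol S tp ->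
   (forall z, S z -> tp z * tp z = k%:C * Q z) ->
   (forall z, S z -> f z = (A' * cexp (t z) + C' + C' ^+ 2 / (4 * A') * cexp (- t z)) * tp z) ->
   exists2 b : R, 0 <= b & matches (wF b) (phF b).
  move=> A0 ht Htp tpE ftE.
  (* The constant term of the model is 2 b lam e: its modulus fixes b >= 0, and its argument, with
     the sign of [lam], is left to the rotation [e]. *)
  have [b [e [b0 e1 bE]]] : exists b : R, exists e : R[i], [/\ 0 <= b, normsq e = 1 & 2 * b%:C * lam%:C * e = C'].
    have [->|C0] := eqVneq C' 0.
      by exists 0, 1; split => //; [rewrite /normsq /=; ring|rewrite rC_0 mulr0 !mul0r].
    have [n n0 nn] := normsq_root C0.
    have al0 : 0 < `|lam| by rewrite normr_gt0.
    exists (n / (2 * `|lam|)), (C' / (n * lam / `|lam|)%:C); split.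
    - by rewrite divr_ge0 ?mulr_ge0// ltW.
    - rewrite normsqM -rC_V -nn [X in _ * X]/normsq /=.
      have l2 : `|lam| ^+ 2 = lam ^+ 2 by rewrite real_normK ?num_real.
      have -> : (n * lam / `|lam|)^-1 ^+ 2 = `|lam| ^+ 2 / (n ^+ 2 * lam ^+ 2).
        by field; rewrite lam0 !gt_eqF.
      by rewrite l2; field; rewrite lam0 gt_eqF.
    - rewrite !rCE; field; rewrite lamC !rC_eq0 !gt_eqF//.
  have e0 : e != 0 by rewrite -normsq_eq0 e1 oner_eq0.
  (* Translating the parameter by [sig] normalizes the coefficient of the exponential. *)
  have [sig sigE] : exists sig, cexp sig = A' / (lam%:C * e).
    by apply: cexp_surj; rewrite !mulf_neq0// invr_eq0 mulf_neq0.
  exists b => //.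
  apply: (@matching _ _ _ _ (fun z => t z + sig) tp lam e (-1) (@hol_wF R b) (@hol_phF R b) (@Hol_dwF R b) (@Hol_dphF R b)) => //.
  - by move=> z n0; rewrite hopf_F// rC_N.
  - by apply: hol_eqr (holD ht (hol_cst sig)) => z _; rewrite /cst addr0.
  - move=> z Sz; rewrite ftE// /dwF ptK opprD !cexpD sigE !cexpN sigE -bE expr2 !rCE.
    have := cexp_neq0 (t z); move: (cexp (t z)) (tp z) => x y x0.
    by field; rewrite x0 A0 lamC e0.
  - by move=> z Sz; rewrite expr2 tpE// lamE rC_N; field.
have [A0|A0] := eqVneq A 0; last first.
  apply: (main (A / 2) C s sp) => //.
    by rewrite mulf_neq0// invr_eq0 pnatr_eq0.
  move=> z Sz; rewrite fE//; congr (_ * _).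
  have -> : C ^+ 2 / (4 * (A / 2)) = B / 2 by rewrite CAB; field.
  by ring.
have C0 : C = 0 by apply/eqP; rewrite -sqrf_eq0 CAB A0 mul0r.
have B0 : B != 0.
  have [z Sz] := S0; apply: contraTneq (f0 Sz) => B0.
  by rewrite fE// A0 C0 B0 !mul0r !add0r mul0r eqxx.
apply: (main (- (B / 2)) 0 (fun z => - s z) (fun z => - sp z)).
- by rewrite oppr_eq0 mulf_neq0// invr_eq0 pnatr_eq0.
- exact: holN.
- exact: (HolN oS Hsp).
- by move=> z Sz; rewrite mulrNN spE.
- by move=> z Sz; rewrite fE// A0 C0 expr2 !mul0r; ring.
Qed.

Lemma classify_G : (forall z, S z -> KK f P z = 0) ->
  exists2 b : R, 0 <= b & matches (wG b) (phG b).
Proof.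
move=> hK.
have [s [sp [hs Hsp spE sp0 dspE]]] := dev_map (oner_neq0 (R[i] : nzRingType)).
have SO z : S z -> (S `&` [set z | Q z != 0]) z by move=> Sz; split => //; exact: Q0.
have Hsg : Hol S sg by apply: Hol_sub (Hol_sg oS Hf HP f0).
have dsg z : S z -> cD sg z = (Q z * sg z ^+ 2) / (2 * f z).
  by move=> Sz; rewrite (sg_derive f0 (SO z Sz)) hK// mul0r add0r.
have HQ := HolQ oS Hf HP f0.
have QE z : S z -> Q z = sp z * sp z by move=> Sz; rewrite spE// mul1r.
pose rho z := f z * (sp z)^-1.
(* With primes for derivatives in [s], [sg] is rho' and, K being 0, [r2] = rho'^2 / (2 rho) is
   rho''. It is a constant [a]: rho is constant if a = 0, and a / 2 times the square of a translate
   of [s] otherwise. *)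
pose r2 z := sp z * (sg z * sg z) * (2 * f z)^-1.
have n2 z : S z -> 2 * f z != 0.
  by move=> Sz; rewrite !mulf_neq0 ?f0// pnatr_eq0.
have hrho : hol S rho (fun z => sp z * sg z).
  apply: hol_eqr (holM (Hol_hol Hf) (hol_inv (Hol_hol Hsp) sp0)) => z /[!inE] Sz.
  rewrite dspE// QE//; have := f0 Sz; have := sp0 z Sz.
  move: (sp z) (f z) (cD f z) (sg z) => x y y' u x0 y0; by field; rewrite x0 y0.
have dsg2 z : S z -> cD sg z = sp z * r2 z.
  move=> Sz; rewrite dsg// /r2 QE//; have := f0 Sz.
  move: (sp z) (f z) (sg z) => x y u y0; by field.
have hr2 : hol S r2 (cst 0).
  have hf := Hol_hol Hf; have hsg := Hol_hol Hsg.
  apply: hol_eqr (holM (holM (Hol_hol Hsp) (holM hsg hsg))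
    (hol_inv (holM (hol_cst 2) hf) n2)) => z /[!inE] Sz.
  rewrite dspE// dsg// /cst QE//; have := f0 Sz; have := sp0 z Sz.
  move: (sp z) (f z) (cD f z) (sg z) => x y y' u x0 y0; by field.
have [a ha] := hol_cst_on hr2.
have QE1 z : S z -> forall (mu : R) , mu != 0 -> 
    Q z = (mu ^+ 2)%:C * (1 : R)%:C * (sp z / mu%:C) ^+ 2.
  move=> Sz mu mu0; rewrite QE// expr2 !rCE.
  have : mu%:C != 0 :> R[i] by rewrite rC_eq0.
  by move=> m0; field.
have [a0|a0] := eqVneq a 0.
  have sg0 z : S z -> sg z = 0.
    move=> Sz; have := ha z Sz; rewrite a0 /r2 => /eqP.
    rewrite !mulf_eq0 invr_eq0 (negbTE (n2 z Sz)) (negbTE (sp0 z Sz)) /= orbF orbb.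
    by move/eqP.
  have [C hC] : exists C, forall z, S z -> rho z = C.
    by apply: hol_cst_on; apply: hol_eqr hrho => z /[!inE] Sz; rewrite sg0// mulr0.
  have fE z : S z -> f z = C * sp z by move=> Sz; rewrite -(hC z Sz) /rho mulfVK ?sp0.
  have C0 : C != 0.
    have [z Sz] := S0; apply: contraTneq (f0 Sz) => C0.
    by rewrite fE// C0 mul0r eqxx.
  (* [mu] is the modulus of [C]: the homothety mu^2, the rotation C / mu and the parameter s / mu
     give f = C s' back and keep Q = s'^2. *)
  have [mu mu0 muE] := normsq_root C0.
  have muC : mu%:C != 0 :> R[i] by rewrite rC_eq0 gt_eqF.
  exists 0 => //.
  apply: (@matching _ _ _ _ (fun z => s z * (mu%:C)^-1) (fun z => sp z * (mu%:C)^-1) (mu ^+ 2) (C / mu%:C) 1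
     (@hol_wG R 0) (@hol_phG R 0) (@Hol_dwG R 0) (@Hol_dphG R 0)).
  - by move=> z n0; rewrite hopf_G.
  - by rewrite expf_neq0// gt_eqF.
  - rewrite normsqM -muE -rC_V /normsq /=; by field; rewrite gt_eqF.
  - by apply: hol_eqr (holM hs (hol_cst (mu%:C)^-1)) => z _; rewrite /cst; ring.
  - exact: (HolM oS Hsp (Hol_cst oS (mu%:C)^-1)).
  - move=> z Sz; rewrite fE// /dwG expr2 !rCE; by field.
  - by move=> z Sz; apply: QE1 => //; rewrite gt_eqF.
have [sig hsig] : exists sig, forall z, S z -> sg z * a^-1 - s z = sig.
  apply: hol_cst_on; apply: hol_eqr (holB (holM (Hol_hol Hsg) (hol_cst a^-1)) hs) => z /[!inE] Sz.
  by rewrite dsg2// ha// /cst; field.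
have sgE z : S z -> sg z = a * (s z + sig).
  by move=> Sz; rewrite -(hsig z Sz) addrC subrK mulrCA mulfV// mulr1.
have fE z : S z -> f z = a / 2 * (s z + sig) ^+ 2 * sp z.
  move=> Sz; have f0z := f0 Sz.
  have e : a * (2 * f z) = sp z * (sg z * sg z) by rewrite -(ha z Sz) /r2 mulfVK ?n2.
  apply: (mulfI a0); apply: (mulfI (_ : 2 != 0)); first by rewrite pnatr_eq0.
  have -> : 2 * (a * f z) = a * (2 * f z) by ring.
  rewrite e sgE//; by field.
have a20 : a / 2 != 0 by rewrite mulf_neq0// invr_eq0 pnatr_eq0.
have [n n0 nE] := normsq_root a20.
(* With mu = 1 / |a / 2| the factor mu a / 2 is a rotation. The parameter is shifted by -1 below
   because the model with b = 1 has w' = (1 + z)^2. *)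
have [mu mu0 muE] : exists2 mu : R, mu != 0 & mu ^+ 2 * n ^+ 2 = 1.
  by exists n^-1; rewrite ?invr_eq0 ?gt_eqF// -exprMn mulVf ?expr1n// gt_eqF.
have muC : mu%:C != 0 :> R[i] by rewrite rC_eq0.
exists 1 => //.
apply: (@matching _ _ _ _ (fun z => (s z + sig) * (mu%:C)^-1 - 1) (fun z => sp z * (mu%:C)^-1) (mu ^+ 2) (mu%:C * (a / 2)) 1
     (@hol_wG R 1) (@hol_phG R 1) (@Hol_dwG R 1) (@Hol_dphG R 1)).
- by move=> z h; rewrite hopf_G.
- by rewrite expf_neq0.
- by rewrite normsqM -nE -muE /normsq /=; ring.
- by apply: hol_eqr (holB (holM (holD hs (hol_cst sig)) (hol_cst (mu%:C)^-1)) (hol_cst 1)) => z _; rewrite /cst; ring.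
- exact: (HolM oS Hsp (Hol_cst oS (mu%:C)^-1)).
- move=> z Sz; rewrite fE// /dwG ptK expr2 !rCE; by field.
- by move=> z Sz; exact: QE1.
Qed.

End NonPlane.

Theorem classification :
  [\/ exists2 b : R, 0 <= b & matches (wF b) (phF b),
      exists2 b : R, 0 <= b & matches (wG b) (phG b) |
      matches (@cz R) (cst 0)].
Proof.
have [Q0|Q0] := umbilic_dichotomy oS cS Hf HP f0 hW hl pl.
  by apply: Or33; exact: matches_plane.
have [k hk] := KK_real_const oS cS Hf HP f0 hW hl pl Q0.
have [k0|k0] := eqVneq k 0.
  by apply: Or32; apply: classify_G => // z Sz; rewrite hk// k0.
by apply: Or31; exact: (classify_F Q0 k0 hk).
Qed.

End Classification.

(** * Isometries and planes of the isotropic space *)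

Section Isometries.
Variable R : realType.
Local Notation M := (@minkowski_mx R).

Definition emb (l : R) (w : R[i]) : 'cV[R]_4 := vec4 l (Re w) (Im w) l.

Lemma I3_emb (Y : 'cV[R]_4) : I3 Y -> Y = emb (Y o0 0) (Y o1 0 +i* Y o2 0).
Proof.
move=> /I3E h; have [v0 v1 v2 v3] := vec4E (Y o0 0) (Y o1 0) (Y o2 0) (Y o0 0).
by apply: cV4_eq; rewrite ?v0 ?v1 ?v2 ?v3.
Qed.

Lemma emb_I3 l w : I3 (emb l w).
Proof. by apply/I3E; rewrite !mxE. Qed.

Lemma emb_add l w l' w' : emb l w + emb l' w' = emb (l + l') (w + w').
Proof. by apply: cV4_eq; rewrite !mxE /= ?ReD ?ImD. Qed.

Lemma emb_scale (k : R) l w : k *: emb l w = emb (k * l) (k%:C * w).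
Proof. by apply: cV4_eq; rewrite !mxE /= ?ReM ?ImM /= ?mul0r ?subr0 ?addr0. Qed.

Lemma det_mink : \det M != 0.
Proof.
rewrite det_diag prodf_seq_neq0; apply/allP => i _ /=; rewrite mxE.
by case: ifP => _; rewrite ?oppr_eq0 oner_eq0.
Qed.

(* Being a square makes the determinant [1] rather than [-1]. *)
Lemma SO31_square (A B : 'M[R]_4) : B^T *m M *m B = M -> A = B *m B -> SO31 A.
Proof.
move=> BM ->; split.
  by rewrite trmx_mul !mulmxA -[B^T *m B^T *m _]mulmxA -(mulmxA B^T _ B) BM BM.
rewrite det_mulmx.
have := congr1 determinant BM; rewrite !det_mulmx det_tr => h.
apply: (mulIf det_mink); rewrite mul1r -[RHS]h; ring.
Qed.

Definition mx4 (r0 r1 r2 r3 : 'cV[R]_4) : 'M[R]_4 :=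
  \matrix_(i, j) (if i == o0 then r0 j 0 else if i == o1 then r1 j 0 else if i == o2 then r2 j 0 else r3 j 0).

Definition rot (e : R[i]) : 'M[R]_4 :=
  mx4 (vec4 1 0 0 0) (vec4 0 (Re e) (- Im e) 0) (vec4 0 (Im e) (Re e) 0) (vec4 0 0 0 1).

(* On [I3]: [(l, w) |-> (l + Re (c w), w)]. *)
Definition shear (c : R[i]) : 'M[R]_4 :=
  let h := normsq c / 2 in
  mx4 (vec4 (1 + h) (Re c) (- Im c) (- h)) (vec4 (Re c) 1 0 (- Re c))
      (vec4 (- Im c) 0 1 (Im c)) (vec4 h (Re c) (- Im c) (1 - h)).

Lemma ord4P (i : 'I_4) : [\/ i = o0, i = o1, i = o2 | i = o3].
Proof.
by apply: (@ord4_case i (fun i => [\/ i = o0, i = o1, i = o2 | i = o3]));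
  [exact: Or41|exact: Or42|exact: Or43|exact: Or44].
Qed.

Lemma mx4_entries (A B : 'M[R]_4) : (forall i j, A i j = B i j) -> A = B.
Proof. by move=> h; apply/matrixP. Qed.

Lemma rot_mul e e' : rot e *m rot e' = rot (e * e').
Proof.
apply: mx4_entries => i j; rewrite mxE sum_ord4.
by case: (ord4P i) => ->; case: (ord4P j) => ->; rewrite !mxE /= ?ReM ?ImM; ring.
Qed.

Lemma rot_mink e : normsq e = 1 -> (rot e)^T *m M *m rot e = M.
Proof.
rewrite /normsq => e1; apply: mx4_entries => i j; rewrite /minkowski_mx mul_mx_diag mxE sum_ord4.
by case: (ord4P i) => ->; case: (ord4P j) => ->; rewrite !mxE /=;
  first [ring | rewrite -[RHS]e1; ring].
Qed.

Lemma shear_half c : shear c = shear (c / 2) *m shear (c / 2).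
Proof.
have h1 : Re (c / 2) = Re c / 2.
  by rewrite (_ : (2 : R[i])^-1 = (2^-1)%:C) ?ReM /= ?mulr0 ?subr0// rC_V rC_nat.
have h2 : Im (c / 2) = Im c / 2.
  by rewrite (_ : (2 : R[i])^-1 = (2^-1)%:C) ?ImM /= ?mulr0 ?add0r// rC_V rC_nat.
apply: mx4_entries => i j; rewrite [RHS]mxE sum_ord4.
by case: (ord4P i) => ->; case: (ord4P j) => ->; rewrite !mxE /= /normsq ?h1 ?h2; field.
Qed.

Lemma shear_mink c : (shear c)^T *m M *m shear c = M.
Proof.
apply: mx4_entries => i j; rewrite /minkowski_mx mul_mx_diag mxE sum_ord4.
by case: (ord4P i) => ->; case: (ord4P j) => ->; rewrite !mxE /= /normsq; field.
Qed.

(** A rotation is the square of one by half the angle; the root has [normsq] 1, a nonnegative number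
    whose square is 1. *)
Lemma rot_isometry e : normsq e = 1 -> isometry_I3 (fun Y => rot e *m Y).
Proof.
move=> e1; apply: isometry_linear; last first.
  by apply: cV4_eq; rewrite !mxE sum_ord4 !mxE /=; ring.
apply: (@SO31_square _ (rot (sqrtC e))).
  apply: rot_mink; have := e1; rewrite -{1}(sqrtCK e) expr2 normsqM -expr2 => /eqP.
  rewrite sqrf_eq1 => /orP[/eqP//|/eqP h].
  by have := normsq_ge0 (sqrtC e); rewrite h oppr_ge0 ler10.
by rewrite rot_mul -expr2 sqrtCK.
Qed.

Lemma shear_isometry c : isometry_I3 (fun Y => shear c *m Y).
Proof.
apply: isometry_linear; last first.
  by apply: cV4_eq; rewrite !mxE sum_ord4 !mxE /=; ring.
exact: (SO31_square (shear_mink (c / 2)) (shear_half c)).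
Qed.

Lemma rot_emb e l w : rot e *m emb l w = emb l (e * w).
Proof. by apply: cV4_eq; rewrite !mxE sum_ord4 !mxE /= ?ReM ?ImM; ring. Qed.

Lemma shear_emb c l w : shear c *m emb l w = emb (l + Re (c * w)) w.
Proof. by apply: cV4_eq; rewrite !mxE sum_ord4 !mxE /= ?ReM; ring. Qed.

(** The horizontal motion comes before the shear, so that the shear acts through the final
    horizontal coordinate, as in [matches]. *)
Lemma isometry_affine (e c d : R[i]) (d0 : R) : normsq e = 1 ->
  exists2 Phi : 'cV[R]_4 -> 'cV[R]_4, isometry_I3 Phi &
    forall l w, Phi (emb l w) = emb (l + Re (c * (e * w + d)) + d0) (e * w + d).
Proof.
move=> e1.
exists (fun Y => (shear c *m (rot e *m Y + emb 0 d)) + emb d0 0).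
  apply: (@isometry_comp _ (fun Y => Y + emb d0 0)).
    by apply: isometry_translation; exact: emb_I3.
  apply: (@isometry_comp _ (fun Y => shear c *m Y) (fun Y => rot e *m Y + emb 0 d)).
    exact: shear_isometry.
  apply: (@isometry_comp _ (fun Y => Y + emb 0 d)).
    by apply: isometry_translation; exact: emb_I3.
  exact: rot_isometry.
by move=> l w; rewrite rot_emb emb_add addr0 shear_emb emb_add addr0.
Qed.

End Isometries.

Section PlaneCovector.
Variable R : realType.

(** The covector is the cross product of [b] and [c] in the coordinates (l, x, y). If it vanished,
    every c_i b - b_i c would be 0, since its coordinates are the same minors, and [b] would be
    0. *)
Lemma plane_covector (Pl : set 'cV[R]_4) : affine_plane_I3 Pl ->
  exists al be ga d : R, [|| al != 0, be != 0 | ga != 0] /\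
    forall Y, Pl Y -> al * Y o0 0 + be * Y o1 0 + ga * Y o2 0 = d.
Proof.
move=> [a [b [c [_ bI cI fr ->]]]].
pose al := b o1 0 * c o2 0 - b o2 0 * c o1 0.
pose be := b o2 0 * c o0 0 - b o0 0 * c o2 0.
pose ga := b o0 0 * c o1 0 - b o1 0 * c o0 0.
exists al, be, ga, (al * a o0 0 + be * a o1 0 + ga * a o2 0); split; last first.
  by move=> _ [s [t ->]]; rewrite !mxE /al /be /ga; ring.
apply: contraT; rewrite !negb_or !negbK => /and3P[/eqP al0 /eqP be0 /eqP ga0].
have lin (s t : R) : s *: b + t *: c = 0 -> s = 0 /\ t = 0.
  move=> st.
  have /freeP h := fr.
  pose k (i : 'I_2) := if i == 0 then s else t.
  have : \sum_(i < 2) k i *: [:: b; c]`_i = 0.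
    by rewrite !big_ord_recl big_ord0 addr0 /= -st.
  by move=> /h H; split; [exact: (H ord0)|exact: (H (lift ord0 ord0))].
have key (i : 'I_4) : c i 0 *: b - b i 0 *: c = 0.
  move/I3E: (bI) => b3; move/I3E: (cI) => c3.
  case: (ord4P i) => ->; apply: cV4_eq; rewrite !mxE ?b3 ?c3;
  move: al0 be0 ga0; rewrite /al /be /ga; lra.
have z (i : 'I_4) : b i 0 = 0.
  by have := lin _ _ (etrans (congr1 _ (scaleNr _ _)) (key i)) => -[_ /eqP]; rewrite oppr_eq0 => /eqP.
have b0 : b = 0 by apply/matrixP => i j; rewrite (ord1 j) z mxE.
have [/eqP] := lin 1 0 (etrans (congr1 _ (scale0r _)) (etrans (addr0 _) (etrans (scale1r _) b0))).
by rewrite oner_eq0.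
Qed.

End PlaneCovector.

(** * Holomorphic data of a zero mean curvature immersion *)

Section SurfaceData.
Variable R : realType.
Variables (S : set (R * R)) (X : R * R -> 'cV[R]_4).
Hypotheses (domS : domain S) (zX : zmc_planar_on S X).

Let oS : open S. Proof. by case: domS. Qed.
Let cS : connected S. Proof. by case: domS. Qed.
Let S0 : S !=set0. Proof. by case: domS. Qed.
Let sX : smooth_on S X. Proof. by case: zX. Qed.
Let XI z : S z -> I3 (X z). Proof. by case: zX => _ h _ _ _; exact: h. Qed.

Local Notation d10 g := ('D_((1, 0) : R * R) g).
Local Notation d01 g := ('D_((0, 1) : R * R) g).
Local Notation x := (crd X o1).
Local Notation y := (crd X o2).
Local Notation l := (crd X o0).

Let sc i : smooth_on S (crd X i). Proof. exact: smooth_coord. Qed.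

Lemma conformal_cases z : S z ->
  let a := d10 x z in let b := d01 x z in let c := d10 y z in let d := d01 y z in
  a * d - b * c != 0 /\
  ((0 < a * d - b * c -> b = - c /\ d = a) /\ (a * d - b * c < 0 -> b = c /\ d = - a)).
Proof.
move=> Sz a b c d.
have [omega /(_ z Sz) conf] : conformal_on S X by case: zX.
have ff v w : first_form X z v w = 'D_v x z * 'D_w x z + 'D_v y z * 'D_w y z.
  exact: (mink_I3I3 (derive_I3 oS sX XI v Sz) (derive_I3 oS sX XI w Sz) (dX sX o1 v Sz)
    (dX sX o2 v Sz) (dX sX o1 w Sz) (dX sX o2 w Sz)).
have h1 := conf (1, 0) (1, 0); rewrite ff /= !(mulr1, mulr0, addr0) in h1.
have h2 := conf (0, 1) (0, 1); rewrite ff /= !(mulr1, mulr0, add0r) in h2.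
have h3 := conf (1, 0) (0, 1); rewrite ff /= !(mulr1, mulr0, mul0r, add0r, addr0) in h3.
have E0 : 0 < expR (2 * omega z) by exact: expR_gt0.
move: h1 h2 h3 E0; rewrite -/a -/b -/c -/d; move: (expR _) a b c d => E a b c d h1 h2 h3 E0.
have J2 : (a * d - b * c) ^+ 2 = E ^+ 2.
  have -> : (a * d - b * c) ^+ 2 = (a * a + c * c) * (b * b + d * d) - (a * b + c * d) ^+ 2 by ring.
  by rewrite h1 h2 h3; ring.
have J : a * d - b * c = E \/ a * d - b * c = - E.
  by move/eqP: J2; rewrite eqf_sqr => /orP[/eqP|/eqP]; [left|right].
have sq0 (p q : R) : p ^+ 2 + q ^+ 2 = 0 -> p = 0 /\ q = 0.
  by move=> /eqP; rewrite paddr_eq0 ?sqr_ge0// !sqrf_eq0 => /andP[/eqP -> /eqP ->].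
split; first by case: J => ->; rewrite ?oppr_eq0 gt_eqF.
split=> h.
  have Je : a * d - b * c = E by case: J => // e; move: h; rewrite e; lra.
  have [] := sq0 (d - a) (b + c); last by move=> p q; split; lra.
  have -> : (d - a) ^+ 2 + (b + c) ^+ 2 = (a * a + c * c) + (b * b + d * d) - 2 * (a * d - b * c) by ring.
  by rewrite h1 h2 Je; ring.
have Je : a * d - b * c = - E by case: J => // e; move: h; rewrite e; lra.
have [] := sq0 (d + a) (b - c); last by move=> p q; split; lra.
have -> : (d + a) ^+ 2 + (b - c) ^+ 2 = (a * a + c * c) + (b * b + d * d) + 2 * (a * d - b * c) by ring.
by rewrite h1 h2 Je; ring.
Qed.

(** The Jacobian of (x, y) is continuous without zeros, so its sign is constant on the connected set
    [S]; [eps] is that sign. *)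
Lemma orientation : exists2 eps : R, eps * eps = 1 & forall z, S z ->
  d01 x z = - (eps * d10 y z) /\ d01 y z = eps * d10 x z.
Proof.
have [z0 Sz0] := S0.
pose J z := d10 x z * d01 y z - d01 x z * d10 y z.
have J0 z : S z -> J z != 0 by move=> /conformal_cases [].
have cJ z : S z -> {for z, continuous J}.
  move=> Sz.
  have c g v : smooth_on S g -> {for z, continuous ('D_v g : R * R -> R)}.
    by move=> sg; apply: differentiable_continuous; exact: smooth_on_diff (smooth_onD v sg) Sz.
  by apply: cvgB; apply: cvgM; apply: c.
have pos_near z : S z -> 0 < J z -> \forall w \near z, 0 < J w.
  by move=> Sz h; exact: (cJ z Sz _ (lt_nbhsr h)).
have neg_near z : S z -> J z < 0 -> \forall w \near z, J w < 0.
  by move=> Sz h; exact: (cJ z Sz _ (lt_nbhsl h)).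
have sgn z : S z -> ~ (0 < J z) -> J z < 0.
  by move=> Sz /negP; rewrite -leNgt le_eqVlt (negbTE (J0 z Sz)).
have [p|n] := pselect (0 < J z0).
  exists 1; first by rewrite mulr1.
  move=> z Sz; have [_ [h _]] := conformal_cases Sz; rewrite !mul1r; apply: h.
  apply: (@connected_ind _ S (fun z => 0 < J z) z0) => //.
  move=> w Sw nw; apply: filterS (neg_near w Sw (sgn w Sw nw)) => v h.
  by apply/negP; rewrite -leNgt ltW.
exists (-1); first by rewrite mulrNN mulr1.
move=> z Sz; have [_ [_ h]] := conformal_cases Sz; rewrite !mulN1r opprK; apply: h.
apply: (@connected_ind _ S (fun z => J z < 0) z0) => //; first exact: sgn.
move=> w Sw nw; have pw : 0 < J w.
  by move/negP: nw; rewrite -leNgt le_eqVlt eq_sym (negbTE (J0 w Sw)).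
apply: filterS (pos_near w Sw pw) => v h.
by apply/negP; rewrite -leNgt ltW.
Qed.

Lemma zmc_data : exists (eps : R) (f P W : R * R -> R[i]),
  [/\ eps * eps = 1, Hol S f /\ Hol S P, (forall z, S z -> f z != 0) /\ hol S W f,
      (forall z, S z -> is_diff z l (fun v => Re (P z * cz v))) /\ planar_lines S f P W l &
      forall z, S z -> X z = emb (l z) (Re (W z) +i* (eps * Im (W z)))].
Proof.
have [eps eps1 CR] := orientation.
pose W z : R[i] := x z +i* (eps * y z).
have sy := smooth_scale eps oS (sc o2).
have dey v z : S z -> 'D_v (fun z => eps * y z) z = eps * 'D_v y z.
  move=> Sz; have := @deriveZ R _ _ (crd X o2) eps z v; rewrite /GRing.scale /= => <- //.
  exact/diff_derivable/(smooth_on_diff (sc o2)).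
have HW : Hol S W.
  apply: (Hol_smooth oS (sc o1) sy) => z Sz; rewrite dey//; have [h1 h2] := CR z Sz.
    by rewrite h2 mulrA eps1 mul1r.
  by rewrite h1.
pose f := cD W; have hW : hol S W f := Hol_hol HW.
have Hf : Hol S f := Hol_cD HW.
have hx z v : S z -> 'D_v x z = Re (f z * cz v).
  by move=> Sz; exact: (cdiff_derive_Re v (hW z Sz)).
have hy z v : S z -> 'D_v y z = eps * Im (f z * cz v).
  move=> Sz; rewrite -(cdiff_derive_Im v (hW z Sz)) -[RHS]/(eps * 'D_v (fun z => eps * y z) z).
  by rewrite dey// mulrA eps1 mul1r.
have f0 z : S z -> f z != 0.
  move=> Sz; rewrite -normsq_eq0.
  have := first_formE oS sX XI eps1 hx hy (1, 0) (1, 0) Sz.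
  have [omega /(_ z Sz) ->] : conformal_on S X by case: zX.
  rewrite /= !(mulr1, mulr0, addr0) => <-; exact: lt0r_neq0 (expR_gt0 _).
have harm z : S z -> d10 (d10 l) z + d01 (d01 l) z = 0.
  move=> Sz.
  have H0 : mean_curvature X z = 0 by case: zX => _ _ _ h _; exact: h.
  have ff : first_form X z (1, 0) (1, 0) != 0.
    rewrite (first_formE oS sX XI eps1 hx hy (1, 0) (1, 0) Sz) /= !(mulr1, mulr0, addr0).
    by rewrite normsq_eq0 f0.
  move/eqP: H0; rewrite /mean_curvature !mulf_eq0 !invr_eq0 pnatr_eq0 (negbTE ff) /=.
  have hL : L_coef X z = _ := mink_second oS sX XI eps1 Hf hx hy (1, 0) (1, 0) Sz (f0 z Sz).
  have hN : N_coef X z = _ := mink_second oS sX XI eps1 Hf hx hy (0, 1) (0, 1) Sz (f0 z Sz).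
  rewrite hL hN cz10 cz01.
  move: (d10 (d10 l) z) (d01 (d01 l) z) (gradl X z / f z) (cD f z) => l1 l2 p q /eqP E.
  rewrite -[RHS]E.
  (* The horizontal terms of L and N are opposite because i^2 = -1; vanishing mean curvature is thus
     the harmonicity of the height. *)
  have -> : Re (p * (q * 'i * 'i)) = - Re (p * (q * 1 * 1)).
    by rewrite !ReImE /=; ring.
  by rewrite opprK addrACA addNr addr0.
pose P z := gradl X z.
have HP : Hol S P := Hol_harmonic oS (sc o0) harm.
have hl z v : S z -> 'D_v l z = Re (P z * cz v) by exact: gradlE.
have hl' z : S z -> is_diff z l (fun v => Re (P z * cz v)).
  move=> Sz; apply: (is_diff_eq (is_diff_plane (smooth_on_diff (sc o0) Sz))).
  by apply/funext => v; rewrite /P /gradl ReM /=; ring.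
exists eps, f, P, W; split; [exact: eps1|by []|by []| |]; last first.
  move=> z Sz; rewrite {1}(I3_emb (XI Sz)); congr emb; congr (_ +i* _).
  by rewrite /W /= mulrA eps1 mul1r.
split; first exact: hl'.
move=> a b c ab sc' hc.
have pl : planar_curvature_lines S X by case: zX.
have [|Pl /plane_covector[al [be [ga [d [nz hd]]]]] hPl] := pl a b c ab.
  split => // s; rewrite in_itv /= => sab; have [Sc c0 Q0] := hc s sab; split => //.
  by apply/(principalE oS sX XI eps1 Hf hx hy HP hl _ Sc (f0 _ Sc)).
(* Re ((be - i eps ga) (x + i eps y)) = be x + ga y, as eps^2 = 1. *)
exists al, (be -i* (eps * ga)), d; split.
  move: nz; case: (al != 0) => //=; apply: contraTT; rewrite negbK => /eqP [-> /eqP].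
  rewrite oppr_eq0 mulf_eq0 => /orP[/eqP e0|/eqP ->]; last by rewrite eqxx.
  by move: eps1; rewrite e0 mul0r => /esym/eqP; rewrite oner_eq0.
move=> t tab; have tI : t \in `]a, b[ by rewrite in_itv /= tab.
rewrite -(hd _ (hPl t tI)).
rewrite ReM /=.
have -> : - (eps * ga) * (eps * y (c t)) = - (eps * eps) * (ga * y (c t)) by ring.
by rewrite eps1 /crd; ring.
Qed.

End SurfaceData.

(** * Orientation and congruence with a model *)

Section Congruence.
Variable R : realType.
Variable eps : R.
Hypothesis eps1 : eps * eps = 1.

(* The identity or the conjugation, according to the orientation of the
   immersion; the models commute with it because their coefficients are real. *)
Definition tw (a : R[i]) : R[i] := Re a +i* (eps * Im a).

Lemma twD a b : tw (a + b) = tw a + tw b.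
Proof. by apply: cplx_eq; rewrite /= !ReImE//= mulrDr. Qed.

Lemma twN a : tw (- a) = - tw a.
Proof. by apply: cplx_eq; rewrite /= !ReImE//= mulrN. Qed.

Lemma twM a b : tw (a * b) = tw a * tw b.
Proof.
apply: cplx_eq; last by rewrite [RHS]ImM /= ImM; ring.
rewrite [RHS]ReM /= ReM.
have -> : eps * Im a * (eps * Im b) = (eps * eps) * (Im a * Im b) by ring.
by rewrite eps1 mul1r.
Qed.

Lemma tw_real (x : R) : tw x%:C = x%:C.
Proof. by apply: cplx_eq; rewrite /= ?mulr0. Qed.

Lemma tw_normsq a : normsq (tw a) = normsq a.
Proof.
rewrite /normsq /=; have -> : (eps * Im a) ^+ 2 = (eps * eps) * Im a ^+ 2 by ring.
by rewrite eps1 mul1r.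
Qed.

Lemma Re_twM a b : Re (tw a * tw b) = Re (a * b).
Proof. by rewrite -twM. Qed.

Lemma eps_cases : eps = 1 \/ eps = -1.
Proof.
by move/eqP: eps1; rewrite -expr2 sqrf_eq1 => /orP[/eqP|/eqP]; [left|right].
Qed.

Lemma tw_exp a : tw (cexp a) = cexp (tw a).
Proof.
by apply: cplx_eq => /=; case: eps_cases => ->;
  rewrite ?mul1r ?mulN1r ?cosN ?sinN ?mulrN.
Qed.

Lemma tw_inj0 a : tw a = 0 -> a = 0.
Proof.
move=> h; have := congr1 (@complex.Re R) h; have := congr1 (@complex.Im R) h => /= h1 h2.
apply: cplx_eq => //=; have : eps * (eps * Im a) = 0 by rewrite h1 mulr0.
by rewrite mulrA eps1 mul1r.
Qed.

Lemma tw_is_diff (V : normedModType R) (z : V) (F dF : V -> R[i]) : cdiff z F dF ->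
  is_diff z (fun z => pt (tw (F z))) (fun h => pt (tw (dF h))).
Proof. by move=> [h1 h2]; exact: (is_diff_pair h1 (is_diffZ eps h2)). Qed.

Lemma tw_smooth S H : open S -> Hol S H -> smooth_on S (fun z => pt (tw (H z))).
Proof.
move=> oS HH.
pose P (g : R * R -> R * R) := exists2 H, Hol S H & g = (fun z => pt (tw (H z))).
apply: (smooth_coind oS (P := P)); last by exists H.
move=> _ {HH}[{}H HH ->].
have D z : S z -> is_diff z (fun z => pt (tw (H z))) (fun h => pt (tw (cD H z * cz h))).
  by move=> Sz; exact: (tw_is_diff (Hol_hol HH Sz)).
split; first by move=> z /D [].
move=> v; exists (fun z => pt (tw (cD H z * cz v))).
  exists (fun z => cD H z * cst (cz v) z); last reflexivity.
  exact: (HolM oS (Hol_cD HH) (Hol_cst oS (cz v))).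
by move=> z /[!inE] /D /is_diff_derive ->.
Qed.

Lemma tw_immersed S H z : Hol S H -> S z -> cD H z != 0 ->
  immersed_at (fun z => pt (tw (H z))) z.
Proof.
move=> HH Sz H0; have D := tw_is_diff (Hol_hol HH Sz).
split; first by case: D.
move=> v v0; rewrite (is_diff_derive v D); apply: contraNneq v0 => /(congr1 (@cz R)).
rewrite ptK (_ : cz 0 = 0)// => /tw_inj0/eqP; rewrite mulf_eq0 (negbTE H0) /= => /eqP e.
by apply/eqP; apply: (can_inj (@czK R)); rewrite e.
Qed.

(** Applying [tw] to the relation between [W] and the model twists [e], [c], [d] and [psi]; the
    model itself is preserved, and heights are unchanged because [tw] does not affect real parts. *)
Lemma congruent_of_matches (S : set (R * R)) (X : R * R -> 'cV[R]_4)
    (W wm phm : R * R -> R[i]) (l : R * R -> R) (Y : R * R -> 'cV[R]_4) :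
  open S -> matches S W l wm phm ->
  (forall z, S z -> X z = emb (l z) (tw (W z))) ->
  (forall z, Y z = emb (Re (phm z)) (wm z)) ->
  (forall s, tw (wm (pt s)) = wm (pt (tw s))) ->
  (forall s, tw (phm (pt s)) = phm (pt (tw s))) ->
  congruent_to_piece_of S X setT Y.
Proof.
move=> oS [lam [e [psi [c [d [d0 [lam0 e1 Hpsi psi0 H]]]]]]] XE YE tww twp.
have [|Phi isoPhi PhiE] := @isometry_affine R (tw e) (tw c) (tw d) d0; first by rewrite tw_normsq.
exists Phi, lam, (fun z => pt (tw (psi z))); split => //.
  by split; [exact: tw_smooth|move=> z Sz; apply: (tw_immersed Hpsi Sz); exact: psi0].
move=> z Sz; have [WE lE] := H z Sz.
rewrite YE emb_scale PhiE XE// -tww.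
have twW : tw e * (lam%:C * tw (wm (pt (psi z)))) + tw d = tw (W z).
  by rewrite WE twD !twM tw_real mulrA [tw e * _]mulrC.
rewrite twW Re_twM lE; congr (emb (lam * _ + _ + _) _).
by rewrite -twp.
Qed.

Lemma tw_wF b s : tw (wF b (pt s)) = wF b (pt (tw s)).
Proof. by rewrite /wF !ptK !(twD, twN, twM, tw_exp, tw_real). Qed.
Lemma tw_phF b s : tw (phF b (pt s)) = phF b (pt (tw s)).
Proof. by rewrite /phF !ptK !(twD, twN, twM, tw_exp, tw_real). Qed.
Lemma tw_wG b s : tw (wG b (pt s)) = wG b (pt (tw s)).
Proof. by rewrite /wG !ptK !(twD, twN, twM, tw_exp, tw_real). Qed.
Lemma tw_phG b s : tw (phG b (pt s)) = phG b (pt (tw s)).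
Proof. by rewrite /phG !ptK !(twD, twN, twM, tw_exp, tw_real). Qed.

End Congruence.

(** * Surfaces with given holomorphic data *)

Section MemberTools.
Variable R : realType.

(** At a zero with a nonzero derivative, F (z + h) = 0 would give |a h| <= |h| / M, hence |h| <= 2
    |1 / a| |a h| <= (M - 1) / M |h|, which is impossible for h nonzero. *)
Lemma simple_zero (F : R * R -> R[i]) z a : cdiff z F (fun h => a * cz h) ->
  (F z != 0) || (a != 0) -> \forall w \near z^', F w != 0.
Proof.
move=> hF; have [Fz|Fz _] := eqVneq (F z) 0; last first.
  by apply: cvg_within; apply: hol_neq0_near => //; eexists; exact: hF.
rewrite /= => a0; have [h1 h2] := hF.
pose M := 2 * `|pt a^-1| + 1.
have M0 : 0 < M by rewrite ltr_wpDl// mulr_ge0.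
have e0 : 0 < M^-1 by rewrite invr_gt0.
have /nbhs_ballP[d1 /= d10 hd1] := is_diff_eps h1 e0.
have /nbhs_ballP[d2 /= d20 hd2] := is_diff_eps h2 e0.
apply/nbhs_ballP; exists (Num.min d1 d2); first by rewrite /= lt_min d10.
move=> w; rewrite -ball_normE /= lt_min => /andP[b1 b2] wz.
apply/negP => /eqP Fw.
pose h := w - z.
have hw : z + h = w by rewrite /h addrCA subrr addr0.
have hn : 0 < `|h| by rewrite normr_gt0 subr_eq0.
have h1' : ball (0 : R * R) d1 h by rewrite -ball_normE /= sub0r normrN distrC.
have h2' : ball (0 : R * R) d2 h by rewrite -ball_normE /= sub0r normrN distrC.
have E1 := hd1 h h1'; have E2 := hd2 h h2'.
rewrite hw Fw Fz /= subrr sub0r normrN in E1.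
rewrite hw Fw Fz /= subrr sub0r normrN in E2.
have E : `|pt (a * cz h)| <= M^-1 * `|h| by rewrite prod_normE ge_max /= E1 E2.
have hE : h = pt (a^-1 * (a * cz h)) by rewrite mulKf// czK.
have : `|h| <= 2 * `|pt a^-1| * (M^-1 * `|h|).
  by rewrite {1}hE; apply: le_trans (norm_pt_mul _ _) _; rewrite ler_wpM2l// mulr_ge0.
have -> : 2 * `|pt a^-1| * (M^-1 * `|h|) = (M - 1) / M * `|h| by rewrite /M; ring.
rewrite leNgt gtr_pMl// ltr_pdivrMr// mul1r gtrBl ltr01; exact.
Qed.

Lemma free_pair (b c : 'cV[R]_4) :
  (forall s t : R, s *: b + t *: c = 0 -> s = 0 /\ t = 0) -> free [:: b; c].
Proof.
move=> h; apply/freeP => k; rewrite !big_ord_recl big_ord0 addr0 /= => /h [k0 k1].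
by case=> [[|[|//]] i2]; [rewrite -k0|rewrite -k1]; congr k; apply: val_inj.
Qed.

(** The equation is solved for a coordinate whose coefficient is nonzero, the other two being the
    parameters of the plane. *)
Lemma covector_plane (al be ga d : R) : [|| al != 0, be != 0 | ga != 0] ->
  exists2 Pl : set 'cV[R]_4, affine_plane_I3 Pl &
    forall l w, al * l + be * Re w + ga * Im w = d -> Pl (emb l w).
Proof.
have build (a b c : 'cV[R]_4) : I3 a -> I3 b -> I3 c ->
    (forall s t : R, s *: b + t *: c = 0 -> s = 0 /\ t = 0) ->
    (forall l w, al * l + be * Re w + ga * Im w = d -> exists s t, emb l w = a + s *: b + t *: c) ->
    exists2 Pl : set 'cV[R]_4, affine_plane_I3 Pl &
    forall l w, al * l + be * Re w + ga * Im w = d -> Pl (emb l w).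
  move=> aI bI cI h1 h2; exists [set Y | exists s t : R, Y = a + s *: b + t *: c] => //.
  by exists a, b, c; split => //; exact: free_pair.
have coords (Y : 'cV[R]_4) : Y = 0 -> [/\ Y o0 0 = 0, Y o1 0 = 0 & Y o2 0 = 0].
  by move=> ->; rewrite !mxE.
case/or3P => n0.
- apply: (build (emb (d / al) 0) (emb (- be / al) 1) (emb (- ga / al) 'i)); try exact: emb_I3.
  + by move=> s t /coords[]; rewrite !mxE /= !(mulr0, mulr1, addr0, add0r) => _ -> ->.
  + move=> l w E; exists (Re w), (Im w); rewrite !emb_scale !emb_add; congr emb.
      rewrite -E; by field.
    by apply: cplx_eq; rewrite !ReImE /=; ring.
- apply: (build (emb 0 (d / be)%:C) (emb 1 (- al / be)%:C) (emb 0 ((- ga / be) +i* 1))); try exact: emb_I3.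
  + by move=> s t /coords[]; rewrite !mxE /= !(mulr0, mulr1, addr0, add0r) => -> _ ->.
  + move=> l w E; exists l, (Im w); rewrite !emb_scale !emb_add; congr emb; first by ring.
    apply: cplx_eq; rewrite !ReImE /=; last by ring.
    rewrite -E; by field.
- apply: (build (emb 0 (0 +i* (d / ga))) (emb 1 (0 +i* (- al / ga))) (emb 0 (1 +i* (- be / ga)))); try exact: emb_I3.
  + by move=> s t /coords[]; rewrite !mxE /= !(mulr0, mulr1, addr0, add0r) => -> ->.
  + move=> l w E; exists l, (Re w); rewrite !emb_scale !emb_add; congr emb; first by ring.
    apply: cplx_eq; rewrite !ReImE /=; first by ring.
    rewrite -E; by field.
Qed.

Lemma const_on_interval (g : R -> R) (a b : R) :
  (forall t, a < t < b -> is_derive t 1 g 0) ->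
  forall s t, a < s < b -> a < t < b -> g s = g t.
Proof.
move=> dg s t /andP[s1 s2] /andP[t1 t2].
have ab u : 0 <= u <= 1 -> a < s + u * (t - s) < b.
  move=> /andP[u0 u1]; have -> : s + u * (t - s) = (1 - u) * s + u * t by ring.
  have [->|un] := eqVneq u 0; first by rewrite subr0 mul1r mul0r addr0 s1.
  have up : 0 < u by rewrite lt0r un.
  have h1 : 0 <= 1 - u by rewrite subr_ge0.
  have m1 : (1 - u) * a <= (1 - u) * s by rewrite ler_wpM2l// ltW.
  have m2 : (1 - u) * s <= (1 - u) * b by rewrite ler_wpM2l// ltW.
  have m3 : u * a < u * t by rewrite ltr_pM2l.
  have m4 : u * t < u * b by rewrite ltr_pM2l.
  lra.
have [|u _] := @seg_MVT R (fun u => g (s + u * (t - s))) (fun=> 0 * (t - s)).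
  move=> u u01.
  have h1 : is_derive u 1 (fun u : R => s + u * (t - s)) (t - s).
    have := is_derive_of_diff (is_diff_line s (t - s) u); rewrite scale1r; exact.
  exact: (@is_derive1_comp R g (fun u : R => s + u * (t - s)) u 0 (t - s) (dg _ (ab u u01)) h1).
rewrite mul1r !mul0r addr0 addrCA subrr addr0 => /eqP.
by rewrite subr_eq0 => /eqP.
Qed.

(** At each time exactly one component of c' vanishes. Both alternatives are open conditions, so one
    of them holds throughout the interval, and the corresponding coordinate of [c] is constant. *)
Lemma axis_curve (a b : R) (c : R -> R * R) : a < b -> smooth_on `]a, b[%classic c ->
  (forall t, a < t < b -> derive1 c t != 0 /\ (derive1 c t).1 * (derive1 c t).2 = 0) ->
  (exists v0, forall t, a < t < b -> (c t).2 = v0) \/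
  (exists u0, forall t, a < t < b -> (c t).1 = u0).
Proof.
move=> ab sc hc.
have oI : open (`]a, b[%classic : set R) by exact: interval_open.
have cI : connected (`]a, b[%classic : set R).
  by apply/connected_intervalP; exact: interval_is_interval.
have I t : a < t < b -> (`]a, b[%classic : set R) t by rewrite /= in_itv.
have I' t : (`]a, b[%classic : set R) t -> a < t < b by rewrite /= in_itv.
have dc t : a < t < b -> is_diff t c ('d c t).
  by move=> /I h; apply: differentiableP; exact: smooth_on_diff sc h.
have c1E t : a < t < b -> is_derive t 1 (fun t => (c t).1) (derive1 c t).1.
  move=> h; have := is_derive_of_diff (is_diff_comp (dc t h) (fst_diff (c t))).
  by rewrite /= derive1E deriveE//; have [] := dc t h.
have c2E t : a < t < b -> is_derive t 1 (fun t => (c t).2) (derive1 c t).2.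
  move=> h; have := is_derive_of_diff (is_diff_comp (dc t h) (snd_diff (c t))).
  by rewrite /= derive1E deriveE//; have [] := dc t h.
have d1c t : a < t < b -> {for t, continuous (fun t => (derive1 c t).1)} /\
    {for t, continuous (fun t => (derive1 c t).2)}.
  move=> /I h; have sc' := smooth_onD (1 : R) sc.
  have e : derive1 c = 'D_1 c by apply/funext => s; rewrite derive1E.
  rewrite e; have D := differentiableP (smooth_on_diff sc' h).
  have [q1 _] := is_diff_comp D (fst_diff ('D_1 c t)).
  have [q2 _] := is_diff_comp D (snd_diff ('D_1 c t)).
  by split; [exact: differentiable_continuous q1|exact: differentiable_continuous q2].
have nz (g : R -> R) t : {for t, continuous g} -> g t != 0 -> \forall s \near t, g s != 0.
  move=> cg g0; have := cg; move/cvgrPdist_lt => /(_ `|g t|); rewrite normr_gt0 => /(_ g0).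
  apply: filterS => s; apply: contraTneq => ->; by rewrite subr0 ltxx.
pose m := (a + b) / 2.
have mI : a < m < b by rewrite /m; lra.
have other t : a < t < b -> ((derive1 c t).1 == 0) = ((derive1 c t).2 != 0).
  move=> h; have [n0 /eqP] := hc t h; rewrite mulf_eq0.
  case: eqP => /= [e1|n1 /eqP ->]; last by rewrite eqxx.
  move=> _; apply/esym; apply: contraNneq n0 => e2; apply/eqP.
  by apply: injective_projections.
have [m2|m2] := eqVneq ((derive1 c m).2) 0.
- left; exists (c m).2 => t ht; apply: (@const_on_interval (fun t => (c t).2) a b _ t m) => // s hs.
  apply: is_derive_eq (c2E s hs) _.
  apply: (@connected_ind _ _ (fun s => (derive1 c s).2 = 0) m oI cI (I _ mI) m2 _ _ _ (I _ hs)).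
  + move=> u /I' hu e.
    have n1 : (derive1 c u).1 != 0 by rewrite other// e eqxx.
    have h1 := nz _ _ (d1c u hu).1 n1; have h2 := nearU oI (I _ hu).
    by apply: filterS2 h2 h1 => w /I' /other ->; rewrite negbK => /eqP.
  + move=> u /I' hu /eqP e; have := nz _ _ (d1c u hu).2 e.
    by apply: filterS => w /eqP.
- have m1 : (derive1 c m).1 = 0 by apply/eqP; rewrite other.
  right; exists (c m).1 => t ht; apply: (@const_on_interval (fun t => (c t).1) a b _ t m) => // s hs.
  apply: is_derive_eq (c1E s hs) _.
  apply: (@connected_ind _ _ (fun s => (derive1 c s).1 = 0) m oI cI (I _ mI) m1 _ _ _ (I _ hs)).
  + move=> u /I' hu e.
    have n1 : (derive1 c u).2 != 0 by rewrite -other// e eqxx.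
    have h1 := nz _ _ (d1c u hu).2 n1; have h2 := nearU oI (I _ hu).
    by apply: filterS2 h2 h1 => w /I' /other <- /eqP.
  + move=> u /I' hu /eqP e; have := nz _ _ (d1c u hu).1 e.
    by apply: filterS => w /eqP.
Qed.

End MemberTools.

Section Member.
Variable R : realType.
Variables (w dw ph dph : R * R -> R[i]).
Hypotheses (hw : hol setT w dw) (hph : hol setT ph dph).
Hypotheses (Hdw : Hol setT dw) (Hdph : Hol setT dph).
Let X z := emb (Re (ph z)) (w z).
Let oT : open [set: R * R] := openT.

Definition e03 : 'cV[R]_4 := emb 1 0.
Definition e1 : 'cV[R]_4 := emb 0 1.
Definition e2 : 'cV[R]_4 := emb 0 'i.

Lemma embE (l : R) (a : R[i]) : emb l a = l *: e03 + Re a *: e1 + Im a *: e2.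
Proof.
rewrite !emb_scale !emb_add; congr emb; first by ring.
by apply: cplx_eq; rewrite !ReImE /=; ring.
Qed.

Lemma emb_is_diff (A B dA dB : R * R -> R[i]) z : cdiff z A dA -> cdiff z B dB ->
  is_diff z (fun z => emb (Re (A z)) (B z)) (fun h => emb (Re (dA h)) (dB h)).
Proof.
move=> [a1 _] [b1 b2].
have h0 := is_diff_comp a1 (is_diff_scalel (Re (A z)) e03).
have h1 := is_diff_comp b1 (is_diff_scalel (Re (B z)) e1).
have h2 := is_diff_comp b2 (is_diff_scalel (Im (B z)) e2).
have h := is_diffD (is_diffD h0 h1) h2.
have -> : (fun z => emb (Re (A z)) (B z)) = (fun x => *:%R^~ e03 (Re (A x))) +
   (fun x => *:%R^~ e1 (Re (B x))) + (fun x => *:%R^~ e2 (Im (B x))).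
  by apply/funext => x; rewrite embE !fctE.
by apply: (is_diff_eq h); apply/funext => v; rewrite embE !fctE.
Qed.

Lemma dXE z : is_diff z X (fun v => emb (Re (dph z * cz v)) (dw z * cz v)).
Proof. exact: (emb_is_diff (hph I) (hw I)). Qed.

Lemma emb_eq0 (l : R) (a : R[i]) : emb l a = 0 -> l = 0 /\ a = 0.
Proof.
move=> h; have := congr1 (fun Y : 'cV[R]_4 => Y o0 0) h.
have := congr1 (fun Y : 'cV[R]_4 => Y o1 0) h; have := congr1 (fun Y : 'cV[R]_4 => Y o2 0) h.
by rewrite !mxE /= => h2 h1 h0; split => //; exact: cplx_eq.
Qed.

Lemma cz_eq0 (v : R * R) : (cz v == 0) = (v == 0).
Proof.
apply/eqP/eqP => [e|->//]; by apply: (can_inj (@czK R)); rewrite e.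
Qed.

Lemma immersedE z : immersed_at X z <-> dw z != 0.
Proof.
have D := dXE z; split.
  move=> [_ h]; apply/negP => /eqP d0.
  (* Where [dw] vanishes only the height can vary, and this direction is chosen so that Re (dph v) =
     0. *)
  pose v := if dph z == 0 then ((1 : R), (0 : R)) else pt ('i / dph z).
  have v0 : v != 0.
    rewrite /v; case: (eqVneq (dph z) 0) => [_|n0].
      by apply/eqP => /(congr1 fst) /eqP; rewrite oner_eq0.
    have i0 : 'i != 0 :> R[i] by rewrite eq_complex /= oner_eq0 andbF.
    by rewrite -cz_eq0 ptK mulf_neq0 ?invr_eq0.
  have := h v v0; rewrite (is_diff_derive v D) d0 mul0r.
  suff -> : Re (dph z * cz v) = 0.
    by move/eqP; apply; apply: cV4_eq; rewrite !mxE.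
  rewrite /v; case: (eqVneq (dph z) 0) => [->|n0]; first by rewrite mul0r.
  by rewrite ptK mulrCA mulfV// mulr1.
move=> n0; split; first by case: D.
move=> v v0; rewrite (is_diff_derive v D); apply/eqP => /emb_eq0 [_ /eqP].
by rewrite mulf_eq0 (negbTE n0) /= cz_eq0 (negbTE v0).
Qed.

Lemma member_smooth : smooth_on setT X.
Proof.
pose P (g : R * R -> 'cV[R]_4) := exists A B : R * R -> R[i],
  [/\ Hol setT A, Hol setT B & g = (fun z => emb (Re (A z)) (B z))].
apply: (smooth_coind oT (P := P)); last first.
  exists ph, w; split; [exact: (Hol_prim oT hph Hdph)|exact: (Hol_prim oT hw Hdw)|reflexivity].
move=> _ [A [B [HA HB ->]]].
have D z := emb_is_diff (Hol_hol HA (I : setT z)) (Hol_hol HB (I : setT z)).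
split; first by move=> z _; case: (D z).
move=> v; exists (fun z => emb (Re (cD A z * cz v)) (cD B z * cz v)).
  exists (fun z => cD A z * cst (cz v) z), (fun z => cD B z * cst (cz v) z); split;
    [exact: (HolM oT (Hol_cD HA) (Hol_cst oT (cz v)))|
     exact: (HolM oT (Hol_cD HB) (Hol_cst oT (cz v)))|reflexivity].
by move=> z _; exact: (is_diff_derive v (D z)).
Qed.

(** When Q is a nonzero real constant, Im (Q c'^2) = 0 means that c' is parallel to an axis, so
    planarity is a condition on the coordinate lines. *)
Definition axis_planes : Prop :=
  (forall v0 : R, exists al be ga d : R, [|| al != 0, be != 0 | ga != 0] /\
    forall u : R, al * Re (ph (u, v0)) + be * Re (w (u, v0)) + ga * Im (w (u, v0)) = d) /\
  (forall u0 : R, exists al be ga d : R, [|| al != 0, be != 0 | ga != 0] /\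
    forall v : R, al * Re (ph (u0, v)) + be * Re (w (u0, v)) + ga * Im (w (u0, v)) = d).

Lemma member : (forall z, \forall x \near z^', dw x != 0) ->
  (forall z, Re (ph z) = 0) \/
  (exists k : R, [/\ k != 0, (forall z, dw z != 0 -> hopfQ dw dph z = k%:C) & axis_planes]) ->
  zmc_planar_member setT X.
Proof.
move=> iso cases.
have XI z : I3 (X z) by exact: emb_I3.
have DE : [set z | setT z /\ immersed_at X z] = setT `&` [set z | dw z != 0].
  by apply/seteqP; split => z [_] /= h; split => //; apply/immersedE.
split => //; first exact: member_smooth.
  by move=> z _; apply: filterS (iso z) => x; exact: (immersedE x).2.
rewrite DE; set U := _ `&` _.
have oU : open U := open_neq0 oT Hdw.
have UT : U `<=` setT by [].
have sX := smooth_on_sub UT member_smooth.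
have XIU z : U z -> I3 (X z) by move=> _.
have Hf := Hol_sub UT Hdw; have HP := Hol_sub UT Hdph.
have f0 z : U z -> dw z != 0 by case.
have dcrd i z v : 'D_v (crd X i) z = emb (Re (dph z * cz v)) (dw z * cz v) i 0.
  rewrite -(derive_coord i v member_smooth (I : setT z)).
  by rewrite (is_diff_derive v (dXE z)).
have hx z v : U z -> 'D_v (crd X o1) z = Re (dw z * cz v) by move=> _; rewrite dcrd mxE.
have hy z v : U z -> 'D_v (crd X o2) z = 1 * Im (dw z * cz v) by move=> _; rewrite dcrd mxE mul1r.
have hl z v : U z -> 'D_v (crd X o0) z = Re (dph z * cz v) by move=> _; rewrite dcrd mxE.
have e11 : 1 * 1 = 1 :> R by rewrite mulr1.
split.
- exact: sX.
- exact: XIU.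
- exists (fun z => ln (normsq (dw z)) / 2) => z Uz v v'.
  rewrite (first_formE oU sX XIU e11 hx hy v v' Uz).
  have -> : 2 * (ln (normsq (dw z)) / 2) = ln (normsq (dw z)) by field.
  by rewrite lnK// posrE normsq_gt0 f0.
- by move=> z Uz; exact: (mean_curvature0 oU sX XIU e11 Hf hx hy HP hl Uz (f0 z Uz)).
move=> a b c ab [sc hc].
case: cases => [ph0|[k [k0 hk [pu pv]]]].
  have [|Pl hPl1 hPl2] := @covector_plane R 1 0 0 0; first by rewrite oner_neq0.
  exists Pl => // s _; apply: hPl2; rewrite ph0; ring.
have ax : forall t, a < t < b -> derive1 c t != 0 /\ (derive1 c t).1 * (derive1 c t).2 = 0.
  move=> t tab; have tI : t \in `]a, b[ by rewrite in_itv /= tab.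
  have [Ut pr] := hc t tI.
  have [c0 Q0] := (principalE oU sX XIU e11 Hf hx hy HP hl (derive1 c t) Ut (f0 _ Ut)).1 pr.
  split => //; move: Q0; rewrite hk ?f0//.
  move: (derive1 c t) => [p q]; rewrite expr2 !ReImE /= => Q0.
  have : 2 * k * (p * q) = 0 by rewrite -Q0; ring.
  by move/eqP; rewrite !mulf_eq0 pnatr_eq0 (negbTE k0) /= -mulf_eq0 => /eqP.
have [[v0 hv]|[u0 hu]] := axis_curve ab sc ax.
- have [al [be [ga [d [nz hd]]]]] := pu v0.
  have [Pl hPl1 hPl2] := covector_plane d nz; exists Pl => // s.
  rewrite in_itv /= => sab; apply: hPl2.
  by rewrite -(hd (c s).1) -(hv s sab) -surjective_pairing.
- have [al [be [ga [d [nz hd]]]]] := pv u0.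
  have [Pl hPl1 hPl2] := covector_plane d nz; exists Pl => // s.
  rewrite in_itv /= => sab; apply: hPl2.
  by rewrite -(hd (c s).2) -(hu s sab) -surjective_pairing.
Qed.

End Member.

(** * The continuous family *)

Section AxisPlanes.
Variable R : realType.
Implicit Types k b u v : R.

Lemma cexp_coord u v : cexp (cz (u, v)) = (expR u * cos v) +i* (expR u * sin v).
Proof. by []. Qed.

Lemma cexpN_coord u v : cexp (- cz (u, v)) = (expR (- u) * cos v) +i* (- (expR (- u) * sin v)).
Proof. by rewrite /cexp /= cosN sinN mulrN. Qed.

(** For fixed v, sin v Re w - cos v Im w eliminates e^u and leaves 2 b sin v Re ph plus a constant,
    where ph = [phF b]; for fixed u, Re w and Re ph are both affine in cos v. *)
Lemma axis_planes_F k b : k != 0 -> axis_planes (wF b) (fun z => k%:C * phF b z).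
Proof.
move=> k0; split.
- move=> v; exists (- (2 * b * sin v) / k), (sin v), (- cos v), (- (2 * b * v * cos v)); split.
    apply: contraT; rewrite !negb_or !negbK oppr_eq0 => /and3P[_ /eqP s0 /eqP c0].
    by have := cos2Dsin2 v; rewrite s0 c0 expr0n /= addr0 => /eqP; rewrite eq_sym oner_eq0.
  move=> u; rewrite /wF /phF cexp_coord cexpN_coord !ReImE /= ?ReImE /=.
  move: (expR u) (expR (- u)) (cos v) (sin v) => e e' c s; by field.
- move=> u; have e0 : expR u != 0 by rewrite gt_eqF ?expR_gt0.
  exists ((expR u - b ^+ 2 * expR (- u)) / k), (b * expR (- u)), 0,
    ((expR u - b ^+ 2 * expR (- u)) * u + 2 * b ^+ 2 * u * expR (- u)); split.
    apply: contraT; rewrite !negb_or !negbK => /and3P[h1 h2 _].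
    have b0 : b = 0.
      by move: h2; rewrite mulf_eq0 => /orP[/eqP//|]; rewrite gt_eqF ?expR_gt0.
    move: h1; rewrite b0 expr0n /= mul0r subr0 mulf_eq0 invr_eq0 (negbTE k0) orbF.
    by rewrite (negbTE e0).
  move=> v; rewrite /wF /phF cexp_coord cexpN_coord !ReImE /= ?ReImE /= expRN.
  move: (expR u) (cos v) (sin v) e0 => e c s e0; field; by rewrite k0 e0.
Qed.

(** For fixed v, the coefficients cancel the powers u^3, u^2 and u; for fixed u, Re w and the height
    are both affine in v^2. *)
Lemma axis_planes_G k b : k != 0 -> axis_planes (wG b) (fun z => k%:C * phG b z).
Proof.
move=> k0; split.
- move=> v; exists (2 * b ^+ 2 * v / k), (- (2 * b * v)), 1, (v + 2 / 3 * b ^+ 2 * v ^+ 3); split.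
    by rewrite oner_neq0 !orbT.
  move=> u; rewrite /wG /phG !ReImE /= ?ReImE /=; by field.
- move=> u.
  exists (- (b + b ^+ 2 * u) / k), (1 / 2 + b * u), 0,
    (- (b + b ^+ 2 * u) * (u ^+ 2 / 2 + b * u ^+ 3 / 3) + (1 / 2 + b * u) * (u + b * u ^+ 2 + b ^+ 2 * u ^+ 3 / 3)); split.
    apply: contraT; rewrite !negb_or !negbK => /and3P[h1 /eqP h2 _].
    move: h1; rewrite mulf_eq0 invr_eq0 (negbTE k0) orbF oppr_eq0 => /eqP h1.
    have h3 : b * u = - (1 / 2) by lra.
    have h4 : b + b ^+ 2 * u = b / 2 by rewrite expr2 -mulrA h3; field.
    have b0 : b = 0 by lra.
    by move: h2; rewrite b0 mul0r addr0 => /eqP; rewrite mul1r invr_eq0 pnatr_eq0.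
  move=> v; rewrite /wG /phG !ReImE /= ?ReImE /=; by field.
Qed.

End AxisPlanes.

Section Family.
Variable R : realType.
Implicit Types t : R.

Definition clamp01 (x : R) : R := Num.max 0 (Num.min 1 x).
Definition pospart (x : R) : R := Num.max 0 x.

(* For [t <= 0] this is [F_(-t)] and for [t >= 3] this is [G_(t - 3)]; in between
   the height of [F_0] is scaled down to a plane, whose parametrization is
   deformed from [e^z] to [z], and the height of [G_0] is scaled up. *)
Definition w_fam t z : R[i] :=
  (1 - clamp01 (t - 1))%:C * wF (pospart (- t)) z + (clamp01 (t - 1))%:C * wG (pospart (t - 3)) z.
Definition ph_fam t z : R[i] :=
  (1 - clamp01 t)%:C * phF (pospart (- t)) z + (clamp01 (t - 2))%:C * phG (pospart (t - 3)) z.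
Definition fam t (z : R * R) : 'cV[R]_4 := emb (Re (ph_fam t z)) (w_fam t z).

Lemma clamp_le0 x : x <= 0 -> clamp01 x = 0.
Proof.
by move=> h; rewrite /clamp01 (min_idPr _) ?(le_trans h)// (max_idPl _).
Qed.
Lemma clamp_ge1 x : 1 <= x -> clamp01 x = 1.
Proof. by move=> h; rewrite /clamp01 (min_idPl _)// (max_idPr _). Qed.
Lemma clamp_id x : 0 <= x <= 1 -> clamp01 x = x.
Proof. by move=> /andP[h0 h1]; rewrite /clamp01 (min_idPr _)// (max_idPr _). Qed.
Lemma pospart_le0 x : x <= 0 -> pospart x = 0.
Proof. by move=> h; rewrite /pospart (max_idPl _). Qed.
Lemma pospart_ge0 x : 0 <= x -> pospart x = x.
Proof. by move=> h; rewrite /pospart (max_idPr _). Qed.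

Lemma fam_left t : t <= 1 ->
  fam t = (fun z => emb (Re ((1 - clamp01 t)%:C * phF (pospart (- t)) z)) (wF (pospart (- t)) z)).
Proof.
move=> t1; apply/funext => z; rewrite /fam /w_fam /ph_fam.
rewrite (clamp_le0 (x := t - 1)); last by lra.
rewrite (clamp_le0 (x := t - 2)); last by lra.
by rewrite rC_0 subr0 rC_1 !mul0r mul1r !addr0.
Qed.

Lemma fam_right t : 2 <= t ->
  fam t = (fun z => emb (Re ((clamp01 (t - 2))%:C * phG (pospart (t - 3)) z)) (wG (pospart (t - 3)) z)).
Proof.
move=> t1; apply/funext => z; rewrite /fam /w_fam /ph_fam.
rewrite (clamp_ge1 (x := t - 1)); last by lra.
rewrite (clamp_ge1 (x := t)); last by lra.
by rewrite subrr rC_0 rC_1 !mul0r mul1r !add0r.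
Qed.

Lemma hopf_scale (k : R) (f P : R * R -> R[i]) z : Hol setT P ->
  hopfQ f (fun z => k%:C * P z) z = k%:C * hopfQ f P z.
Proof.
move=> HP; rewrite /hopfQ (hol_cD (holM (hol_cst k%:C) (Hol_hol HP)))//.
rewrite /cst; ring.
Qed.

Let oT : open [set: R * R] := openT.

(** The zeros of [dwF b] are double, so the criterion for simple zeros is applied to the squared
    factor e^z + b. *)
Lemma iso_F (b : R) z : \forall x \near z^', dwF b x != 0.
Proof.
have h : cdiff z (fun z => cexp (cz z) + b%:C) (fun h => cexp (cz z) * cz h).
  apply: cdiff_eq (cdiffD (cdiff_exp (cdiff_cz z)) (cdiff_cst z b%:C)) _ => h.
  by rewrite /cst; ring.
have := simple_zero h; rewrite cexp_neq0 orbT => /(_ isT).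
by apply: filterS => x hx; rewrite dwFE mulf_neq0 ?expf_neq0 ?cexp_neq0.
Qed.

Lemma iso_G (b : R) z : \forall x \near z^', dwG b x != 0.
Proof.
have h : cdiff z (fun z => 1 + b%:C * cz z) (fun h => b%:C * cz h).
  apply: cdiff_eq (cdiffD (cdiff_cst z 1) (cdiffM (cdiff_cst z b%:C) (cdiff_cz z))) _ => h.
  by rewrite /cst; ring.
have hn : (1 + b%:C * cz z != 0) || (b%:C != 0 :> R[i]).
  by have [->|b0] := eqVneq b 0; [rewrite rC_0 mul0r addr0 oner_neq0|rewrite rC_eq0 b0 orbT].
have := simple_zero h hn.
by apply: filterS => x hx; rewrite mulf_neq0.
Qed.

Lemma fam_member t : zmc_planar_member setT (fam t).
Proof.
have [t1|t1] := leP t 1.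
  rewrite fam_left//; set k := 1 - clamp01 t; set b := pospart (- t).
  apply: (@member R (wF b) (dwF b) (fun z => k%:C * phF b z) (fun z => k%:C * dphF b z)).
  - exact: hol_wF.
  - apply: hol_eqr (holM (hol_cst k%:C) (@hol_phF R b)) => z _; rewrite /cst; ring.
  - exact: Hol_dwF.
  - exact: (HolM oT (Hol_cst oT k%:C) (@Hol_dphF R b)).
  - exact: iso_F.
  have [k0|k0] := eqVneq k 0; [left|right].
    by move=> z; rewrite k0 rC_0 mul0r.
  exists (- k); split; [by rewrite oppr_eq0| |exact: axis_planes_F].
  move=> z n0; rewrite (hopf_scale k (dwF b) z (@Hol_dphF R b)) hopf_F//.
  by rewrite mulrN1 rC_N.
have [t2|t2] := leP 2 t.
  rewrite fam_right//; set k := clamp01 (t - 2); set b := pospart (t - 3).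
  apply: (@member R (wG b) (dwG b) (fun z => k%:C * phG b z) (fun z => k%:C * dphG b z)).
  - exact: hol_wG.
  - apply: hol_eqr (holM (hol_cst k%:C) (@hol_phG R b)) => z _; rewrite /cst; ring.
  - exact: Hol_dwG.
  - exact: (HolM oT (Hol_cst oT k%:C) (@Hol_dphG R b)).
  - exact: iso_G.
  have [k0|k0] := eqVneq k 0; [left|right].
    by move=> z; rewrite k0 rC_0 mul0r.
  exists k; split; [exact: k0| |exact: axis_planes_G].
  by move=> z n0; rewrite (hopf_scale k (dwG b) z (@Hol_dphG R b)) hopf_G// mulr1.
(* Between the two flattenings the height is 0. Since k < 1, the derivative (1 - k) e^z + k of the
   horizontal part has only simple zeros. *)
set k := clamp01 (t - 1).
have kE : k = t - 1 by rewrite /k clamp_id//; lra.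
have famE : fam t = (fun z => emb (Re (cst 0 z : R[i])) ((1 - k)%:C * wF 0 z + k%:C * wG 0 z)).
  apply/funext => z; rewrite /fam /w_fam /ph_fam.
  rewrite (clamp_ge1 (x := t)); last by lra.
  rewrite (clamp_le0 (x := t - 2)); last by lra.
  rewrite (pospart_le0 (x := - t)); last by lra.
  rewrite (pospart_le0 (x := t - 3)); last by lra.
  by rewrite subrr rC_0 !mul0r addr0.
rewrite famE.
have h0 : hol setT (cst 0) (cst 0 : R * R -> R[i]) by exact: hol_cst.
apply: (@member R _ (fun z => (1 - k)%:C * dwF 0 z + k%:C * dwG 0 z) (cst 0) (cst 0)).
- apply: hol_eqr (holD (holM (hol_cst (1 - k)%:C) (@hol_wF R 0)) (holM (hol_cst k%:C) (@hol_wG R 0))) => z _.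
  rewrite /cst; ring.
- exact: h0.
- exact: (HolD oT (HolM oT (Hol_cst oT _) (@Hol_dwF R 0)) (HolM oT (Hol_cst oT _) (@Hol_dwG R 0))).
- exact: Hol_cst.
- move=> z.
  have h : cdiff z (fun z => (1 - k)%:C * cexp (cz z) + k%:C) (fun h => ((1 - k)%:C * cexp (cz z)) * cz h).
    apply: cdiff_eq (cdiffD (cdiffM (cdiff_cst z (1 - k)%:C) (cdiff_exp (cdiff_cz z))) (cdiff_cst z k%:C)) _ => h.
    by rewrite /cst; ring.
  have := simple_zero h; rewrite [X in _ || X](_ : _ = true) ?orbT; last first.
    rewrite mulf_neq0 ?cexp_neq0// rC_eq0 kE; lra.
  move=> /(_ isT); apply: filterS => x; rewrite /dwF /dwG mulr0 expr0n /= !rC_0.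
  by rewrite !mul0r !addr0 mulr1 mulr1.
- by left.
Qed.

Section Continuity.

(** Continuity jointly in the parameter and the point, from which uniformity on compact sets will
    follow. *)
Definition ccont (p : R * (R * R)) (F : R * (R * R) -> R[i]) :=
  {for p, continuous (@complex.Re R \o F)} /\ {for p, continuous (@complex.Im R \o F)}.

Lemma ccont_cst p a : ccont p (cst a).
Proof. by split; exact: cvg_cst. Qed.

Lemma ccontD p F G : ccont p F -> ccont p G -> ccont p (fun q => F q + G q).
Proof.
move=> [f1 f2] [g1 g2]; split.
  have -> : @complex.Re R \o (fun q => F q + G q) = (@complex.Re R \o F) \+ (@complex.Re R \o G).
    by apply/funext => q /=; rewrite ReD.
  exact: cvgD.
have -> : @complex.Im R \o (fun q => F q + G q) = (@complex.Im R \o F) \+ (@complex.Im R \o G).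
  by apply/funext => q /=; rewrite ImD.
exact: cvgD.
Qed.

Lemma ccontM p F G : ccont p F -> ccont p G -> ccont p (fun q => F q * G q).
Proof.
move=> [f1 f2] [g1 g2]; split.
  have -> : @complex.Re R \o (fun q => F q * G q) =
    (fun q => Re (F q) * Re (G q) - Im (F q) * Im (G q)).
    by apply/funext => q /=; rewrite ReM.
  by apply: cvgB; apply: cvgM.
have -> : @complex.Im R \o (fun q => F q * G q) =
  (fun q => Re (F q) * Im (G q) + Im (F q) * Re (G q)).
  by apply/funext => q /=; rewrite ImM.
by apply: cvgD; apply: cvgM.
Qed.

Lemma ccontN p F : ccont p F -> ccont p (fun q => - F q).
Proof.
move=> [f1 f2]; split.
  have -> : @complex.Re R \o (fun q => - F q) = (fun q => - Re (F q)).
    by apply/funext => q /=; rewrite ReN.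
  exact: cvgN.
have -> : @complex.Im R \o (fun q => - F q) = (fun q => - Im (F q)).
  by apply/funext => q /=; rewrite ImN.
exact: cvgN.
Qed.

Lemma ccont_exp p F : ccont p F -> ccont p (fun q => cexp (F q)).
Proof.
move=> [f1 f2].
have he : {for p, continuous (fun q => expR (Re (F q)))}.
  by apply: (@continuous_comp _ R R (fun q => Re (F q)) expR) => //; exact: continuous_expR.
have hc : {for p, continuous (fun q => cos (Im (F q)))}.
  exact: (cvg_comp _ _ f2 (@continuous_cos R _)).
have hs : {for p, continuous (fun q => sin (Im (F q)))}.
  exact: (cvg_comp _ _ f2 (@continuous_sin R _)).
by split; apply: cvgM.
Qed.

Lemma ccont_real p (g : R -> R) : continuous g -> ccont p (fun q => (g q.1)%:C).
Proof.
move=> cg; split; last exact: cvg_cst.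
by apply: (@continuous_comp _ R R (fun q : R * (R * R) => q.1) g); [exact: cvg_fst|exact: cg].
Qed.

Lemma ccont_cz p : ccont p (fun q => cz q.2).
Proof.
have h : {for p, continuous (fun q : R * (R * R) => q.2)} by exact: cvg_snd.
split.
  exact: (cvg_comp _ _ h cvg_fst).
exact: (cvg_comp _ _ h cvg_snd).
Qed.

Lemma continuous_max0 (g : R -> R) : continuous g -> continuous (fun t => Num.max 0 (g t)).
Proof.
by move=> cg t; apply: (@continuous_max R R (fun=> 0) g); [exact: cvg_cst|exact: cg].
Qed.

Lemma continuous_clamp (g : R -> R) : continuous g -> continuous (fun t => clamp01 (g t)).
Proof.
move=> cg; apply: continuous_max0 => t.
by apply: (@continuous_min R R (fun=> 1) g); [exact: cvg_cst|exact: cg].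
Qed.

Lemma continuous_affine (s c : R) : continuous (fun t : R => s * t + c).
Proof. by move=> t; apply: cvgD; [apply: cvgM; [exact: cvg_cst|exact: cvg_id]|exact: cvg_cst]. Qed.

End Continuity.
End Family.

(** * Joint continuity and uniform convergence on compact sets *)

Section FamilyContinuity.
Variable R : realType.
Implicit Types t : R.
Lemma fam_ccont (p : R * (R * R)) :
  ccont p (fun q => w_fam q.1 q.2) /\ ccont p (fun q => ph_fam q.1 q.2).
Proof.
have cN : continuous (fun t => pospart (- t)).
  have -> : (fun t => pospart (- t)) = (fun t => Num.max 0 ((-1) * t + 0)).
    by apply/funext => t; rewrite mulN1r addr0.
  exact: (@continuous_max0 R (fun t : R => (-1) * t + 0) (@continuous_affine R (-1) 0)).
have aff (c : R) : continuous (fun t : R => t - c).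
  have -> : (fun t : R => t - c) = (fun t : R => 1 * t + - c).
    by apply/funext => t; rewrite mul1r.
  exact: continuous_affine.
have c3 : continuous (fun t => pospart (t - 3)) by exact: (continuous_max0 (aff 3)).
have k1 : continuous (fun t => clamp01 (t - 1)) by exact: (continuous_clamp (aff 1)).
have k2 : continuous (fun t => clamp01 (t - 2)) by exact: (continuous_clamp (aff 2)).
have k0 : continuous (fun t => clamp01 t) by apply: continuous_clamp => t; exact: cvg_id.
have onem (g : R -> R) : continuous g -> continuous (fun t => 1 - g t).
  by move=> cg t; apply: cvgB; [exact: cvg_cst|exact: cg].
have mulc (g h : R -> R) : continuous g -> continuous h -> continuous (fun t => g t * h t).
  by move=> cg ch t; apply: cvgM; [exact: cg|exact: ch].
have cstc (c : R) : continuous (fun _ : R => c) by move=> t; exact: cvg_cst.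
have cE := ccont_exp (ccont_cz p).
have cEN := ccont_exp (ccontN (ccont_cz p)).
have cZ := ccont_cz p.
split.
  exact: (ccontD
    (ccontM (ccont_real p (onem _ k1))
       (ccontD (ccontD cE (ccontM (ccont_real p (mulc _ _ (cstc 2) cN)) cZ))
          (ccontN (ccontM (ccont_real p (mulc _ _ cN cN)) cEN))))
    (ccontM (ccont_real p k1)
       (ccontD (ccontD cZ (ccontM (ccont_real p c3) (ccontM cZ cZ)))
          (ccontM (ccont_real p (mulc _ _ (mulc _ _ c3 c3) (cstc 3^-1)))
             (ccontM cZ (ccontM cZ cZ)))))).
exact: (ccontD
  (ccontM (ccont_real p (onem _ k0))
     (ccontD cZ (ccontN (ccontM (ccont_real p cN) cEN))))
  (ccontM (ccont_real p k2)
     (ccontD (ccontM (ccont_cst p _) (ccontM cZ cZ))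
        (ccontM (ccont_real p (mulc _ _ c3 (cstc 3^-1))) (ccontM cZ (ccontM cZ cZ)))))).
Qed.

Lemma fam_continuous (p : R * (R * R)) : {for p, continuous (fun q => fam q.1 q.2)}.
Proof.
have [[w1 w2] [p1 _]] := fam_ccont p.
have -> : (fun q => fam q.1 q.2) = (fun q => Re (ph_fam q.1 q.2) *: e03 R
    + Re (w_fam q.1 q.2) *: e1 R + Im (w_fam q.1 q.2) *: e2 R).
  by apply/funext => q; rewrite /fam embE.
by apply: cvgD; [apply: cvgD|]; apply: cvgZr_tmp.
Qed.

(** A tube argument: near each point [z] of [K], the values at (t, z') and at (t0, z') are both
    within e / 2 of [Y t0 z], and compactness gives one neighbourhood of [t0] for all points. *)
Lemma uniform_of_joint (V : normedModType R) (Y : R -> R * R -> V) (t0 : R) (K : set (R * R)) :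
  compact K -> (forall z, K z -> {for (t0, z), continuous (fun q => Y q.1 q.2)}) ->
  {uniform K, Y t @[t --> t0] --> Y t0}.
Proof.
move=> cK cY.
move=> Q /uniform_nbhs [E [entE sub]].
have := entE; rewrite -entourage_ballE => -[e /= e0 he].
have H : \forall t \near t0, K `<=` [set z | ball (Y t0 z) e (Y t z)].
  move/compact_near_coveringP : cK => /(_ R (nbhs t0) (fun t z => ball (Y t0 z) e (Y t z)) _); apply => z Kz.
  have e20 : 0 < e / 2 by rewrite divr_gt0.
  have := cY z Kz _ (nbhsx_ballx (Y t0 z) _ e20).
  case => -[A B] /= [nA nB] AB.
  exists (B, A) => //= -[z' t] /= [Bz At].
  have h1 := AB (t, z') (conj At Bz).
  have h2 := AB (t0, z') (conj (nbhs_singleton nA) Bz).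
  exact: (ball_splitr h2 h1).
apply: filterS H => t Kt; apply: sub => z Kz; apply: he.
exact: Kt.
Qed.

Lemma fam_deformation : continuous_deformation `]-oo, +oo[ setT (@fam R).
Proof.
move=> t0 _ K cK _.
have H := uniform_of_joint cK (fun z _ => @fam_continuous (t0, z)).
move=> A /H hA; have {}hA : nbhs t0 (fun t => A (fam t)) := hA.
by rewrite nbhs_simpl /= /within /=; apply: filterS hA => t ht _.
Qed.

End FamilyContinuity.

Lemma connected_plane (R : realType) : connected [set: R * R].
Proof.
have -> : [set: R * R] = \bigcup_(h in [set: R * R]) ((fun t : R => t *: h) @` setT).
  apply/seteqP; split => // h _; exists h => //; exists 1 => //; exact: scale1r.
apply: bigcup_connected.
  by exists 0 => h _; exists 0 => //; exact: scale0r.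
move=> h _; apply: connected_continuous_connected; first by apply/connected_intervalP.
by apply: continuous_subspaceT => t; exact: scalel_continuous.
Qed.

Theorem theorem5p2 (R : realType) :
  exists (I : interval R) (D : set (R * R)) (X_ : R -> R * R -> 'cV[R]_4),
    [/\ domain D,
        continuous_deformation I D X_,
        (forall t : R, t \in I -> zmc_planar_member D (X_ t)) &
        (forall (S : set (R * R)) (X : R * R -> 'cV[R]_4),
           domain S -> simply_connected S -> zmc_planar_on S X ->
           exists2 t : R, t \in I & congruent_to_piece_of S X D (X_ t))].
Proof.
exists `]-oo, +oo[, setT, (@fam R); split.
- split; [exact: openT| |by exists 0].
  exact: connected_plane.
- exact: fam_deformation.
- by move=> t _; exact: fam_member.
move=> S X domS scS zX.
have [eps [f [P [W [eps1 [Hf HP] [f0 hW] [hl pl] XE]]]]] := zmc_data domS zX.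
have [oS cS S0] := domS.
have [[b b0 m]|[b b0 m]|m] := classification oS scS S0 Hf HP f0 hW hl pl.
(* At t = - b <= 0 the height factor is 1 and the member is F_b. *)
- exists (- b) => //.
  apply: (congruent_of_matches eps1 oS m XE).
  + move=> z; rewrite fam_left; last by lra.
    by rewrite opprK pospart_ge0// clamp_le0 ?subr0 ?rC_1 ?mul1r// oppr_le0.
  + exact: tw_wF.
  + exact: tw_phF.
(* From t = 3 on, the height of the right-hand models is at full scale. *)
- exists (b + 3) => //.
  apply: (congruent_of_matches eps1 oS m XE).
  + move=> z; rewrite fam_right; last by lra.
    rewrite addrK pospart_ge0// clamp_ge1 ?rC_1 ?mul1r//; lra.
  + exact: tw_wG.
  + exact: tw_phG.
(* At t = 2 the height is 0 and the horizontal part is z itself, which is the plane of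
   [matches_plane]. *)
- exists 2 => //.
  apply: (congruent_of_matches eps1 oS m XE).
  + move=> z; rewrite fam_right// subrr clamp_le0// rC_0 mul0r pospart_le0; last by lra.
    by rewrite /wG expr2 !mul0r !addr0.
  + by move=> s; rewrite !ptK.
  + by move=> s; exact: (tw_real eps 0).
Qed.
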